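(* Let $N\ge2$. For any domain $\Omega\subsetneq\mathbb{R}^N$, any $1<p<\infty$, and any $u\in C_0^\infty(\Omega)$, $$\frac1{\Xi(N,p)}\int_\Omega|\nabla u|^pdx=\left(\frac{p-1}p\right)^p\frac1{\Xi(N,p)}\int_\Omega\frac{|u|^p}{d_{\Omega,M,p}^p}dx+2\left(\frac{p-1}p\right)^{p-1}\mathcal S_\Omega\!\left[|u|^p\rho_\nu^{1-p}\right]+\int_\Omega\int_{S^{N-1}}C_p\!\left(\partial_\nu u,\ \rho_\nu^{\frac{p-1}p}\partial_\nu\!\left(\frac{u}{\rho_\nu^{\frac{p-1}p}}\right)\right)d\sigma(\nu)\,dx .$$ Also, for $\lambda\in\mathbb{R}$ such that $\Xi(N,\lambda)$ and $\Xi(N,\lambda+p)$ are positive and finite, $$\frac1{\Xi(N,\lambda)}\int_\Omega\frac{|\nabla u|^p}{d_{\Omega,M,\lambda}^\lambda}dx\ge\left|\frac{p+\lambda-1}p\right|^p\frac1{\Xi(N,\lambda+p)}\int_\Omega\frac{|u|^p}{d_{\Omega,M,\lambda+p}^{\lambda+p}}dx+2\,\frac{p+\lambda-1}p\left|\frac{p+\lambda-1}p\right|^{p-2}\mathcal S_\Omega\!\left[|u|^p\rho_\nu^{1-p-\lambda}\right]$$ $$+\int_\Omega\int_{S^{N-1}}\frac1{\rho_\nu^\lambda}\,C_p\!\left(\partial_\nu u,\ \rho_\nu^{\frac{p+\lambda-1}p}\partial_\nu\!\left(\frac{u}{\rho_\nu^{\frac{p+\lambda-1}p}}\right)\right)d\sigma(\nu)\,dx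 .$$
   Context: For $x,y\in\mathbb{R}$, $C_p(x,y)=|x|^p-|x-y|^p-p|x-y|^{p-2}(x-y)y$. For $\nu\in S^{N-1}$ and $x\in\Omega$, $\rho_\nu(x)=\inf\{|s|: s\in\mathbb{R},\ x+s\nu\notin\Omega\}$ is the distance from $x$ to $\partial\Omega$ along the line through $x$ in the direction $\nu$; $\partial_\nu$ is the directional derivative; $d\sigma$ is the normalized round measure on $S^{N-1}$. $\Xi(N,q)=\frac{\sqrt\pi\,\Gamma(\frac{N+q}2)}{\Gamma(\frac{q+1}2)\Gamma(\frac N2)}$, and the mean distance function is $d_{\Omega,M,q}(x)=\left(\Xi(N,q)\int_{S^{N-1}}\rho_\nu(x)^{-q}d\sigma(\nu)\right)^{-1/q}$, so that $d_{\Omega,M,q}(x)^{-q}=\Xi(N,q)\int_{S^{N-1}}\rho_\nu(x)^{-q}d\sigma(\nu)$ (this last formula being the meaning of $d_{\Omega,M,q}^{-q}$ when $q=0$). For $\nu\in S^{N-1}$ and $x'\in\nu^\perp\cong\mathbb{R}^{N-1}$, $[x',\nu]$ is the family of connected components of the intersection of $\Omega$ with the line $\{x'+s\nu:s\in\mathbb{R}\}$. For $\ell\in[x',\nu]$ let $m_\ell$ be the midpoint of $\ell$ if $\ell$ is bounded, and $m_\ell=\infty$ otherwise, with the convention $f(\infty)=0$ for compactly supported $f$. The $\nu$-skeleton is $\Sigma_\nu=\overline{\{m_\ell:\ell\in[x',\nu],x'\in\nu^\perp\}}\cap\Omega$, and $\mu_\nu$ is the Radon measure on $\Sigma_\nu$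 with $\int_{\Sigma_\nu}f\,d\mu_\nu=\int_{\nu^\perp}\sum_{\ell\in[x',\nu]}f(m_\ell)\,dx'$ for $f\in C_0(\Omega)$ (continuous with compact support). The spherical skeletal mean is $\mathcal S_\Omega[f]=\int_{S^{N-1}}\int_{\Sigma_\nu}f(m)\,d\mu_\nu(m)\,d\sigma(\nu)$, where the integrand may depend on $\nu$. The expression $t|t|^{p-2}$ is read as $0$ at $t=0$. *)

(* Defs.v *)
From HB Require Import structures.
From mathcomp Require Import all_boot all_order all_algebra.
From mathcomp Require Import all_classical all_reals all_analysis.
From mathcomp Require Import measurable_realfun.

Set Implicit Arguments.
Unset Strict Implicit.
Unset Printing Implicit Defensive.

Import Order.TTheory GRing.Theory Num.Theory.
Import numFieldNormedType.Exports.

Local Open Scope classical_set_scope.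
Local Open Scope ring_scope.

(* The sigma-algebra on row vectors is the product one, i.e. the one generated
   by the coordinates; as R is second countable it is the Borel one. *)
Section rV_measurable.
Context {R : realType} (n : nat).

Let coord (i : 'I_n) (x : 'rV[R]_n) : measurableTypeR R := x ord0 i.

Let rV_set0 : g_sigma_preimage coord set0.
Proof. exact: sigma_algebra0. Qed.

Let rV_setC A : g_sigma_preimage coord A -> g_sigma_preimage coord (~` A).
Proof. exact: sigma_algebraC. Qed.

Let rV_bigcup (F : _^nat) : (forall i, g_sigma_preimage coord (F i)) ->
  g_sigma_preimage coord (\bigcup_i (F i)).
Proof. exact: sigma_algebra_bigcup. Qed.

HB.instance Definition _ :=
  @isMeasurable.Build (measure_tuple_display default_measure_display)
    'rV[R]_n (g_sigma_preimage coord) rV_set0 rV_setC rV_bigcup.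

End rV_measurable.

Section rV_measurable_fun.
Context {R : realType} (n : nat).

Lemma measurable_rV_coord (i : 'I_n) :
  measurable_fun [set: 'rV[R]_n] (fun x : 'rV[R]_n => x ord0 i).
Proof.
move=> _ Y mY; rewrite setTI; apply: sub_sigma_algebra => /=.
rewrite -bigcup_seq/=; exists i => /=; first by rewrite mem_index_enum.
by exists Y => //; rewrite setTI.
Qed.

Lemma measurable_fun_rV d (T : measurableType d) (f : T -> 'rV[R]_n) :
  (forall i, measurable_fun [set: T] (fun t => f t ord0 i)) ->
  measurable_fun [set: T] f.
Proof.
move=> mf _ A mA; rewrite setTI; move: A mA.
suff H : (@measurable _ 'rV[R]_n) `<=` [set A | measurable (f @^-1` A)].
  by move=> A mA; exact: (H A mA).
apply: smallest_sub.
  split=> /=.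
  - by rewrite preimage_set0.
  - by move=> A mA; rewrite setTD preimage_setC; exact: measurableC.
  - by move=> F mF; rewrite preimage_bigcup; exact: bigcupT_measurable.
rewrite -bigcup_seq/= => A [i _ [B mB <-]] /=.
rewrite setTI -[X in measurable X]setTI.
exact: (mf i measurableT B mB).
Qed.

End rV_measurable_fun.

(* [pushforward], with the measurability proof as an argument so that the
   measure structure can be inferred. *)
Section image_measure.
Context d1 d2 (T1 : measurableType d1) (T2 : measurableType d2) (R : realType).
Variables (mu : {measure set T1 -> \bar R}) (f : T1 -> T2).
Variable mf : measurable_fun [set: T1] f.

Definition image_measure of measurable_fun [set: T1] f : set T2 -> \bar R :=
  pushforward mu f.

Let image0 : image_measure mf set0 = 0%E.
Proof. by rewrite /image_measure /pushforward preimage_set0 measure0. Qed.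

Let image_ge0 A : (0 <= image_measure mf A)%E.
Proof. exact: measure_ge0. Qed.

Let image_sigma_additive : semi_sigma_additive (image_measure mf).
Proof.
move=> F mF tF mUF; rewrite /image_measure /pushforward preimage_bigcup.
apply: measure_semi_sigma_additive.
- by move=> n; rewrite -[X in measurable X]setTI; exact: mf.
- apply/trivIsetP => /= i j _ _ ij; rewrite -preimage_setI.
  by move/trivIsetP : tF => /(_ _ _ _ _ ij) ->//; rewrite preimage_set0.
- by rewrite -preimage_bigcup -[X in measurable X]setTI; exact: mf.
Qed.

HB.instance Definition _ := isMeasure.Build _ _ _ (image_measure mf)
  image0 image_ge0 image_sigma_additive.

End image_measure.

(* n-dimensional Lebesgue measure: iterated product of the one-dimensional one,
   transported along R * R^n = R^(n+1). *)
Section lebesgue_rV.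
Context {R : realType}.

Definition rV_cons n (p : measurableTypeR R * 'rV[R]_n) : 'rV[R]_n.+1 :=
  \row_i oapp (p.2 ord0) p.1 (unlift ord0 i).

Lemma measurable_rV_cons n : measurable_fun setT (@rV_cons n).
Proof.
apply: measurable_fun_rV => i; rewrite /rV_cons.
under eq_fun do rewrite mxE.
case: (unliftP ord0 i) => [j|] _ /=; last exact: measurable_fst.
exact: (measurableT_comp (measurable_rV_coord j)).
Qed.

Let uncons n (x : 'rV[R]_n.+1) : measurableTypeR R * 'rV[R]_n :=
  (x ord0 ord0, \row_i x ord0 (lift ord0 i)).

Let measurable_uncons n : measurable_fun setT (@uncons n).
Proof.
apply/measurable_fun_pairP; split; first exact: measurable_rV_coord.
apply: measurable_fun_rV => i.
rewrite (_ : (fun _ => _) = fun x : 'rV[R]_n.+1 => x ord0 (lift ord0 i)).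
  exact: measurable_rV_coord.
by apply/funext => x /=; rewrite mxE.
Qed.

Let rV_consK n : cancel (@rV_cons n) (@uncons n).
Proof.
move=> [a x]; congr pair; first by rewrite mxE unlift_none.
by apply/rowP => i; rewrite !mxE liftK.
Qed.

Section step.
Variables (n : nat) (mu : {sigma_finite_measure set 'rV[R]_n -> \bar R}).

Definition lebesgue_rV_step : set 'rV[R]_n.+1 -> \bar R :=
  image_measure (@lebesgue_measure R \x mu)%E (@measurable_rV_cons n).

HB.instance Definition _ := Measure.on lebesgue_rV_step.

Let step_sigma_finite : sigma_finite setT lebesgue_rV_step.
Proof.
have /sigma_finiteP[F [TF ndF Foo]] := sigma_finiteT (@lebesgue_measure R).
have /sigma_finiteP[G [TG ndG Goo]] := sigma_finiteT mu.
exists (fun k => @uncons n @^-1` (F k `*` G k)).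
  rewrite -preimage_bigcup (_ : \bigcup_k _ = setT) ?preimage_setT//.
  rewrite -subTset => -[a x] _.
  have [i _ Fi] : (\bigcup_k F k) a by rewrite -TF.
  have [j _ Gj] : (\bigcup_k G k) x by rewrite -TG.
  exists (maxn i j) => //; split => /=.
  - by move: Fi; exact/subsetPset/ndF/leq_maxl.
  - by move: Gj; exact/subsetPset/ndG/leq_maxr.
move=> k; have [mF Foo'] := Foo k; have [mG Goo'] := Goo k; split.
  rewrite -[X in measurable X]setTI.
  by apply: measurable_uncons => //; exact: measurableX.
rewrite /lebesgue_rV_step /image_measure /pushforward -comp_preimage.
rewrite (_ : _ \o _ = id); last by apply/funext => p /=; rewrite rV_consK.
rewrite preimage_id.
by rewrite /= product_measure1E// lte_mul_pinfty// ge0_fin_numE.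
Qed.

HB.instance Definition _ :=
  Measure_isSigmaFinite.Build _ _ _ lebesgue_rV_step step_sigma_finite.

End step.

Fixpoint lebesgue_rV n : {sigma_finite_measure set 'rV[R]_n -> \bar R} :=
  if n is m.+1 then lebesgue_rV_step (lebesgue_rV m)
  else \d_(0 : 'rV[R]_0).

End lebesgue_rV.

Section euclidean.
Context {R : realType} {N : nat}.
Implicit Types x y nu : 'rV[R]_N.

Definition dotp x y : R := \sum_i x ord0 i * y ord0 i.

(* The library norm of 'rV[R]_N is the sup norm. *)
Definition enorm x : R := Num.sqrt (dotp x x).

Definition usphere : set 'rV[R]_N := [set nu | enorm nu = 1].

Definition unit_ball : set 'rV[R]_N := [set x | enorm x <= 1].

Definition radial x : 'rV[R]_N := (enorm x)^-1 *: x.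

Lemma measurable_enorm : measurable_fun [set: 'rV[R]_N] enorm.
Proof.
apply: (measurableT_comp (continuous_measurable_fun (@sqrt_continuous R))).
rewrite /dotp; apply: measurable_sum => i.
by apply: measurable_funM; exact: measurable_rV_coord.
Qed.

Lemma measurable_unit_ball : measurable unit_ball.
Proof.
rewrite (_ : unit_ball = [set: 'rV[R]_N] `&` enorm @^-1` `]-oo, 1]).
  by apply: measurable_enorm.
by rewrite setTI; apply/seteqP; split => x /=; rewrite in_itv.
Qed.

Lemma measurable_radial : measurable_fun [set: 'rV[R]_N] radial.
Proof.
apply: measurable_fun_rV => i.
rewrite (_ : (fun _ => _) = fun x : 'rV[R]_N => (enorm x)^-1 * x ord0 i).
  apply: measurable_funM; last exact: measurable_rV_coord.
  rewrite (_ : (fun _ => _) = fun x => (enorm x) `^ (-1)).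
    exact: (measurableT_comp (measurable_powR (-1)) measurable_enorm).
  by apply/funext => x; rewrite powR_inv1// sqrtr_ge0.
by apply/funext => x; rewrite mxE.
Qed.

End euclidean.

(* Normalized round measure on the unit sphere, as a measure on R^N: the image
   under x |-> x / |x| of the normalized Lebesgue measure of the unit ball. The
   last argument of mnormalize is a default value which is not used, the ball
   having positive finite measure. *)
Definition sphere_measure (R : realType) (N : nat) :
    probability 'rV[R]_N R :=
  mnormalize
    (image_measure (mrestr (@lebesgue_rV R N) measurable_unit_ball)
                   (@measurable_radial R N))
    (\d_(0 : 'rV[R]_N)).

Section powers.
Context {R : realType}.

Definition Cp (p x y : R) : R :=
  `|x| `^ p - `|x - y| `^ p - p * `|x - y| `^ (p - 2) * (x - y) * y.

(* Powers on [0, +oo], with 0 `^ r = +oo and +oo `^ r = 0 for r < 0, and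
   x `^ 0 = 1; the library power poweR only has this meaning for r >= 0. *)
Definition epow (x : \bar R) (r : R) : \bar R :=
  if 0 <= r then (x `^ r)%E else ((x `^ (- r))^-1)%E.

(* Euler's integral; it is +oo for x <= 0. *)
Definition Euler_Gamma (x : R) : \bar R :=
  (\int[lebesgue_measure]_(t in `]0%R, +oo[) (t `^ (x - 1) * expR (- t))%:E)%E.

(* The Gamma function on the whole real line, continued to x <= 0 by
   Gamma(x) = Gamma(x + n) / (x (x + 1) ... (x + n - 1)), with n the least
   natural number such that x + n >= 0; its value is +oo at the poles
   0, -1, -2, ... *)
Definition Gamma (x : R) : \bar R :=
  let n := if 0 < x then 0%N else `|Num.floor x|%N in
  if x + n%:R == 0 then +oo%E
  else (Euler_Gamma (x + n%:R) / (\prod_(k < n) (x + k%:R))%:E)%E.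

Definition Xi (N : nat) (q : R) : \bar R :=
  ((Num.sqrt pi)%:E * Gamma ((N%:R + q) / 2)
    / (Gamma ((q + 1) / 2) * Gamma (N%:R / 2)))%E.

End powers.

Section functions.
Context {R : realType} {N : nat}.
Implicit Types (Omega : set 'rV[R]_N) (f : 'rV[R]_N -> R).

Definition partial (i : 'I_N) f : 'rV[R]_N -> R :=
  fun x => 'D_(delta_mx ord0 i) f x.

Definition grad f (x : 'rV[R]_N) : 'rV[R]_N := \row_i partial i f x.

Fixpoint class_C (k : nat) f : Prop :=
  continuous f /\
  if k is k'.+1 then
    (forall i x, derivable f x (delta_mx ord0 i)) /\
    (forall i, class_C k' (partial i f))
  else True.

Definition smooth f : Prop := forall k, class_C k f.

Definition supp f : set 'rV[R]_N := closure [set x | f x != 0].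

(* A compactly supported function on Omega is identified with its extension
   by 0 to R^N. *)
Definition compactly_supported_in Omega f : Prop :=
  compact (supp f) /\ supp f `<=` Omega.

Definition C0 Omega f : Prop := continuous f /\ compactly_supported_in Omega f.

Definition C0infty Omega f : Prop := smooth f /\ compactly_supported_in Omega f.

End functions.

Section hardy.
Context {R : realType} {N : nat}.
Variable Omega : set 'rV[R]_N.
Implicit Types (nu x m : 'rV[R]_N) (l : set 'rV[R]_N) (u : 'rV[R]_N -> R).

Definition domain : Prop := [/\ open Omega, connected Omega & Omega !=set0].

Definition rho nu x : \bar R :=
  ereal_inf [set `|s|%:E | s in [set s : R | ~ Omega (x + s *: nu)]].

Definition mean_dist_integral (q : R) x : \bar R :=
  (Xi N q * \int[sphere_measure R N]_(nu in usphere) epow (rho nu x) (- q))%E.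

Definition mean_dist (q : R) x : \bar R := epow (mean_dist_integral q x) (- q^-1).

(* d_{Omega,M,q} ^ (-q); as d_{Omega,M,0} is undefined, the integral formula is
   the meaning of this power for q = 0. *)
Definition mean_dist_powN (q : R) x : \bar R :=
  if q == 0 then mean_dist_integral q x else epow (mean_dist q x) (- q).

Definition line nu x : set 'rV[R]_N := [set x + s *: nu | s in [set: R]].

(* [x', nu] *)
Definition chords nu x : set (set 'rV[R]_N) :=
  [set connected_component (Omega `&` line nu x) y | y in Omega `&` line nu x].

(* The midpoint m_l; None stands for infinity. *)
Definition midpoint nu x l : option 'rV[R]_N :=
  let S := [set s : R | l (x + s *: nu)] in
  if `[< bounded_set l >] then Some (x + ((inf S + sup S) / 2) *: nu) else None.

Definition eval_infty (f : 'rV[R]_N -> R) (m : option 'rV[R]_N) : R := oapp f 0 m.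

Definition perp nu : set 'rV[R]_N := [set x | dotp x nu = 0].

(* The rows form an orthonormal basis of the hyperplane orthogonal to nu (for
   nu a unit vector), so that y |-> y *m perp_frame nu is an isometry of
   R^(N-1) onto this hyperplane; integrals do not depend on the choice. *)
Definition perp_frame nu : 'M[R]_(N.-1, N) :=
  xget 0 [set B | B *m B^T = 1%:M /\ forall i, perp nu (row i B)].

Definition perp_integral nu (g : 'rV[R]_N -> \bar R) : \bar R :=
  (\int[@lebesgue_rV R N.-1]_y g (y *m perp_frame nu))%E.

Definition skeleton nu : set 'rV[R]_N :=
  closure [set m | exists x l,
    [/\ perp nu x, chords nu x l & midpoint nu x l = Some m]] `&` Omega.

(* mu is a Radon measure on R^N carried by the nu-skeleton. The sum over the
   chords is a finite one, as f is compactly supported in Omega. *)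
Definition is_skeletal_measure nu (mu : {measure set 'rV[R]_N -> \bar R}) : Prop :=
  [/\ mu (~` skeleton nu) = 0%E,
      forall K, compact K -> K `<=` skeleton nu -> (mu K < +oo)%E
    & forall f, C0 Omega f ->
      (\int[mu]_(m in skeleton nu) (f m)%:E)%E =
      perp_integral nu
        (fun x => (\sum_(l \in chords nu x) eval_infty f (midpoint nu x l))%:E)].

(* The measure mu_nu: it exists, and is unique by Riesz' theorem. *)
Definition skeletal_measure nu : {measure set 'rV[R]_N -> \bar R} :=
  if pselect (exists mu, is_skeletal_measure nu mu) is left ex
  then projT1 (cid ex) else mzero.

Definition skeletal_mean (f : 'rV[R]_N -> 'rV[R]_N -> \bar R) : \bar R :=
  (\int[sphere_measure R N]_(nu in usphere)
     \int[skeletal_measure nu]_(m in skeleton nu) f nu m)%E.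

(* rho_nu ^ a * d_nu (u / rho_nu ^ a). On a line contained in Omega, where
   rho_nu is constantly +oo, the two constant factors cancel. *)
Definition weighted_derive nu (a : R) u x : R :=
  if rho nu x == +oo%E then 'D_nu u x
  else fine (rho nu x) `^ a * 'D_nu (fun y => u y / fine (rho nu y) `^ a) x.

End hardy.

(* Main.v *)
(* On a line of direction nu, parametrize half of a chord by its distance t to
   the boundary, so that rho_nu = t, and write b = (p + lambda - 1) / p. By the
   definition of C_p,
     t^-lambda |f'|^p - |b|^p |f|^p t^(-lambda-p)
       - t^-lambda C_p (f', t^b (f / t^b)')
   is the derivative of b |b|^(p-2) |f|^p t^(1-p-lambda), which vanishes near
   the endpoint and takes its boundary value at the midpoint of the chord: the
   two halves of the chord give the skeletal term. Integrating over all chords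
   (Tonelli) and over nu gives the theorem for lambda = 0, where the integral of
   |nu . v|^p over the sphere is |v|^p / Xi(N,p), and |nu . v| <= |v| gives the
   inequality for general lambda. Terms of negative sign are kept on the other
   side, so that all the integrals are in [0, +oo] and no integrability is
   needed; the only subtraction is the final one.

   The skeletal measure is realized as the image, under the map sending a point
   to the midpoint of its chord, of a density on Omega of total mass 1 on each
   bounded chord; it is unique since functions in C_0(Omega) determine it. The
   constant Xi(N,p) comes from integrating |x_0|^p exp (-|x|^2) over R^N. *)

Require Import Defs.
From HB Require Import structures.
From mathcomp Require Import all_boot all_order all_algebra.
From mathcomp Require Import all_classical all_reals all_analysis.
From mathcomp Require Import measurable_realfun.
From mathcomp Require Import ring lra.

Set Implicit Arguments.
Unset Strict Implicit.
Unset Printing Implicit Defensive.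

Import Order.TTheory GRing.Theory Num.Theory.
Import numFieldNormedType.Exports.

Local Open Scope classical_set_scope.
Local Open Scope ring_scope.

(** All the integrands are built from the one-sided exit times in the directions [nu] and [- nu]:
    these are jointly measurable in direction and point and vary affinely along a chord, and [rho]
    is their minimum. The derivative in the last term need not exist at midpoints; on [Omega] it
    equals an explicit measurable function, and the open half chords avoid the midpoint.

    Spreading the value at a midpoint over its chord turns the skeletal term into an integral over
    [Omega]. The identity thus becomes an equality of two nonnegative integrals on each chord, and
    as each line has countably many chords it adds up to lines and, by Tonelli, to [Omega].

    A line contained in [Omega] has [rho = +oo]; for negative [lambda] both sides may then be
    infinite.

    Rotation invariance of Lebesgue measure is deduced from the uniqueness of translation-invariant
    measures. For [Xi], the Gaussian integrals of |x_0|^p and of 1 are each evaluated by coordinates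
    and by homogeneity; the Gaussian factor of the other coordinates cancels between the two. *)

(** * Lebesgue measure on row vectors *)

Section lebesgue_line.
Context {R : realType}.
Local Open Scope ereal_scope.
Notation leb := (@lebesgue_measure R).

Let shift (c : R) (s : measurableTypeR R) : measurableTypeR R := (c + s)%R.

Let measurable_shift c : measurable_fun setT (shift c).
Proof. exact: measurable_funD. Qed.

Lemma lebesgue_shift (c : R) (A : set (measurableTypeR R)) : measurable A ->
  pushforward leb (fun s : measurableTypeR R => (c + s)%R : measurableTypeR R) A =
  leb A.
Proof.
move=> mA; rewrite [RHS](@lebesgue_measure_unique R
  (image_measure leb (measurable_shift c)))//.
move=> X [[a b] _ <-].
rewrite /image_measure /pushforward/=.
rewrite (_ : _ @^-1` _ = `]a - c, b - c]%classic)%R.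
  rewrite !lebesgue_measure_itv/= !lte_fin ltrD2r.
  by case: ifP => // _; rewrite -!EFinB; congr EFin; ring.
by apply/seteqP; split => s /=; rewrite !in_itv/= /shift => /andP[? ?]; apply/andP; split; lra.
Qed.

Lemma ge0_integral_shift (c : R) (f : R -> \bar R) :
  measurable_fun [set: R] f -> (forall x, 0 <= f x) ->
  \int[leb]_s f (c + s)%R = \int[leb]_s f s.
Proof.
move=> mf f0.
rewrite -(@ge0_integral_pushforward _ _ _ _ _ _ (measurable_shift c) leb setT f)//.
by apply: eq_measure_integral => A mA _; exact: lebesgue_shift.
Qed.

Lemma ge0_integral_opp (f : R -> \bar R) :
  measurable_fun [set: R] f -> (forall x, 0 <= f x) ->
  \int[leb]_s f (- s)%R = \int[leb]_s f s.
Proof.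
move=> mf f0.
have mo : measurable_fun [set: measurableTypeR R] (-%R : _ -> measurableTypeR R).
  exact: oppr_measurable.
rewrite -(@ge0_integral_pushforward _ _ _ _ _ _ mo leb setT f)//.
by apply: eq_measure_integral => A mA _; exact: lebesgue_measureN.
Qed.

End lebesgue_line.

Section lebesgue_rV.
Context {R : realType}.
Local Open Scope ereal_scope.
Notation leb := (@lebesgue_measure R).

Lemma ge0_integral_lebesgue_rVS n (f : 'rV[R]_n.+1 -> \bar R) :
  measurable_fun setT f -> (forall x, 0 <= f x) ->
  \int[lebesgue_rV n.+1]_x f x =
  \int[leb]_s \int[lebesgue_rV n]_y f (rV_cons (s, y)).
Proof.
move=> mf f0; rewrite [LHS]/=.
rewrite (@ge0_integral_pushforward _ _ _ _ _ _ (@measurable_rV_cons R n)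
  (leb \x lebesgue_rV n) setT f)// preimage_setT.
rewrite (@fubini_tonelli1 _ _ _ _ _ leb (lebesgue_rV n) (f \o @rV_cons R n))//.
  exact: measurableT_comp mf (@measurable_rV_cons R n).
by move=> z; exact: f0.
Qed.

Lemma ge0_integral_lebesgue_rVS2 n (f : 'rV[R]_n.+1 -> \bar R) :
  measurable_fun setT f -> (forall x, 0 <= f x) ->
  \int[lebesgue_rV n.+1]_x f x =
  \int[lebesgue_rV n]_y \int[leb]_s f (rV_cons (s, y)).
Proof.
move=> mf f0; rewrite ge0_integral_lebesgue_rVS//.
rewrite (@fubini_tonelli _ _ _ _ _ leb (lebesgue_rV n) (f \o @rV_cons R n))//.
  exact: measurableT_comp mf (@measurable_rV_cons R n).
by move=> z; exact: f0.
Qed.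

Lemma measurable_rV_mulmx n m (A : 'M[R]_(n, m)) :
  measurable_fun [set: 'rV[R]_n] (fun x => x *m A).
Proof.
apply: measurable_fun_rV => i; under eq_fun do rewrite mxE.
apply: measurable_sum => j; apply: measurable_funM; last exact: measurable_cst.
exact: measurable_rV_coord.
Qed.

Lemma measurable_rVD d (T : measurableType d) n (f g : T -> 'rV[R]_n) :
  measurable_fun setT f -> measurable_fun setT g ->
  measurable_fun setT (fun t => f t + g t)%R.
Proof.
move=> mf mg; apply: measurable_fun_rV => i; under eq_fun do rewrite mxE.
apply: measurable_funD.
  exact: (measurableT_comp (measurable_rV_coord i) mf).
exact: (measurableT_comp (measurable_rV_coord i) mg).
Qed.

Lemma measurable_rVZ d (T : measurableType d) n (f : T -> R) (g : T -> 'rV[R]_n) :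
  measurable_fun setT f -> measurable_fun setT g ->
  measurable_fun setT (fun t => f t *: g t)%R.
Proof.
move=> mf mg; apply: measurable_fun_rV => i; under eq_fun do rewrite mxE.
apply: measurable_funM => //.
exact: (measurableT_comp (measurable_rV_coord i) mg).
Qed.

Lemma measurable_rVN d (T : measurableType d) n (g : T -> 'rV[R]_n) :
  measurable_fun setT g -> measurable_fun setT (fun t => - g t)%R.
Proof.
move=> mg; under eq_fun do rewrite -scaleN1r.
by apply: measurable_rVZ => //; exact: measurable_cst.
Qed.

Lemma ge0_integral_rV_shift n (c : 'rV[R]_n) (f : 'rV[R]_n -> \bar R) :
  measurable_fun setT f -> (forall x, 0 <= f x) ->
  \int[lebesgue_rV n]_x f (c + x)%R = \int[lebesgue_rV n]_x f x.
Proof.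
elim: n c f => [|n IH] c f mf f0.
  by apply: eq_integral => x _; congr f; rewrite [LHS]thinmx0 [RHS]thinmx0.
have mfc : measurable_fun [set: 'rV[R]_n.+1] (fun x => f (c + x)%R).
  by apply: measurableT_comp mf _; apply: measurable_rVD => //; exact: measurable_cst.
rewrite [LHS](ge0_integral_lebesgue_rVS mfc (fun x => f0 _)).
rewrite [RHS](ge0_integral_lebesgue_rVS mf f0).
pose c' : 'rV[R]_n := \row_i c ord0 (lift ord0 i).
have E s y : (c + rV_cons (s, y) = rV_cons ((c ord0 ord0 + s)%R : measurableTypeR R, c' + y))%R.
  apply/rowP => i; rewrite !mxE; case: (unliftP ord0 i) => [j|] -> /=; by rewrite ?mxE.
under eq_integral do under eq_integral do rewrite E.
under eq_integral => s _.
  rewrite (IH c' (fun y => f (rV_cons ((c ord0 ord0 + s)%R : measurableTypeR R, y))))//; last first.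
    apply: measurableT_comp mf _; apply: measurableT_comp (@measurable_rV_cons R n) _.
    exact: pair1_measurable.
  over.
apply: (@ge0_integral_shift R (c ord0 ord0) (fun s => \int[lebesgue_rV n]_y f (rV_cons (s, y)))).
  apply: (@measurable_fun_fubini_tonelli_F _ _ _ _ _ (lebesgue_rV n) (f \o @rV_cons R n)) => //.
  exact: measurableT_comp mf (@measurable_rV_cons R n).
  by move=> s; exact: f0.
by move=> s; apply: integral_ge0 => y _; exact: f0.
Qed.

End lebesgue_rV.

(** * Uniqueness of translation-invariant measures up to a factor *)

Section haar.
Context {R : realType}.
Local Open Scope ereal_scope.
Notation leb := (@lebesgue_measure R).

Definition translation_invariant n (m : {measure set 'rV[R]_n -> \bar R}) :=
  forall (c : 'rV[R]_n) (f : 'rV[R]_n -> \bar R),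
    measurable_fun setT f -> (forall x, 0 <= f x) ->
    \int[m]_x f (c + x)%R = \int[m]_x f x.

Lemma measurable_indicE n (A : set 'rV[R]_n) : measurable A ->
  measurable_fun setT (fun x => (\1_A x : R)%:E).
Proof. by move=> mA; apply/measurable_EFinP; exact: measurable_indic. Qed.

(** Both sides are the integral of 1_A(x) 1_E(x + y) for the product of [m] and Lebesgue measure.
    Integrating first in y gives the left-hand side. Translating x by -y first turns the integrand
    into 1_A(x - y) 1_E(x), whose integral in y is the measure of -A. With a fixed [E] of positive
    finite measure, [m] is determined up to a factor. *)
Lemma translation_invariant_prop n (m : {sigma_finite_measure set 'rV[R]_n -> \bar R})
    (A E : set 'rV[R]_n) : translation_invariant m -> measurable A -> measurable E ->
  m A * lebesgue_rV n E = m E * lebesgue_rV n (-%R @^-1` A).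
Proof.
move=> minv mA mE.
have mNA : measurable (-%R @^-1` A : set 'rV[R]_n).
  rewrite -[X in measurable X]setTI; apply: measurable_rVN => //; exact: measurable_id.
have m1A := measurable_indicE mA; have m1E := measurable_indicE mE.
have m2x : measurable_fun setT (fun z : 'rV[R]_n * 'rV[R]_n => z.1).
  exact: measurable_fst.
have m2y : measurable_fun setT (fun z : 'rV[R]_n * 'rV[R]_n => z.2).
  exact: measurable_snd.
transitivity (\int[m]_x \int[lebesgue_rV n]_y
    ((\1_A x : R)%:E * (\1_E (x + y)%R : R)%:E)).
  under [RHS]eq_integral => x _.
    rewrite (@ge0_integralZl_EFin _ _ _ (lebesgue_rV n) setT _ _ _ _)//=; last first.
      by apply: measurableT_comp m1E _; apply: measurable_rVD => //; exact: measurable_cst.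
    rewrite (ge0_integral_rV_shift x m1E)// integral_indic// setIT.
    over.
  rewrite ge0_integralZr ?measure_ge0//.
  by rewrite integral_indic// setIT.
rewrite (@fubini_tonelli _ _ _ _ _ m (lebesgue_rV n) (fun z =>
    (\1_A z.1 : R)%:E * (\1_E (z.1 + z.2)%R : R)%:E))/=; last 2 first.
- apply: emeasurable_funM; first exact: measurableT_comp m1A m2x.
  by apply: measurableT_comp m1E _; exact: measurable_rVD.
- by move=> z; rewrite mule_ge0// lee_fin.
transitivity (\int[lebesgue_rV n]_y \int[m]_x
    ((\1_A (x - y)%R : R)%:E * (\1_E x : R)%:E)).
  apply: eq_integral => y _.
  rewrite -[RHS](minv y); last 2 first.
  - apply: emeasurable_funM => //; apply: measurableT_comp m1A _.
    apply: measurable_rVD; [exact: measurable_id|exact: measurable_cst].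
  - by move=> x; rewrite mule_ge0// lee_fin.
  by apply: eq_integral => x _; rewrite addrAC subrr add0r addrC.
rewrite -(@fubini_tonelli _ _ _ _ _ m (lebesgue_rV n) (fun z =>
    (\1_A (z.1 - z.2)%R : R)%:E * (\1_E z.1 : R)%:E))/=; last 2 first.
- apply: emeasurable_funM; last exact: measurableT_comp m1E m2x.
  by apply: measurableT_comp m1A _; apply: measurable_rVD => //; exact: measurable_rVN.
- by move=> z; rewrite mule_ge0// lee_fin.
under eq_integral => x _.
  under eq_integral do rewrite muleC.
  rewrite (@ge0_integralZl_EFin _ _ _ (lebesgue_rV n) setT _ _ _ _)//=; last first.
    apply: measurableT_comp m1A _; apply: measurable_rVD; first exact: measurable_cst.
    by apply: measurable_rVN; exact: measurable_id.
  rewrite (_ : (fun y => _) = (fun y => (fun z => (\1_(-%R @^-1` A) z : R)%:E) ((- x) + y)%R)); last first.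
    apply/funext => y /=; rewrite !indicE; congr (nat_of_bool _)%:R%:E.
    by apply/idP/idP => /set_mem h; apply/mem_set; move: h; rewrite /= opprD opprK.
  rewrite (ge0_integral_rV_shift _ (measurable_indicE mNA))// integral_indic// setIT.
  over.
rewrite ge0_integralZr ?measure_ge0//.
by rewrite integral_indic// setIT.
Qed.

Lemma lebesgue_rV_invariant n : translation_invariant (@lebesgue_rV R n).
Proof. by move=> c f; exact: ge0_integral_rV_shift. Qed.

Definition cube n (r : R) : set 'rV[R]_n := [set x | forall i, `|x ord0 i|%R <= r]%R.
Arguments cube : clear implicits.

Lemma measurable_cube n r : measurable (cube n r).
Proof.
rewrite (_ : cube n r = \bigcap_(i in [set: 'I_n])
    ((fun x : 'rV[R]_n => x ord0 i) @^-1` `[(- r)%R, r])).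
  apply: fin_bigcap_measurable => // i _; rewrite -[X in measurable X]setTI.
  exact: measurable_rV_coord.
apply/seteqP; split => x /=.
  by move=> h i _ /=; rewrite in_itv/= -ler_norml.
by move=> h i; have := h i I; rewrite /= in_itv/= -ler_norml.
Qed.

Lemma lebesgue_cube n r : (0 <= r)%R -> lebesgue_rV n (cube n r) = ((2 * r) ^+ n)%:E.
Proof.
move=> r0; elim: n => [|n IH].
  by rewrite expr0/= diracE mem_set// => -[].
rewrite -[cube n.+1 r]setIT -integral_indic//; last exact: measurable_cube.
have m1 k := @measurable_indicE k _ (@measurable_cube k r).
rewrite [LHS](ge0_integral_lebesgue_rVS (m1 _))//.
transitivity (\int[leb]_s ((\1_(`[(-r)%R, r]%classic) s : R)%:E * ((2 * r) ^+ n)%:E)).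
  apply: eq_integral => s _.
  rewrite -IH -[cube n r]setIT -integral_indic//; last exact: measurable_cube.
  rewrite -ge0_integralZl//; last exact: m1.
  apply: eq_integral => y _; rewrite -EFinM; congr EFin; rewrite /indic -natrM mulnb; congr (_%:R).
  congr nat_of_bool.
  apply/idP/andP => [/set_mem h|[/set_mem h1 /set_mem h2]]; last apply/mem_set.
    split; apply/mem_set.
      by have := h ord0; rewrite /= mxE unlift_none/= ler_norml in_itv.
    by move=> i; have := h (lift ord0 i); rewrite mxE liftK.
  move=> i; rewrite mxE; case: (unliftP ord0 i) => [j|] _ /=; first exact: h2.
  by move: h1; rewrite /= in_itv/= -ler_norml.
rewrite ge0_integralZr ?lee_fin ?exprn_ge0 ?mulr_ge0//; last first.
  by apply/measurable_EFinP; exact: measurable_indic.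
rewrite integral_indic// setIT/= lebesgue_measure_itv/= lte_fin -EFinB.
case: ifPn => [_|]; first by rewrite -EFinM exprS; congr ((_ * _)%:E)%R; ring.
rewrite -leNgt => rr; have -> : r = 0%R by apply/eqP; lra.
by rewrite mul0e mulr0 expr0n.
Qed.

End haar.
Arguments cube {R} n r.

Section linear_image.
Context {R : realType} (n : nat).
Local Open Scope ereal_scope.
Variables (A B : 'M[R]_n).
Hypothesis (AB : A *m B = 1%:M).

(** The proof of invertibility is an argument so that the sigma-finite structure, which uses the
    inverse [B], can be inferred. *)
Definition linear_image of A *m B = 1%:M : set 'rV[R]_n -> \bar R :=
  image_measure (lebesgue_rV n) (measurable_rV_mulmx A).

HB.instance Definition _ := Measure.on (linear_image AB).

Let sigma_finite_linear_image : sigma_finite setT (linear_image AB).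
Proof.
have /sigma_finiteP[F [TF ndF Foo]] := sigma_finiteT (@lebesgue_rV R n).
exists (fun k => (fun x => x *m B) @^-1` F k).
  by rewrite -preimage_bigcup -TF preimage_setT.
move=> k; have [mF Foo'] := Foo k; split.
  by rewrite -[X in measurable X]setTI; exact: measurable_rV_mulmx.
rewrite /linear_image /image_measure /pushforward -comp_preimage.
rewrite (_ : _ \o _ = id) ?preimage_id//.
by apply/funext => x /=; rewrite -mulmxA AB mulmx1.
Qed.

HB.instance Definition _ :=
  Measure_isSigmaFinite.Build _ _ _ (linear_image AB) sigma_finite_linear_image.

Lemma ge0_integral_linear_image (f : 'rV[R]_n -> \bar R) :
  measurable_fun setT f -> (forall x, 0 <= f x) ->
  \int[linear_image AB]_x f x = \int[lebesgue_rV n]_x f (x *m A).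
Proof.
move=> mf f0.
by rewrite (@ge0_integral_pushforward _ _ _ _ _ _ (measurable_rV_mulmx A)
  (lebesgue_rV n) setT f)// preimage_setT.
Qed.

Lemma linear_image_invariant : translation_invariant (linear_image AB).
Proof.
move=> c f mf f0; rewrite !ge0_integral_linear_image//; last first.
  by apply: measurableT_comp mf _; apply: measurable_rVD => //; exact: measurable_cst.
rewrite -[RHS](ge0_integral_rV_shift (c *m B)); last 2 first.
- exact: measurableT_comp mf (measurable_rV_mulmx A).
- by move=> x; exact: f0.
apply: eq_integral => x _; rewrite mulmxDl -mulmxA (mulmx1C AB) mulmx1//.
Qed.

End linear_image.

(** * Rotations and dilations of Lebesgue measure *)

Section orthogonal.
Context {R : realType}.
Local Open Scope ereal_scope.

Lemma dotpE n (x y : 'rV[R]_n) : dotp x y = (x *m y^T) ord0 ord0.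
Proof. by rewrite mxE; apply: eq_bigr => i _; rewrite !mxE. Qed.

Lemma dotpC n (x y : 'rV[R]_n) : dotp x y = dotp y x.
Proof. by apply: eq_bigr => i _; rewrite mulrC. Qed.

Lemma dotp_ge0 n (x : 'rV[R]_n) : (0 <= dotp x x)%R.
Proof. by apply: sumr_ge0 => i _; rewrite -expr2 sqr_ge0. Qed.

Lemma dotp_mulmx n (A : 'M[R]_n) (x y : 'rV[R]_n) : A *m A^T = 1%:M ->
  dotp (x *m A) (y *m A) = dotp x y.
Proof.
by move=> AA; rewrite !dotpE trmx_mul mulmxA -(mulmxA x) AA mulmx1.
Qed.

Lemma enorm_mulmx n (A : 'M[R]_n) (x : 'rV[R]_n) : A *m A^T = 1%:M ->
  enorm (x *m A) = enorm x.
Proof. by move=> AA; rewrite /enorm dotp_mulmx. Qed.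

Lemma enorm_ge0 n (x : 'rV[R]_n) : (0 <= enorm x)%R.
Proof. exact: sqrtr_ge0. Qed.

Lemma enormZ n (r : R) (x : 'rV[R]_n) : enorm (r *: x) = (`|r| * enorm x)%R.
Proof.
rewrite /enorm (_ : dotp _ _ = r ^+ 2 * dotp x x)%R.
  by rewrite sqrtrM ?sqr_ge0// sqrtr_sqr.
by rewrite /dotp mulr_sumr; apply: eq_bigr => i _; rewrite !mxE; ring.
Qed.

Lemma coord_le_enorm n (x : 'rV[R]_n) i : (`|x ord0 i| <= enorm x)%R.
Proof.
rewrite -sqrtr_sqr ler_wsqrtr// /dotp (bigD1 i)//= -expr2 lerDl.
by apply: sumr_ge0 => j _; rewrite -expr2 sqr_ge0.
Qed.

Lemma ltey_cube n r : lebesgue_rV n (@cube R n r) < +oo.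
Proof.
have [r0|r0] := leP 0%R r; first by rewrite lebesgue_cube// ltry.
apply: le_lt_trans (_ : lebesgue_rV n (cube n 0%R) < _); last first.
  by rewrite lebesgue_cube// ltry.
apply: le_measure; rewrite ?inE; try exact: measurable_cube.
by move=> x h i; exact: le_trans (h i) (ltW r0).
Qed.

Lemma unit_ball_cube n : @unit_ball R n `<=` cube n 1.
Proof. by move=> x /= x1 i; exact: le_trans (coord_le_enorm _ _) x1. Qed.

Lemma cube_unit_ball n : cube n (n.+1%:R^-1) `<=` @unit_ball R n.
Proof.
move=> x h; rewrite /unit_ball/= -[leRHS](@sqrtr1 R) ler_wsqrtr//.
apply: (@le_trans _ _ (\sum_(i < n) n.+1%:R^-1)%R).
  apply: ler_sum => i _; apply: le_trans (ler_norm _) _; rewrite normrM.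
  rewrite -[leRHS]mulr1; apply: ler_pM => //.
  by apply: le_trans (h i) _; rewrite invf_le1 ?ler1n.
by rewrite sumr_const card_ord -[X in (X <= _)%R]mulr_natr mulrC ler_pdivrMr// mul1r ler_nat.
Qed.

Lemma lebesgue_unit_ball_lty n : lebesgue_rV n (@unit_ball R n) < +oo.
Proof.
apply: le_lt_trans (ltey_cube n 1); apply: le_measure; rewrite ?inE//.
- exact: measurable_unit_ball.
- exact: measurable_cube.
- exact: unit_ball_cube.
Qed.

Lemma lebesgue_unit_ball_gt0 n : 0 < lebesgue_rV n (@unit_ball R n).
Proof.
apply: lt_le_trans (_ : lebesgue_rV n (cube n n.+1%:R^-1) <= _).
  by rewrite lebesgue_cube// lte_fin exprn_gt0// mulr_gt0.
apply: le_measure; rewrite ?inE//.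
- exact: measurable_cube.
- exact: measurable_unit_ball.
- exact: cube_unit_ball.
Qed.

Lemma mule_cancelr (x y z : \bar R) : 0 < z -> z < +oo -> x * z = y * z -> x = y.
Proof.
move=> z0 zoo /eqP; have zf : z \is a fin_num by rewrite ge0_fin_numE// ltW.
by rewrite eq_le !lee_pmul2r// -eq_le => /eqP.
Qed.

(** The uniqueness lemma, applied to Lebesgue measure itself, produces the reflected set; the
    measure of the unit ball, positive and finite, cancels. *)
Lemma lebesgue_rVN n (A : set 'rV[R]_n) : measurable A ->
  lebesgue_rV n (-%R @^-1` A) = lebesgue_rV n A.
Proof.
move=> mA; have := translation_invariant_prop (@lebesgue_rV_invariant R n) mA
  (measurable_unit_ball (N:=n)).
rewrite [RHS]muleC => /mule_cancelr ->//; first exact: lebesgue_unit_ball_gt0.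
exact: lebesgue_unit_ball_lty.
Qed.

Lemma linear_image_prop n (A B : 'M[R]_n) (AB : A *m B = 1%:M) (X E : set 'rV[R]_n) :
  measurable X -> measurable E ->
  linear_image AB X * lebesgue_rV n E = linear_image AB E * lebesgue_rV n X.
Proof.
move=> mX mE; rewrite -(lebesgue_rVN mX).
exact: (translation_invariant_prop (linear_image_invariant AB)).
Qed.

(** The image measure is translation invariant, hence proportional to Lebesgue measure; the factor
    is 1 because the unit ball is preserved. *)
Lemma ge0_integral_orthogonal n (A : 'M[R]_n) (f : 'rV[R]_n -> \bar R) :
  A *m A^T = 1%:M -> measurable_fun setT f -> (forall x, 0 <= f x) ->
  \int[lebesgue_rV n]_x f (x *m A) = \int[lebesgue_rV n]_x f x.
Proof.
move=> AA mf f0; rewrite -(ge0_integral_linear_image AA)//.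
apply: eq_measure_integral => X mX _.
have := linear_image_prop AA mX (measurable_unit_ball (N:=n)).
have -> : linear_image AA unit_ball = lebesgue_rV n unit_ball.
  rewrite [LHS]/linear_image /image_measure /pushforward; congr (lebesgue_rV n _).
  by apply/seteqP; split => x; rewrite /unit_ball/= enorm_mulmx.
rewrite [RHS]muleC => /mule_cancelr; apply; first exact: lebesgue_unit_ball_gt0.
exact: lebesgue_unit_ball_lty.
Qed.

(** The proportionality factor is read off on the cube of half side 1, whose preimage under x -> r x
    is the cube of half side 1/r. *)
Lemma ge0_integral_rV_scale n (r : R) (f : 'rV[R]_n -> \bar R) : (0 < r)%R ->
  measurable_fun setT f -> (forall x, 0 <= f x) ->
  (r ^+ n)%:E * \int[lebesgue_rV n]_x f (r *: x)%R = \int[lebesgue_rV n]_x f x.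
Proof.
move=> r0 mf f0.
have rr : (r%:M : 'M[R]_n) *m r^-1%:M = 1%:M by rewrite -scalar_mxM divff// gt_eqF.
under eq_integral do rewrite -mul_mx_scalar.
rewrite -(ge0_integral_linear_image rr)//.
have rn : (0 <= r ^+ n)%R by rewrite exprn_ge0// ltW.
pose rn' := NngNum rn.
rewrite -[LHS]/(rn'%:num%:E * _) -ge0_integral_mscale//.
apply: eq_measure_integral => X mX _.
have := linear_image_prop rr mX (@measurable_cube R n 1%R).
rewrite lebesgue_cube// (_ : linear_image rr (cube n 1%R) = ((2 * r^-1) ^+ n)%:E); last first.
  rewrite -lebesgue_cube ?invr_ge0 ?(ltW r0)//.
  rewrite [LHS]/linear_image /image_measure /pushforward; congr (lebesgue_rV n _).
  have E (y : R) : (`|r * y| <= 1 = (`|y| <= r^-1))%R.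
    by rewrite normrM gtr0_norm// -[r^-1%R]mulr1 ler_pdivlMl.
  by apply/seteqP; split => x h i; have := h i; rewrite mul_mx_scalar mxE E.
rewrite /mscale/= => h.
have : (r ^+ n / 2 ^+ n)%:E * (linear_image rr X * ((2 * 1) ^+ n)%:E) =
  (r ^+ n / 2 ^+ n)%:E * (((2 / r) ^+ n)%:E * lebesgue_rV n X) by rewrite h.
have E1 : (r ^+ n / 2 ^+ n * (2 * 1) ^+ n = r ^+ n)%R.
  by rewrite mulr1 divfK ?expf_neq0.
have E2 : (r ^+ n / 2 ^+ n * (2 / r) ^+ n = 1)%R.
  rewrite -expr_div_n -exprMn (_ : r / 2 * (2 / r) = 1)%R ?expr1n//.
  by field; rewrite gt_eqF.
by rewrite muleCA -EFinM muleA -EFinM E1 E2 mul1e muleC.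
Qed.

End orthogonal.

(** * Orthonormal frames and integration along parallel lines *)

Section frame.
Context {R : realType}.
Local Open Scope ereal_scope.

Lemma dotp_eq0 n (x : 'rV[R]_n) : (dotp x x == 0)%R = (x == 0)%R.
Proof.
apply/eqP/eqP => [|->]; last first.
  by rewrite /dotp big1// => i _; rewrite mxE mul0r.
move/eqP; rewrite psumr_eq0; last by move=> i _; rewrite -expr2 sqr_ge0.
move=> /allP h; apply/rowP => i; rewrite mxE.
by have := h i (mem_index_enum _); rewrite /= mulf_eq0 orbb => /eqP.
Qed.

Lemma usphere_dotp n (nu : 'rV[R]_n) : usphere nu -> dotp nu nu = 1%R.
Proof.
rewrite /usphere/= /enorm => h; rewrite -(sqr_sqrtr (dotp_ge0 nu)) h.
by rewrite expr1n.
Qed.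

(* A reflection exchanges the first basis vector and nu. *)
Lemma orthogonal_first_row n (nu : 'rV[R]_n.+1) : usphere nu ->
  exists2 O : 'M[R]_n.+1, O *m O^T = 1%:M & row ord0 O = nu.
Proof.
move=> /usphere_dotp nu1; pose e : 'rV[R]_n.+1 := delta_mx ord0 ord0.
have [->|nue] := eqVneq nu e.
  by exists 1%:M; rewrite ?trmx1 ?mulmx1// rowE mulmx1.
pose v := (nu - e)%R; pose d := dotp v v.
have d0 : d != 0%R by rewrite dotp_eq0 subr_eq0.
have vv : v *m v^T = d%:M by rewrite [LHS]mx11_scalar -dotpE.
pose O : 'M[R]_n.+1 := (1%:M - (2 / d) *: (v^T *m v))%R.
have OT : O^T = O by rewrite /O linearB linearZ/= trmx1 trmx_mul trmxK.
exists O.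
  rewrite OT /O; set W := v^T *m v; set c := (2 / d)%R.
  have WW : W *m W = d *: W.
    by rewrite /W mulmxA -(mulmxA v^T) vv mul_mx_scalar -scalemxAl.
  have cd : (c * (c * d) = c + c)%R by rewrite /c; field.
  rewrite mulmxBr mulmx1 mulmxBl mul1mx -scalemxAl -scalemxAr WW !scalerA.
  by rewrite -mulrA cd scalerDl opprB addrK subrK.
have ev : dotp e v = (nu ord0 ord0 - 1)%R.
  rewrite /dotp (bigD1 ord0)//= big1 ?addr0 => [|i i0].
    by rewrite !mxE/= mul1r.
  by rewrite !mxE (negbTE i0)/= mul0r.
(* As [nu] and [e] are unit vectors, |v|^2 = 2 - 2 nu_0 = -2 <e, v>. Hence the reflection sends [e]
   to e - (2/d) <e, v> v = e + v = nu. *)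
have dE : d = (- 2 * dotp e v)%R.
  rewrite ev /d /v.
  have -> : dotp (nu - e) (nu - e) = (dotp nu nu - dotp nu e *+ 2 + dotp e e)%R.
    rewrite -sumrMnl -sumrB -big_split/=; apply: eq_bigr => i _.
    by rewrite !mxE; ring.
  have ee : dotp e e = 1%R.
    rewrite /dotp (bigD1 ord0)//= big1 ?addr0 => [|i i0].
      by rewrite !mxE/= mul1r.
    by rewrite !mxE (negbTE i0)/= mul0r.
  have ne : dotp nu e = nu ord0 ord0.
    rewrite /dotp (bigD1 ord0)//= big1 ?addr0 => [|i i0].
      by rewrite !mxE/= mulr1.
    by rewrite !mxE (negbTE i0)/= mulr0.
  rewrite nu1 ee ne; ring.
rewrite rowE -/e /O mulmxBr mulmx1 -scalemxAr mulmxA.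
rewrite (_ : e *m v^T = (dotp e v)%:M); last by rewrite [LHS]mx11_scalar -dotpE.
rewrite mul_scalar_mx scalerA [X in X *: _](_ : _ = -1)%R.
  by rewrite scaleN1r opprK addrC subrK.
by rewrite dE; field; apply: contraNneq d0 => h; rewrite dE h mulr0.
Qed.

Lemma perp_frameP n (nu : 'rV[R]_n.+1) : usphere nu ->
  perp_frame nu *m (perp_frame nu)^T = 1%:M /\
  forall i, perp nu (row i (perp_frame nu)).
Proof.
move=> nu1.
suff [B HB] : exists B : 'M[R]_(n, n.+1),
    B *m B^T = 1%:M /\ forall i, perp nu (row i B).
  by rewrite /perp_frame; case: xgetP => [B' _ //|/(_ B)].
have [Q QQ Q0] := orthogonal_first_row nu1.
have QE i j : (\sum_k Q i k * Q j k = (i == j)%:R)%R.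
  by have := congr1 (fun M : 'M[R]_n.+1 => M i j) QQ; rewrite !mxE => <-;
    apply: eq_bigr => k _; rewrite mxE.
exists (\matrix_(i < n, j < n.+1) Q (lift ord0 i) j); split.
  apply/matrixP => i j; rewrite !mxE -(inj_eq (@lift_inj _ ord0)) -QE.
  by apply: eq_bigr => k _; rewrite !mxE.
move=> i; rewrite /perp/= -Q0 -[RHS](QE (lift ord0 i) ord0).
by apply: eq_bigr => k _; rewrite !mxE.
Qed.

Definition frame_mx n (nu : 'rV[R]_n.+1) : 'M[R]_n.+1 :=
  \matrix_i oapp (fun j => row j (perp_frame nu)) nu (unlift ord0 i).

Lemma frame_mx_orthogonal n (nu : 'rV[R]_n.+1) : usphere nu ->
  frame_mx nu *m (frame_mx nu)^T = 1%:M.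
Proof.
move=> nu1; have [BB Bnu] := perp_frameP nu1.
apply/matrixP => i j; rewrite !mxE.
transitivity (dotp (row i (frame_mx nu)) (row j (frame_mx nu))).
  by apply: eq_bigr => k _; rewrite !mxE.
rewrite !rowK; case: (unliftP ord0 i) => [i'|] ->; case: (unliftP ord0 j) => [j'|] -> /=.
- rewrite (inj_eq (@lift_inj _ ord0)).
  have := congr1 (fun M : 'M[R]_n => M i' j') BB; rewrite !mxE => <-.
  by apply: eq_bigr => k _; rewrite !mxE.
- by rewrite (Bnu i')//.
- by rewrite dotpC (Bnu j')//.
- by rewrite usphere_dotp.
Qed.

Lemma rV_cons_frame n (nu : 'rV[R]_n.+1) (s : measurableTypeR R) y :
  rV_cons (s, y) *m frame_mx nu = (y *m perp_frame nu + (s : R) *: nu)%R.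
Proof.
apply/rowP => j; rewrite [LHS]mxE [RHS]mxE big_ord_recl [LHS]addrC.
congr (_ + _)%R; last by rewrite !mxE unlift_none/=.
by rewrite [RHS]mxE; apply: eq_bigr => i _; rewrite !mxE liftK/= mxE.
Qed.

(** The orthogonal matrix [frame_mx nu], with first row [nu], carries the first coordinate axis to
    the direction [nu]; Tonelli in the rotated coordinates then isolates the lines. *)
Lemma ge0_integral_lines n (nu : 'rV[R]_n.+1) (f : 'rV[R]_n.+1 -> \bar R) :
  usphere nu -> measurable_fun setT f -> (forall x, 0 <= f x) ->
  \int[lebesgue_rV n.+1]_x f x =
  \int[lebesgue_rV n]_y \int[lebesgue_measure]_s f (y *m perp_frame nu + s *: nu)%R.
Proof.
move=> nu1 mf f0; rewrite -(ge0_integral_orthogonal (frame_mx_orthogonal nu1))//.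
rewrite ge0_integral_lebesgue_rVS2; last 2 first.
- exact: measurableT_comp mf (measurable_rV_mulmx _).
- by move=> x; exact: f0.
by apply: eq_integral => y _; apply: eq_integral => s _; rewrite rV_cons_frame.
Qed.

Lemma measurable_lines n (nu : 'rV[R]_n.+1) (f : 'rV[R]_n.+1 -> \bar R) :
  measurable_fun setT f -> (forall x, 0 <= f x) ->
  measurable_fun setT (fun y : 'rV[R]_n =>
    \int[lebesgue_measure]_s f (y *m perp_frame nu + s *: nu)%R).
Proof.
move=> mf f0.
have := @measurable_fun_fubini_tonelli_G _ _ (measurableTypeR R) 'rV[R]_n R lebesgue_measure
  (fun z => f (z.2 *m perp_frame nu + (z.1 : R) *: nu)%R).
apply => //; apply: measurableT_comp mf _.
apply: measurable_rVD.
  exact: measurableT_comp (measurable_rV_mulmx _) measurable_snd.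
apply: measurable_rVZ; first exact: measurable_fst.
exact: measurable_cst.
Qed.

End frame.

(** * Exit times and chords *)

Section borel.
Context {R : realType}.

Lemma countable_bigcup_measurable d (T : measurableType d) (I : countType)
    (D : set I) (F : I -> set T) :
  (forall i, D i -> measurable (F i)) -> measurable (\bigcup_(i in D) F i).
Proof.
move=> mF.
rewrite (_ : \bigcup_(i in D) F i = \bigcup_n
    (if unpickle n is Some i then (if `[< D i >] then F i else set0) else set0)).
  apply: bigcupT_measurable => n; case: unpickle => [i|]; last exact: measurable0.
  by case: asboolP => [/mF//|_]; exact: measurable0.
apply/seteqP; split => x.
  by move=> [i Di Fix]; exists (pickle i) => //; rewrite pickleK; case: asboolP.
move=> [n _]; case: unpickle => [i|//]; case: asboolP => // Di Fix; by exists i.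
Qed.

Lemma countable_bigcap_measurable d (T : measurableType d) (I : countType)
    (F : I -> set T) :
  (forall i, measurable (F i)) -> measurable (\bigcap_(i in [set: I]) F i).
Proof.
move=> mF; rewrite -[X in measurable X]setCK setC_bigcap; apply: measurableC.
by apply: countable_bigcup_measurable => i _; apply: measurableC.
Qed.

Lemma measurable_rV_ball n (x : 'rV[R]_n) (e : R) : measurable (ball x e).
Proof.
have [e0|e0] := ltP 0 e; last first.
  by rewrite (_ : ball _ _ = set0); [exact: measurable0|apply/seteqP; split => y //= -[]]; rewrite ltNge e0.
rewrite (_ : ball x e = \bigcap_(i in [set: 'I_n])
    ((fun y : 'rV[R]_n => y ord0 i) @^-1` ball (x ord0 i) e)).
  apply: fin_bigcap_measurable => // i _; rewrite -[X in measurable X]setTI.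
  apply: measurable_rV_coord => //; exact: measurable_ball.
apply/seteqP; split => y /=; first by move=> [_ h] i _; exact: h.
by move=> h; split => // i j; rewrite (ord1 i); exact: (h j I).
Qed.

(** An open set is the union of the balls with rational centre and radius 1/(k+1) that it contains.
    Around x, a rational centre at distance less than 1/(k+1) will do once 2/(k+1) is at most the
    radius [e] of a ball about x inside [A]. *)
Lemma open_measurable_rV n (A : set 'rV[R]_n) : open A -> measurable A.
Proof.
move=> oA.
pose b (z : 'rV[rat]_n * nat) : set 'rV[R]_n := ball (map_mx (ratr : rat -> R) z.1) (z.2.+1%:R^-1).
rewrite (_ : A = \bigcup_(z in [set z | b z `<=` A]) b z).
  by apply: countable_bigcup_measurable => z _; exact: measurable_rV_ball.
apply/seteqP; split => [x Ax|x [z bA bx]]; last exact: bA.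
have /nbhs_ballP[e /= e0 xA] : nbhs x A by exact: open_nbhs_nbhs.
pose k := Num.truncn (2 / e).
have k0 : 0 < k.+1%:R^-1 :> R by rewrite invr_gt0.
have ke : k.+1%:R^-1 + k.+1%:R^-1 <= e.
  have : 2 / e < k.+1%:R by exact: truncnS_gt.
  rewrite ltr_pdivrMr// mulrC -ltr_pdivrMr// => /ltW.
  by rewrite mulrDl mul1r.
have qP i : exists q : rat, x ord0 i - k.+1%:R^-1 < ratr q < x ord0 i + k.+1%:R^-1.
  have /rat_in_itvoo[q] : x ord0 i - k.+1%:R^-1 < x ord0 i + k.+1%:R^-1.
    by rewrite ltrD2l -subr_gt0 opprK addr_gt0.
  by rewrite in_itv/=; exists q.
have [q {}qP] := choice qP.
have bx : b (\row_i q i, k) x.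
  split => //= i j; rewrite (ord1 i) !mxE /ball/= ltr_norml.
  have /andP[? ?] := qP j.
  by apply/andP; split; rewrite ?ltrBrDr ?ltrBlDr 1?addrC.
exists (\row_i q i, k) => //= y bqy; apply: xA.
apply: le_ball ke _ _; apply: ball_triangle bqy; exact/ball_sym.
Qed.

Lemma closed_measurable_rV n (A : set 'rV[R]_n) : closed A -> measurable A.
Proof.
by move=> cA; rewrite -[A]setCK; apply: measurableC; apply: open_measurable_rV; exact: closed_openC.
Qed.

Lemma continuous_measurable_rV n (f : 'rV[R]_n -> R) :
  continuous f -> measurable_fun setT f.
Proof.
move=> /continuousP cf; apply: (measurability _ (RGenOpens.measurableE R)).
move=> _ [_ [a [b ->] <-]]; rewrite setTI; apply: open_measurable_rV.
exact/cf/interval_open.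
Qed.

End borel.

Section cdist.
Context {R : realType} {V : normedModType R}.
Variable C : set V.

(* Cut off at 1, so that it makes sense for [C] empty. *)
Definition cdist (x : V) : R := inf ([set 1] `|` [set `|x - y| | y in C]).

Let has_inf_cdist x : has_inf ([set 1] `|` [set `|x - y| | y in C]).
Proof.
split; first by exists 1; left.
by exists 0 => _ [->//|[y _ <-]].
Qed.

Lemma cdist_ge0 x : 0 <= cdist x.
Proof. by apply: lb_le_inf => [|_ [->//|[y _ <-]//]]; exists 1; left. Qed.

Lemma cdist_le1 x : cdist x <= 1.
Proof. by apply: ge_inf; [have [] := has_inf_cdist x|left]. Qed.

Lemma cdist_le x y : C y -> cdist x <= `|x - y|.
Proof. by move=> Cy; apply: ge_inf; [have [] := has_inf_cdist x|right; exists y]. Qed.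

Lemma cdist_lipschitz x y : cdist x <= cdist y + `|x - y|.
Proof.
rewrite -lerBlDr; apply: lb_le_inf; first by exists 1; left.
move=> _ [->|[z Cz <-]].
  by rewrite lerBlDr (le_trans (cdist_le1 x))// lerDl.
rewrite lerBlDr (le_trans (cdist_le x Cz))//.
have -> : x - z = (y - z) + (x - y) by rewrite [RHS]addrC addrA subrK.
exact: ler_normD.
Qed.

Lemma cdist_continuous : continuous cdist.
Proof.
move=> x; apply/cvgrPdist_lt => e e0; near=> y.
apply: (@le_lt_trans _ _ `|x - y|); last by near: y; exact: cvgr_dist_lt.
have := cdist_lipschitz x y; have := cdist_lipschitz y x.
by rewrite distrC ler_norml => ? ?; apply/andP; split; lra.
Unshelve. all: by end_near. Qed.

Lemma cdist_gt0 x : closed C -> ~ C x -> 0 < cdist x.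
Proof.
rewrite -openC => oC Cx.
have /nbhs_ballP[e /= e0 xC] : nbhs x (~` C) by exact: open_nbhs_nbhs.
apply: (@lt_le_trans _ _ (Num.min e 1)); first by rewrite lt_min e0/=.
apply: lb_le_inf; first by exists 1; left.
move=> _ [->|[z Cz <-]]; first by rewrite ge_min lexx orbT.
rewrite ge_min leNgt; apply/orP; left; apply/negP => xz.
by apply: (xC z) => //; rewrite -ball_normE.
Qed.

Lemma cdist_eq0 x : C x -> cdist x = 0.
Proof.
by move=> Cx; apply/eqP; rewrite eq_le cdist_ge0 andbT (le_trans (cdist_le x Cx))// subrr normr0.
Qed.

End cdist.

(** * One-sided exit times *)

Section exit_time.
Context {R : realType} (n : nat).
Implicit Types (Omega : set 'rV[R]_n) (nu x : 'rV[R]_n).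

(** The one-sided counterpart of [rho], which is the minimum of the values for [nu] and [- nu].
    Unlike [rho], it has no kink in the interior of a chord. *)
Definition exit_time Omega nu x : \bar R :=
  ereal_inf [set s%:E | s in [set s : R | 0 <= s /\ ~ Omega (x + s *: nu)]].

Lemma exit_time_ge0 Omega nu x : (0 <= exit_time Omega nu x)%E.
Proof. by apply: le_ereal_inf_tmp => _ [s [s0 _] <-]; rewrite lee_fin. Qed.

Lemma line_continuous nu x : continuous (fun s : R => x + s *: nu).
Proof.
move=> s; apply: cvgD; first exact: cvg_cst.
by apply: cvgZr_tmp; exact: cvg_id.
Qed.

(** The inequality is strict because the last point of the segment has a neighbourhood in the open
    set [Omega]. *)
Lemma exit_time_gtP Omega nu x (a : R) : open Omega -> 0 <= a ->
  (a%:E < exit_time Omega nu x)%E <-> forall s, 0 <= s <= a -> Omega (x + s *: nu).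
Proof.
move=> oO a0; split.
  move=> ax s /andP[s0 sa]; apply: contrapT => Os.
  have : (exit_time Omega nu x <= s%:E)%E by apply: ereal_inf_lbound; exists s.
  by move=> /(lt_le_trans ax); rewrite lte_fin ltNge sa.
move=> h.
have : nbhs a [set s | Omega (x + s *: nu)].
  apply: line_continuous; apply: open_nbhs_nbhs; split => //.
  by apply: h; rewrite a0 lexx.
move=> /nbhs_ballP[e /= e0 ae].
apply: (@lt_le_trans _ _ (a + e)%:E); first by rewrite lte_fin ltrDl.
apply: le_ereal_inf_tmp => _ [s [s0 Os] <-]; rewrite lee_fin leNgt; apply/negP => sae.
apply: Os; have [sa|sa] := leP s a; first by apply: h; rewrite s0.
apply: ae; rewrite /ball/= distrC ger0_norm; [lra|rewrite subr_ge0 ltW//].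
Qed.

(** The exit time exceeds a real a >= 0 exactly when the segment up to parameter a stays in [Omega],
    that is, by compactness, at distance at least some 1/(k+1) from the complement. By continuity
    this is tested on rational parameters, clamped into [0, a] by [cl], which leaves countable
    unions and intersections. *)
Lemma measurable_exit_time Omega : open Omega ->
  measurable_fun setT (fun z : 'rV[R]_n * 'rV[R]_n => exit_time Omega z.1 z.2).
Proof.
move=> oO; apply: (measurability _ (ErealGenOInfty.measurableE R)).
move=> /= _ [_ [a ->]] <-; rewrite setTI preimage_itvoy.
have [a0|a0] := ltP a 0.
  rewrite (_ : mkset _ = setT); first exact: measurableT.
  apply/seteqP; split => // z _ /=; apply: lt_le_trans (exit_time_ge0 _ _ _).
  by rewrite lte_fin.
pose cl (q : rat) : R := Num.max 0 (Num.min (ratr q) a).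
have cl_itv (r : R) : 0 <= Num.max 0 (Num.min r a) <= a.
  by rewrite le_max lexx/= ge_max a0/= ge_min lexx orbT.
rewrite (_ : mkset _ = \bigcup_(k in [set: nat]) \bigcap_(q in [set: rat])
    [set z : 'rV[R]_n * 'rV[R]_n | k.+1%:R^-1 <= cdist (~` Omega) (z.2 + cl q *: z.1)]).
  apply: countable_bigcup_measurable => k _.
  apply: countable_bigcap_measurable => q.
  rewrite -[X in measurable X]setTI.
  apply: (@measurable_fun_le _ _ R setT (cst k.+1%:R^-1)
    (fun z : 'rV[R]_n * 'rV[R]_n => cdist (~` Omega) (z.2 + cl q *: z.1))) => //.
  apply: measurableT_comp.
    by apply: continuous_measurable_rV; exact: cdist_continuous.
  apply: measurable_rVD; first exact: measurable_snd.
  by apply: measurable_rVZ; [exact: measurable_cst|exact: measurable_fst].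
have cO : closed (~` Omega) by rewrite closedC.
have cf nu x : continuous (fun s : R => cdist (~` Omega) (x + s *: nu)).
  by move=> s; exact: (continuous_comp (@line_continuous nu x s) (@cdist_continuous _ _ (~` Omega) _)).
apply/seteqP; split => [[nu x] /= /exit_time_gtP h|[nu x] /= [k _ h]].
  have {}h := h oO a0.
  have [c /[!in_itv]/= c0a cmin] := EVT_min a0 (continuous_subspaceT (cf nu x)).
  have c0 : 0 < cdist (~` Omega) (x + c *: nu).
    by apply: cdist_gt0 => //; apply; exact: h.
  exists (Num.truncn (cdist (~` Omega) (x + c *: nu))^-1); first exact: I.
  move=> q _ /=.
  apply: (@le_trans _ _ (cdist (~` Omega) (x + c *: nu))).
    by rewrite invf_ple ?posrE// ltW// truncnS_gt.
  by apply: cmin; rewrite in_itv/=; exact: cl_itv.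
apply/exit_time_gtP => // s sa.
pose g (r : R) := cdist (~` Omega) (x + Num.max 0 (Num.min r a) *: nu).
have cg : continuous g.
  have c1 : continuous (fun r : R => Num.max 0 (Num.min r a)).
    move=> r; apply: (@continuous_max _ _ (cst 0) (fun r => Num.min r a)).
      exact: cvg_cst.
    by apply: (@continuous_min _ _ id (cst a)); [exact: cvg_id|exact: cvg_cst].
  by move=> r; exact: (continuous_comp (c1 r) (cf nu x _)).
(* The clamped function [g] is continuous on the whole line, so the open set where it is below
   1/(k+1) would contain a rational if it contained [s]. *)
have gk : k.+1%:R^-1 <= g s.
  rewrite leNgt; apply/negP => gs.
  have oG : open [set r | g r < k.+1%:R^-1].
    have := @open_lt R k.+1%:R^-1.
    by move/continuousP : cg; apply.
  have [|r [Gr [q _ qr]]] := @dense_rat R _ _ oG; first by exists s.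
  by move: Gr; rewrite /= -qr ltNge; move/negP; apply; exact: h.
move: gk; rewrite /g; have /andP[s0 sa'] := sa.
rewrite (min_idPl sa') (max_idPr s0) => gk.
apply: contrapT => Os; have := @cdist_eq0 _ _ (~` Omega) _ Os.
by move=> E; move: gk; rewrite E leNgt invr_gt0 ltr0n.
Qed.

End exit_time.

(** * Chords through a point *)

Section chord.
Context {R : realType} (n : nat) (Omega : set 'rV[R]_n).
Hypothesis oO : open Omega.
Implicit Types (nu x : 'rV[R]_n).
Notation exit := (exit_time Omega).

Lemma ereal_eq_lt (X Y : \bar R) : (0 <= X)%E -> (0 <= Y)%E ->
  (forall a : R, 0 <= a -> (a%:E < X)%E <-> (a%:E < Y)%E) -> X = Y.
Proof.
wlog XY : X Y / (X <= Y)%E.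
  move=> h X0 Y0 H; have [|/ltW] := leP X Y => XY; first exact: h.
  by apply/esym/h => // a a0; rewrite H.
move=> X0 Y0 H; apply/eqP; rewrite eq_le XY/= leNgt; apply/negP => XltY.
case: X X0 XY H XltY => [r|//|//] r0 _ H; last by rewrite ltNge leey.
by move=> rY; have := (H r r0).2 rY; rewrite ltxx.
Qed.

Lemma exit_gt0 nu x : Omega x -> (0 < exit nu x)%E.
Proof.
move=> Ox; apply/exit_time_gtP => // s; rewrite -eq_le => /eqP <-.
by rewrite scale0r addr0.
Qed.

Lemma exit_in nu x (s : R) : 0 <= s -> (s%:E < exit nu x)%E -> Omega (x + s *: nu).
Proof. by move=> s0 /exit_time_gtP => /(_ oO s0); apply; rewrite s0 lexx. Qed.

(** The infimum is attained, the complement of [Omega] being closed. *)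
Lemma exit_out nu x (r : R) : exit nu x = r%:E -> ~ Omega (x + r *: nu).
Proof.
move=> xr Or.
have r0 : 0 <= r by rewrite -lee_fin -xr exit_time_ge0.
have : (r%:E < exit nu x)%E.
  apply/exit_time_gtP => // s /andP[s0]; rewrite le_eqVlt => /orP[/eqP->//|sr].
  by apply: exit_in => //; rewrite xr lte_fin.
by rewrite xr ltxx.
Qed.

Lemma exit_shift nu x (t : R) : 0 <= t -> (t%:E < exit nu x)%E ->
  exit nu (x + t *: nu) = (exit nu x - t%:E)%E.
Proof.
move=> t0 tx; apply: ereal_eq_lt.
- exact: exit_time_ge0.
- by rewrite sube_ge0 ?fin_numE// ltW.
move=> a a0; rewrite lteBrDr//.
rewrite -EFinD; split => /exit_time_gtP h; apply/exit_time_gtP => //.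
- exact: addr_ge0.
- move=> s /andP[s0 sat]; have [st|st] := leP s t.
    by move/exit_time_gtP : tx => /(_ oO t0); apply; rewrite s0.
  have /= := h oO a0 (s - t); rewrite subr_ge0 (ltW st)/= lerBlDr sat => /(_ erefl).
  by rewrite -addrA -scalerDl addrC (addrC t) subrK addrC.
- move=> s /andP[s0 sa]; rewrite -addrA -scalerDl; apply: h => //.
    exact: addr_ge0.
  by rewrite addr_ge0//= addrC lerD2r.
Qed.

(** The backward exit time grows by exactly t because the stretch covered from [x] lies in
    [Omega]. *)
Lemma exit_shiftN nu x (t : R) : 0 <= t -> (t%:E < exit nu x)%E ->
  exit (- nu) (x + t *: nu) = (exit (- nu) x + t%:E)%E.
Proof.
move=> t0 tx; apply: ereal_eq_lt.
- exact: exit_time_ge0.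
- by rewrite adde_ge0// ?exit_time_ge0// lee_fin.
have E s : x + t *: nu + s *: - nu = x + (t - s) *: nu.
  by rewrite -addrA scalerN -scalerBl.
move=> a a0; have [at_|ta] := ltP a t.
  split => _.
    by rewrite (@lt_le_trans _ _ t%:E) ?lte_fin// leeDr// exit_time_ge0.
  apply/exit_time_gtP => // s /andP[s0 sa]; rewrite E.
  move/exit_time_gtP : tx => /(_ oO t0); apply; rewrite lerBlDr lerDl s0 andbT subr_ge0.
  by rewrite (le_trans sa)// ltW.
rewrite -lteBlDr// -EFinB; split => /exit_time_gtP h; apply/exit_time_gtP => //.
- by rewrite subr_ge0.
- move=> s /andP[s0 sat]; have := h oO a0 (s + t).
  by rewrite E opprD addrCA subrr addr0 scaleNr scalerN addr_ge0//= -lerBrDr sat; apply.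
- move=> s /andP[s0 sa]; rewrite E; have [st|st] := leP s t.
    move/exit_time_gtP : tx => /(_ oO t0); apply; rewrite subr_ge0 st/=.
    by rewrite lerBlDr lerDl.
  rewrite -opprB scaleNr -scalerN; apply: (h oO); first by rewrite subr_ge0.
  by rewrite subr_ge0 (ltW st)/= lerD2r.
Qed.

(** Parameters of the chord through [x], counted from [x]. Exit times give its end points and its
    measurability at once; [component_chord] identifies it with the connected component used in the
    definition of the skeleton. *)
Definition chord nu x : set R :=
  [set s | (- exit (- nu) x < s%:E < exit nu x)%E].

Lemma chordN nu x s : chord (- nu) x s <-> chord nu x (- s).
Proof.
rewrite /chord/= opprK EFinN lteN2 [X in _ <-> is_true X]andbC.
by rewrite lteNl.
Qed.

Lemma chord_exit nu x s : chord nu x s ->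
  exit nu (x + s *: nu) = (exit nu x - s%:E)%E /\
  exit (- nu) (x + s *: nu) = (exit (- nu) x + s%:E)%E.
Proof.
move=> /andP[s1 s2]; have [s0|s0] := leP 0 s.
  by split; [exact: exit_shift|exact: exit_shiftN].
have s0' : 0 <= - s by rewrite oppr_ge0 ltW.
have s1' : ((- s)%:E < exit (- nu) x)%E by rewrite EFinN -lteN2 oppeK.
have -> : s *: nu = (- s) *: (- nu) by rewrite scalerN scaleNr opprK.
split; last by rewrite (exit_shift s0' s1') EFinN oppeK.
by have := exit_shiftN s0' s1'; rewrite opprK EFinN.
Qed.

Lemma chord_sub nu x s : chord nu x s -> Omega (x + s *: nu).
Proof.
move=> /andP[s1 s2]; have [s0|s0] := leP 0 s; first exact: exit_in.
rewrite (_ : s *: nu = (- s) *: (- nu)); last by rewrite scalerN scaleNr opprK.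
by apply: exit_in; rewrite ?oppr_ge0 ?ltW// EFinN -lteN2 oppeK.
Qed.

Lemma chord0 nu x : Omega x -> chord nu x 0.
Proof. by move=> Ox; rewrite /chord/= exit_gt0// oppe_lt0 exit_gt0. Qed.

Lemma chord_shift nu x s r : chord nu x s ->
  chord nu (x + s *: nu) r <-> chord nu x (s + r).
Proof.
move=> cs; have [E1 E2] := chord_exit cs; rewrite /chord/= E1 E2.
rewrite fin_num_oppeD// EFinD.
rewrite lteBlDr// lteBrDr// (addeC r%:E).
by [].
Qed.

Lemma measurable_chord nu x : measurable (chord nu x).
Proof.
rewrite (_ : chord nu x = [set: R] `&` EFin @^-1` (`](- exit (- nu) x)%E, exit nu x[%classic)).
  by apply: EFin_measurable => //; exact: emeasurable_itv.
by rewrite setTI; apply/seteqP; split => s; rewrite /= in_itv.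
Qed.

Lemma chord_ball nu x : Omega x -> exists2 e : R, 0 < e & forall s, `|s| < e -> chord nu x s.
Proof.
move=> Ox; have pos (y : \bar R) : (0 < y)%E -> exists2 e : R, 0 < e & (e%:E <= y)%E.
  by case: y => [r r0||]//; [exists r|exists 1 => //; rewrite leey].
have [e1 e10 h1] := pos _ (exit_gt0 nu Ox).
have [e2 e20 h2] := pos _ (exit_gt0 (- nu) Ox).
exists (Num.min e1 e2); first by rewrite lt_min e10.
move=> s; rewrite lt_min !ltr_norml => /andP[/andP[? ?] /andP[? ?]].
apply/andP; split; last exact: lt_le_trans h1.
by rewrite (@le_lt_trans _ _ (- e2%:E)%E) ?leeN2// -EFinN lte_fin.
Qed.

End chord.

(** * Decomposition of a line into countably many chords *)

Section chord_decomposition.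
Context {R : realType} (n : nat) (Omega : set 'rV[R]_n).
Hypothesis oO : open Omega.
Local Open Scope ereal_scope.
Implicit Types (nu x : 'rV[R]_n) (P Q : 'rV[R]_n -> \bar R).
Notation leb := (@lebesgue_measure R).

(* The parameters, along the line x + s nu, of the chord through x + a nu. *)
Definition chord_at nu x (a : R) : set R :=
  [set s | chord Omega nu (x + a *: nu) (s - a)%R].

Let line_add x nu (a r : R) : (x + r *: nu = x + a *: nu + (r - a) *: nu)%R.
Proof. by rewrite -addrA -scalerDl (addrC a) subrK. Qed.

Lemma chord_at_eq nu x a r : chord_at nu x a r -> chord_at nu x r = chord_at nu x a.
Proof.
move=> car; apply/seteqP; split => s; rewrite /chord_at/=.
  rewrite (line_add x nu a r).
  by move=> /(chord_shift oO _ car); congr chord; ring.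
rewrite (line_add x nu a r).
by move=> h; apply/(chord_shift oO _ car); move: h; congr chord; ring.
Qed.

Lemma measurable_chord_at nu x a : measurable (chord_at nu x a : set (measurableTypeR R)).
Proof.
rewrite -[X in measurable X]setTI.
have m : measurable_fun [set: measurableTypeR R] (fun s : R => s - a)%R.
  by apply: measurable_funB => //; exact: measurable_cst.
by apply: m => //; exact: measurable_chord.
Qed.

Lemma chord_at_sub nu x a s : chord_at nu x a s -> Omega (x + s *: nu)%R.
Proof. by move=> /(chord_sub oO); rewrite -line_add.
Qed.

Lemma ge0_integral_chord_at nu x a P : measurable_fun setT P -> (forall x, 0 <= P x) ->
  \int[leb]_(s in chord_at nu x a) P (x + s *: nu)%R =
  \int[leb]_(s in chord Omega nu (x + a *: nu)) P (x + a *: nu + s *: nu)%R.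
Proof.
move=> mP P0.
have mL : measurable_fun [set: R] (fun s : R => P (x + a *: nu + s *: nu)%R).
  apply: measurableT_comp mP _; apply: measurable_rVD; first exact: measurable_cst.
  by apply: measurable_rVZ => //; exact: measurable_cst.
rewrite integral_mkcond [RHS]integral_mkcond.
rewrite -(@ge0_integral_shift _ (- a)%R ((fun s : R => P (x + a *: nu + s *: nu)%R)
  \_ (chord Omega nu (x + a *: nu)))).
- apply: eq_integral => s _; rewrite !patchE.
  have -> : (s \in chord_at nu x a) = ((- a + s)%R \in chord Omega nu (x + a *: nu)%R).
    by rewrite (addrC (- a)%R); apply/idP/idP => /set_mem h; exact/mem_set.
  by case: ifP => // _; congr P; rewrite -addrA -scalerDl addNKr.
- apply/(measurable_restrict _ (measurable_chord _ _ _) measurableT) => //.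
  exact: measurable_funTS.
- by move=> s; rewrite erestrict_ge0.
Qed.

(** Each chord is open, so it contains a rational parameter: the rationals enumerate all the chords
    of the line, with repetitions. *)
Let Jseq nu x (k : nat) : set R :=
  if unpickle k is Some q then
    (if `[< Omega (x + (ratr q : R) *: nu)%R >] then chord_at nu x (ratr q) else set0)
  else set0.

Let Jseq_cover nu x : \bigcup_k Jseq nu x k = [set s | Omega (x + s *: nu)%R].
Proof.
apply/seteqP; split => [s [k _]|s /= Os]; rewrite /Jseq.
  by case: unpickle => [q|]//; case: asboolP => // _; exact: chord_at_sub.
have [e e0 he] := @chord_ball _ _ _ oO nu _ Os.
have /rat_in_itvoo[q] : (s - e < s + e)%R by lra.
rewrite in_itv/= => /andP[q1 q2].
have cq : chord_at nu x s (ratr q).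
  by apply: he; rewrite ltr_norml; apply/andP; split; lra.
exists (pickle q); first exact: I.
rewrite pickleK; case: asboolP => [_|]; last first.
  by move/chord_at_sub : cq.
by rewrite (chord_at_eq cq) /chord_at/= subrr; exact: chord0.
Qed.

Let Jseq_case nu x k : Jseq nu x k = set0 \/
  exists2 a : R, Omega (x + a *: nu)%R & Jseq nu x k = chord_at nu x a.
Proof.
rewrite /Jseq; case: unpickle => [q|]; last by left.
by case: asboolP => Oq; [right; exists (ratr q)|left].
Qed.

(** Two chords of a line are equal or disjoint, so removing the earlier sets of the sequence keeps a
    chord whole or deletes it. *)
Let seqDU_case nu x k : seqDU (Jseq nu x) k = set0 \/
  exists2 a : R, Omega (x + a *: nu)%R & seqDU (Jseq nu x) k = chord_at nu x a.
Proof.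
have [E|/set0P[r]] := eqVneq (seqDU (Jseq nu x) k) set0; first by left.
move=> [Jr nJr]; right; have [E|[a Oa E]] := Jseq_case nu x k; first by rewrite E in Jr.
exists a => //; apply/seteqP; split => [s []|s cas]; rewrite ?E//.
split; first by rewrite E.
rewrite -bigcup_mkord => -[j /= jk Js]; apply: nJr; rewrite -bigcup_mkord; exists j => //.
have [E'|[b Ob E']] := Jseq_case nu x j; first by rewrite E' in Js.
rewrite E' in Js *.
by rewrite -(chord_at_eq Js) (chord_at_eq cas) -E.
Qed.

Lemma ge0_integral_line_chords nu x P Q :
  measurable_fun setT P -> (forall x, 0 <= P x) ->
  measurable_fun setT Q -> (forall x, 0 <= Q x) ->
  (forall y, Omega y -> \int[leb]_(s in chord Omega nu y) P (y + s *: nu)%R =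
                        \int[leb]_(s in chord Omega nu y) Q (y + s *: nu)%R) ->
  \int[leb]_(s in [set s | Omega (x + s *: nu)%R]) P (x + s *: nu)%R =
  \int[leb]_(s in [set s | Omega (x + s *: nu)%R]) Q (x + s *: nu)%R.
Proof.
move=> mP P0 mQ Q0 PQ; rewrite -(Jseq_cover nu x) (seqDU_bigcup_eq (Jseq nu x)).
have mJ k : measurable (seqDU (Jseq nu x) k : set (measurableTypeR R)).
  have [->|[a _ ->]] := seqDU_case nu x k; [exact: measurable0|exact: measurable_chord_at].
have mL (F : 'rV[R]_n -> \bar R) : measurable_fun setT F ->
    measurable_fun [set: R] (fun s : R => F (x + s *: nu)%R).
  move=> mF; apply: measurableT_comp mF _; apply: measurable_rVD; first exact: measurable_cst.
  by apply: measurable_rVZ => //; exact: measurable_cst.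
have split_chords (F : 'rV[R]_n -> \bar R) : measurable_fun setT F -> (forall x, 0 <= F x) ->
    \int[leb]_(s in \bigcup_k seqDU (Jseq nu x) k) F (x + s *: nu)%R =
    \sum_(k <oo) \int[leb]_(s in seqDU (Jseq nu x) k) F (x + s *: nu)%R.
  move=> mF F0; apply: ge0_integral_bigcup => //.
  exact: measurable_funTS (mL _ mF).
rewrite (split_chords _ mP P0) (split_chords _ mQ Q0).
apply: eq_eseriesr => k _; have [->|[a Oa ->]] := seqDU_case nu x k.
  by rewrite !integral_set0.
by rewrite !ge0_integral_chord_at// PQ.
Qed.

End chord_decomposition.

(** Passage from dimension one to [Omega]: equal integrals over every chord give equal integrals
    over every line of direction [nu], then over [Omega] by Tonelli. *)
Lemma ge0_integral_chords (R : realType) n (Omega : set 'rV[R]_n.+1)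
    (nu : 'rV[R]_n.+1) (P Q : 'rV[R]_n.+1 -> \bar R) :
  open Omega -> usphere nu ->
  measurable_fun setT P -> (forall x, (0 <= P x)%E) ->
  measurable_fun setT Q -> (forall x, (0 <= Q x)%E) ->
  (forall y, Omega y ->
    (\int[lebesgue_measure]_(s in chord Omega nu y) P (y + s *: nu)%R =
     \int[lebesgue_measure]_(s in chord Omega nu y) Q (y + s *: nu)%R)%E) ->
  (\int[lebesgue_rV n.+1]_(x in Omega) P x = \int[lebesgue_rV n.+1]_(x in Omega) Q x)%E.
Proof.
move=> oO nu1 mP P0 mQ Q0 PQ.
have mO := open_measurable_rV oO.
have r0 (F : 'rV[R]_n.+1 -> \bar R) x : (forall x, (0 <= F x)%E) -> (0 <= (F \_ Omega) x)%E.
  by move=> F0; rewrite erestrict_ge0.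
have mr (F : 'rV[R]_n.+1 -> \bar R) : measurable_fun setT F -> measurable_fun setT (F \_ Omega).
  by move=> mF; apply/(measurable_restrict _ mO measurableT) => //; exact: measurable_funTS.
rewrite integral_mkcond [RHS]integral_mkcond.
rewrite [LHS](ge0_integral_lines nu1 (mr _ mP) (fun x => r0 _ x P0)).
rewrite [RHS](ge0_integral_lines nu1 (mr _ mQ) (fun x => r0 _ x Q0)).
apply: eq_integral => y _.
have := ge0_integral_line_chords oO (y *m perp_frame nu) mP P0 mQ Q0 PQ.
rewrite integral_mkcond [X in _ = X -> _]integral_mkcond => h.
transitivity (\int[lebesgue_measure]_s ((fun s => P (y *m perp_frame nu + s *: nu)%R) \_
    [set s | Omega (y *m perp_frame nu + s *: nu)%R]) s)%E.
  by apply: eq_integral => s _; rewrite !patchE; congr (if _ then _ else _);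
    apply/idP/idP => /set_mem ?; apply/mem_set.
rewrite h; apply: eq_integral => s _; rewrite !patchE; congr (if _ then _ else _);
    by apply/idP/idP => /set_mem ?; apply/mem_set.
Qed.

(** * The one-dimensional identity *)

Section signed_power.
Context {R : realType}.
Variable p : R.
Hypothesis p1 : 1 < p.

(** Up to the factor [p], the derivative of |x|^p; the factor [x] gives it the value 0 at 0 for
    every exponent. *)
Definition spow (x : R) : R := x * `|x| `^ (p - 2).

Lemma spow0 : spow 0 = 0. Proof. by rewrite /spow mul0r. Qed.

Lemma normr_spow x : `|spow x| = `|x| `^ (p - 1).
Proof.
rewrite /spow normrM (ger0_norm (powR_ge0 _ _)); have [->|x0] := eqVneq x 0.
  by rewrite normr0 mul0r powR0// subr_eq0 gt_eqF.
rewrite -[X in X * _]powRr1// -powRD ?normr_eq0 ?x0 ?implybT//; congr (_ `^ _); ring.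
Qed.

Lemma mul_spow x : x * spow x = `|x| `^ p.
Proof.
have [->|x0] := eqVneq x 0; first by rewrite spow0 mulr0 normr0 powR0// gt_eqF// (lt_trans _ p1).
rewrite /spow mulrA -expr2 -real_normK ?num_real// -powR_mulrn//.
by rewrite -powRD ?normr_eq0 ?x0 ?implybT// addrC subrK.
Qed.

Lemma spowM x y : spow (x * y) = spow x * spow y.
Proof. by rewrite /spow normrM powRM//; ring. Qed.

Lemma spowN x : spow (- x) = - spow x.
Proof. by rewrite /spow normrN mulNr. Qed.

Lemma spow_gt0 t : 0 < t -> spow t = t `^ (p - 1).
Proof.
move=> t0; rewrite /spow gtr0_norm// -{1}(powRr1 (ltW t0)) -powRD ?(gt_eqF t0) ?implybT//.
by congr (_ `^ _); ring.
Qed.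

Lemma continuous_norm_powR (q : R) : 0 < q -> continuous (fun x : R => `|x| `^ q).
Proof.
move=> q0 x; have [->|x0] := eqVneq x 0; last first.
  have x0' : 0 < `|x| by rewrite normr_gt0.
  apply: (@continuous_comp _ _ _ (fun x : R => `|x|) (fun t : R => @powR R t q)); first exact: norm_continuous.
  apply: differentiable_continuous; apply/derivable1_diffP.
  by apply: derivable_powR; rewrite in_itv/= andbT.
apply/cvgrPdist_lt => e e0; rewrite normr0 powR0 ?gt_eqF//.
near=> t; rewrite sub0r normrN ger0_norm ?powR_ge0//.
have -> : e = (e `^ q^-1) `^ q by rewrite -powRrM mulVf ?gt_eqF// powRr1// ltW.
apply: gt0_ltr_powR => //; rewrite ?nnegrE ?powR_ge0//.
rewrite -[t]subr0 distrC; near: t; apply: cvgr_dist_lt => //; exact: powR_gt0.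
Unshelve. all: by end_near. Qed.

Lemma continuous_spow : continuous spow.
Proof.
move=> x; have [->|x0] := eqVneq x 0; last first.
  have x0' : 0 < `|x| by rewrite normr_gt0.
  apply: (@continuousM _ _ id (fun x : R => `|x| `^ (p - 2))); first exact: cvg_id.
  apply: (@continuous_comp _ _ _ (fun x : R => `|x|) (fun t : R => @powR R t (p - 2))); first exact: norm_continuous.
  apply: differentiable_continuous; apply/derivable1_diffP.
  by apply: derivable_powR; rewrite in_itv/= andbT.
have q0 : 0 < p - 1 by rewrite subr_gt0.
have := continuous_norm_powR q0; move=> /(_ 0).
move=> /cvgrPdist_lt h; apply/cvgrPdist_lt => e e0; have := h e e0.
rewrite spow0 normr0 powR0 ?gt_eqF//; apply: filterS => t.
by rewrite !sub0r !normrN normr_spow ger0_norm ?powR_ge0.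
Qed.

(** At 0 the difference quotient of |h|^p is [spow h], which tends to 0; negative points follow from
    positive ones by parity. *)
Lemma is_derive_norm_powR (x : R) :
  is_derive x 1 (fun t : R => `|t| `^ p) (p * spow x).
Proof.
have p0 : 0 < p := lt_trans ltr01 p1.
have pos (y : R) : 0 < y -> is_derive y 1 (fun t : R => `|t| `^ p) (p * spow y).
  move=> y0.
  apply: (@near_eq_is_derive R R R (fun t : R => @powR R t p)).
  - near=> t; rewrite ger0_norm//.
    by apply/ltW; near: t; exact: lt_nbhsr.
  - by rewrite spow_gt0//; exact: is_derive1_powR.
have [x0|x0|->] := ltgtP x 0; last 1 first.
- rewrite spow0 mulr0.
  have H : (fun h : R => h^-1 *: ((fun t : R => `|t| `^ p) (h *: 1 + 0) -
      (fun t : R => `|t| `^ p) 0)) @ 0^' --> (0 : R).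
    have : spow @ 0^' --> spow 0.
      by apply: cvg_within_filter; exact: continuous_spow.
    rewrite spow0; apply: cvg_trans; apply: near_eq_cvg; near=> h.
    have h0 : h != 0 by near: h; exact: nbhs_dnbhs_neq.
    rewrite /= /GRing.scale/= mulr1 addr0 normr0 powR0 ?gt_eqF// subr0 -mul_spow.
    by rewrite mulKf.
  by apply: DeriveDef; [apply/cvg_ex; exists 0|apply/cvg_lim].
- have := pos (- x); rewrite oppr_gt0 => /(_ x0) dx.
  have : is_derive x 1 ((fun t : R => `|t| `^ p) \o -%R) (p * spow (- x) * (- 1)).
    have dN : is_derive x 1 (-%R : R -> R) (-1).
      exact: is_deriveNid.
    exact: (is_derive1_comp dx dN).
  rewrite mulrN1 spowN mulrN opprK.
  by rewrite (_ : _ \o _ = (fun t : R => `|t| `^ p))//; apply/funext => t /=; rewrite normrN.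
- exact: pos.
Unshelve. all: by end_near. Qed.

(* The convexity inequality |x|^p >= |z|^p + p |z|^(p-2) z (x - z). *)
Lemma Cp_ge0 x y : 0 <= Cp p x y.
Proof.
have p0 : 0 < p := lt_trans ltr01 p1.
set z := x - y; have yE : y = x - z by rewrite /z opprB addrC subrK.
have -> : Cp p x y = `|x| `^ p + (p - 1) * `|z| `^ p - p * (spow z * x).
  by rewrite /Cp -/z -mul_spow [in LHS]yE -(mul_spow z) /spow; ring.
rewrite subr_ge0 (le_trans (y := p * (`|z| `^ (p - 1) * `|x|)))//.
  by rewrite ler_pM2l// -normr_spow -normrM ler_norm.
(* Young's inequality for |x| and |z|^(p-1), with the conjugate exponents p and p/(p-1). *)
have q0 : 0 < p / (p - 1) by rewrite divr_gt0// subr_gt0.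
have := @conjugate_powR R (`|x|) (`|z| `^ (p - 1)) p (p / (p - 1)).
move=> /(_ (normr_ge0 _) (powR_ge0 _ _) p0 q0).
have p1' : p - 1 != 0 by rewrite subr_eq0 gt_eqF.
rewrite -powRrM mulrCA divff// mulr1 => h.
have {}h := h ltac:(by field; rewrite p1' gt_eqF).
rewrite -ler_pdivlMl// mulrC (le_trans h)//.
by rewrite le_eqVlt; apply/orP; left; apply/eqP; field; rewrite p1' gt_eqF.
Qed.

Lemma CpN x y : Cp p (- x) (- y) = Cp p x y.
Proof. by rewrite /Cp (_ : - x - - y = - (x - y)) ?normrN; ring. Qed.

Lemma Cp_id x : Cp p x x = `|x| `^ p.
Proof.
rewrite /Cp subrr normr0 powR0 ?subr0 ?mulr0 ?mul0r ?subr0//.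
by rewrite gt_eqF// (lt_trans _ p1).
Qed.

End signed_power.

Section half_chord.
Context {R : realType}.
Variables (p lambda : R).
Hypothesis p1 : 1 < p.
Notation leb := (@lebesgue_measure R).

Let b : R := (p + lambda - 1) / p.
Let k : R := spow p b.

Variables (f df : R -> R) (delta T : R).
Hypothesis fd : forall t : R, is_derive t 1 f (df t).
Hypothesis cdf : continuous df.
Hypothesis delta_gt0 : 0 < delta.
Hypothesis delta_T : delta < T.
Hypothesis f0 : forall t : R, 0 < t -> t <= delta -> f t = 0.
Hypothesis df0 : forall t : R, 0 < t -> t <= delta -> df t = 0.

Let p0 : 0 < p. Proof. exact: lt_trans p1. Qed.

Let FA (t : R) := t `^ (- lambda) * `|df t| `^ p.
Let FB (t : R) := `|f t| `^ p * t `^ (- lambda - p).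
Let FC (t : R) := t `^ (- lambda) * Cp p (df t) (df t - b * f t / t).
Let h (t : R) := k * (`|f t| `^ p * t `^ (1 - p - lambda)).
Let dh (t : R) := FA t - `|b| `^ p * FB t - FC t.

Let is_derive_powR_gt0 (c : R) (t : R) : 0 < t -> is_derive t 1 (fun s : R => @powR R s c) (c * t `^ (c - 1)).
Proof. by move=> t0; exact: is_derive1_powR. Qed.

Let is_derive_norm_comp (t : R) :
  is_derive t 1 (fun s => `|f s| `^ p) (df t * (p * spow p (f t))).
Proof.
have := is_derive_norm_powR p1 (f t) => H.
have := @is_derive1_comp R (fun s : R => `|s| `^ p) f t _ _ H (fd t).
by rewrite mulrC; apply.
Qed.

(** With z = b f/t, the second argument of [Cp] is f' - z = t^b (f/t^b)', so the power in the middle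
    of [Cp] is |z|^p. The identity then rests on k b = |b|^p, on [spow p z] = k spow(f)/t^(p-1), and
    on 1 - p - lambda = - p b, which is what fixes the value of b. *)
Let dhE (t : R) : 0 < t ->
  dh t = k * (`|f t| `^ p * ((1 - p - lambda) * t `^ (1 - p - lambda - 1))
              + t `^ (1 - p - lambda) * (df t * (p * spow p (f t)))).
Proof.
move=> t0; rewrite /dh /FA /FB /FC.
have tN0 : t != 0 by rewrite gt_eqF.
set z := b * f t / t.
have CE : Cp p (df t) (df t - z) = `|df t| `^ p - `|z| `^ p - p * spow p z * (df t - z).
  by rewrite /Cp /spow (_ : df t - (df t - z) = z); ring.
have zE : spow p z = k * spow p (f t) * (t `^ (p - 1))^-1.
  rewrite /z (spowM p (b * f t) t^-1) (spowM p b (f t)) -/k; congr (_ * _).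
  by rewrite spow_gt0 ?invr_gt0// -powR_inv1 ?ltW// -powRrM mulN1r powRN.
have kb : k * b = `|b| `^ p by rewrite mulrC (mul_spow p1).
have c1 : 1 - p - lambda = - p * b by rewrite /b; field; rewrite gt_eqF.
have E1 : t `^ (1 - p - lambda) = t `^ (- lambda) * (t `^ (p - 1))^-1.
  rewrite -powRN -powRD ?tN0 ?implybT//; congr (_ `^ _); ring.
have E2 : t `^ (1 - p - lambda - 1) = t `^ (- lambda) * (t `^ (p - 1))^-1 / t.
  by rewrite -E1 [LHS]powRD ?tN0 ?implybT// powR_inv1 ?ltW.
have E3 : t `^ (- lambda - p) = t `^ (- lambda) * (t `^ (p - 1))^-1 / t.
  by rewrite -E2; congr (_ `^ _); ring.
rewrite CE -(mul_spow p1 z) zE E1 E2 E3 c1 -kb -(mul_spow p1 (f t)) /z.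
by ring.
Qed.

Let is_derive_h (t : R) : 0 < t -> is_derive t 1 h (dh t).
Proof.
move=> t0; rewrite (dhE t0).
have H1 := is_derive_norm_comp t.
have H2 := is_derive_powR_gt0 (1 - p - lambda) t0.
have H := is_deriveM H1 H2.
have := @is_deriveZ _ _ _ _ k t 1 _ H.
by rewrite /GRing.scale/= /h.
Qed.

Let derivable_h (t : R) : 0 < t -> derivable h t 1.
Proof. by move=> t0; have [] := is_derive_h t0. Qed.

Let derive_h (t : R) : 0 < t -> 'D_1 h t = dh t.
Proof. by move=> t0; have [] := is_derive_h t0. Qed.

Let continuous_h (t : R) : 0 < t -> {for t, continuous h}.
Proof.
by move=> t0; apply: differentiable_continuous; apply/derivable1_diffP; exact: derivable_h.
Qed.

Let continuous_powR_gt0 (c : R) (t : R) : 0 < t -> {for t, continuous (fun s : R => @powR R s c)}.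
Proof.
by move=> t0; apply: differentiable_continuous; apply/derivable1_diffP; have [] := is_derive_powR_gt0 c t0.
Qed.

Let cf : continuous f.
Proof.
by move=> t; apply: differentiable_continuous; apply/derivable1_diffP; have [] := fd t.
Qed.

Let cFA (t : R) : 0 < t -> {for t, continuous FA}.
Proof.
move=> t0; apply: continuousM; first exact: continuous_powR_gt0.
apply: (@continuous_comp _ _ _ df (fun x : R => `|x| `^ p)); first exact: cdf.
exact: continuous_norm_powR.
Qed.

Let cFB (t : R) : 0 < t -> {for t, continuous FB}.
Proof.
move=> t0; apply: continuousM; last exact: continuous_powR_gt0.
apply: (@continuous_comp _ _ _ f (fun x : R => `|x| `^ p)); first exact: cf.
exact: continuous_norm_powR.
Qed.

Let cdh (t : R) : 0 < t -> {for t, continuous dh}.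
Proof.
move=> t0.
pose g s : R := k * (`|f s| `^ p * ((1 - p - lambda) * s `^ (1 - p - lambda - 1))
              + s `^ (1 - p - lambda) * (df s * (p * spow p (f s)))).
have : {for t, continuous g}.
  apply: continuousM; first exact: cvg_cst.
  apply: continuousD.
    apply: continuousM.
      apply: (@continuous_comp _ _ _ f (fun x : R => `|x| `^ p)); first exact: cf.
      exact: continuous_norm_powR.
    by apply: continuousM; [exact: cvg_cst|exact: continuous_powR_gt0].
  apply: continuousM; first exact: continuous_powR_gt0.
  apply: continuousM; first exact: cdf.
  apply: continuousM; first exact: cvg_cst.
  apply: (@continuous_comp _ _ _ f (spow p)); first exact: cf.
  exact: continuous_spow.
rewrite /prop_for /continuous_at (dhE t0); apply: cvg_trans; apply: near_eq_cvg.
by near=> s; rewrite /g -dhE//; near: s; exact: lt_nbhsr.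
Unshelve. all: by end_near. Qed.

(** Obtained by difference from the other terms: [Cp] contains a power with exponent p - 2, possibly
    negative, while the formula [dhE] involves only [spow], which is continuous. *)
Let cFC (t : R) : 0 < t -> {for t, continuous FC}.
Proof.
move=> t0; rewrite (_ : FC = fun s => FA s - `|b| `^ p * FB s - dh s); last first.
  by apply/funext => s; rewrite /dh; ring.
apply: continuousB; last exact: cdh.
apply: continuousB; first exact: cFA.
by apply: continuousM; [exact: cvg_cst|exact: cFB].
Qed.

Let within_gt0 (F : R -> R) : (forall t : R, 0 < t -> {for t, continuous F}) ->
  {within `[delta, T], continuous F}.
Proof.
move=> cF; apply: continuous_in_subspaceT => t /set_mem.
by rewrite /= in_itv/= => /andP[dt _]; apply: cF; exact: lt_le_trans dt.
Qed.

Let integrable_gt0 (F : R -> R) : (forall t : R, 0 < t -> {for t, continuous F}) ->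
  leb.-integrable `[delta, T] (EFin \o F).
Proof.
move=> cF; apply: continuous_compact_integrable; first exact: segment_compact.
exact: within_gt0.
Qed.

Let FC0 (t : R) : 0 < t -> t <= delta -> FC t = 0.
Proof.
move=> t0 td; rewrite /FC f0// df0// mulr0 mul0r subr0 (Cp_id p1) normr0.
by rewrite powR0 ?mulr0// gt_eqF.
Qed.

Let FA0 (t : R) : 0 < t -> t <= delta -> FA t = 0.
Proof. by move=> t0 td; rewrite /FA df0// normr0 powR0 ?mulr0// gt_eqF. Qed.

Let FB0 (t : R) : 0 < t -> t <= delta -> FB t = 0.
Proof. by move=> t0 td; rewrite /FB f0// normr0 powR0 ?mul0r// gt_eqF. Qed.

Let integral_cc : (\int[leb]_(t in `[delta, T]) (FA t)%:E =
  (`|b| `^ p)%:E * \int[leb]_(t in `[delta, T]) (FB t)%:E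
  + \int[leb]_(t in `[delta, T]) (FC t)%:E + (h T)%:E)%E.
Proof.
have hd0 : h delta = 0 by rewrite /h f0// normr0 powR0 ?gt_eqF// mul0r mulr0.
have -> : ((h T)%:E = \int[leb]_(t in `[delta, T]) (dh t)%:E)%E.
  rewrite (@continuous_FTC2 _ dh h)// ?hd0 ?sube0//.
  - exact: within_gt0 cdh.
  - split.
    + move=> t; rewrite in_itv/= => /andP[dt _].
      exact/derivable_h/(lt_trans delta_gt0).
    + by apply: cvg_at_right_filter; exact: continuous_h.
    + apply: cvg_at_left_filter; apply: continuous_h; exact: lt_trans delta_T.
  - move=> t; rewrite in_itv/= => /andP[dt _]; rewrite derive1E.
    exact/derive_h/(lt_trans delta_gt0).
have iB := integrable_gt0 cFB; have iC := integrable_gt0 cFC.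
have iH := integrable_gt0 cdh.
have ibB : leb.-integrable `[delta, T] (fun t => (`|b| `^ p)%:E * (FB t)%:E)%E.
  exact: integrableZl.
rewrite -integralZl// -integralD// -integralD//; last exact: integrableD.
by apply: eq_integral => t _; rewrite -EFinM -!EFinD; congr EFin; rewrite /dh; ring.
Qed.

(** The powers of t may blow up at 0, but [F] vanishes up to [delta], so the fundamental theorem on
    the compact interval suffices. *)
Let integral_oo (F : R -> R) : (forall t : R, 0 < t -> {for t, continuous F}) ->
  (forall t : R, 0 < t -> t <= delta -> F t = 0) ->
  (\int[leb]_(t in `]0%R, T[) (F t)%:E = \int[leb]_(t in `[delta, T]) (F t)%:E)%E.
Proof.
move=> cF F0; rewrite integral_itv_bndo_bndc; last first.
  apply/measurable_EFinP; apply: open_continuous_measurable_fun; first exact: interval_open.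
  by move=> t /set_mem; rewrite /= in_itv/= => /andP[t0 _]; exact: cF.
rewrite integral_mkcond [RHS]integral_mkcond; apply: eq_integral => t _.
rewrite !patchE; case: ifPn => [/set_mem|/negP t1]; case: ifPn => //.
- move=> /negP t2 t1; rewrite F0//.
    by move: t1; rewrite /= in_itv/= => /andP[].
  rewrite leNgt; apply/negP => dt.
  apply: t2; apply/mem_set; move: t1; rewrite /= !in_itv/= => /andP[_ ->].
  by rewrite ltW.
- move=> /set_mem t2; exfalso; apply: t1; apply/mem_set; move: t2.
  by rewrite /= !in_itv/= => /andP[dt ->]; rewrite (lt_le_trans delta_gt0).
Qed.

(* The fundamental theorem of calculus for
   [h t = b |b|^(p-2) |f t|^p t^(1-p-lambda)], whose value at [T] is moved to the
   side on which it is nonnegative. *)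
Lemma half_chord_identity :
  (\int[leb]_(t in `]0%R, T[) (t `^ (- lambda) * `|df t| `^ p)%:E
   + (Num.max (- k) 0 * (`|f T| `^ p * T `^ (1 - p - lambda)))%:E =
   (`|b| `^ p)%:E * \int[leb]_(t in `]0%R, T[) (`|f t| `^ p * t `^ (- lambda - p))%:E
   + ((Num.max k 0 * (`|f T| `^ p * T `^ (1 - p - lambda)))%:E
      + \int[leb]_(t in `]0%R, T[) (t `^ (- lambda) * Cp p (df t) (df t - b * f t / t))%:E))%E.
Proof.
rewrite (integral_oo cFA FA0) (integral_oo cFB FB0) (integral_oo cFC FC0) integral_cc.
have E : h T + Num.max (- k) 0 * (`|f T| `^ p * T `^ (1 - p - lambda)) =
    Num.max k 0 * (`|f T| `^ p * T `^ (1 - p - lambda)).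
  rewrite /h -mulrDl; congr (_ * _).
  have [k0|k0] := leP k 0.
    have kN0 : 0 <= - k by rewrite oppr_ge0.
    by rewrite (max_idPl kN0) subrr.
  have kN0 : - k <= 0 by rewrite oppr_le0 ltW.
  by rewrite (max_idPr kN0) addr0.
rewrite -[LHS]addeA -EFinD E -[LHS]addeA.
by rewrite [X in (_ + X)%E = _]addeC.
Qed.

(** An unbounded half chord is a half chord cut at [T], beyond the support, where the boundary term
    is 0. *)
Lemma half_line_identity : (forall t : R, T <= t -> f t = 0) -> (forall t : R, T <= t -> df t = 0) ->
  (\int[leb]_(t in `]0%R, +oo[) (t `^ (- lambda) * `|df t| `^ p)%:E =
   (`|b| `^ p)%:E * \int[leb]_(t in `]0%R, +oo[) (`|f t| `^ p * t `^ (- lambda - p))%:E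
   + \int[leb]_(t in `]0%R, +oo[) (t `^ (- lambda) * Cp p (df t) (df t - b * f t / t))%:E)%E.
Proof.
move=> fT dfT.
have oy (F : R -> R) : (forall t : R, T <= t -> F t = 0) ->
    (\int[leb]_(t in `]0%R, +oo[) (F t)%:E = \int[leb]_(t in `]0%R, T[) (F t)%:E)%E.
  move=> FT; rewrite integral_mkcond [RHS]integral_mkcond; apply: eq_integral => t _.
  rewrite !patchE; case: ifPn => [/set_mem|/negP t1]; case: ifPn => //.
  - move=> /negP t2 t1; rewrite FT// leNgt; apply/negP => tT; apply: t2.
    by apply/mem_set; move: t1; rewrite /= !in_itv/= tT andbT => ->.
  - move=> /set_mem t2; exfalso; apply: t1; apply/mem_set; move: t2.
    by rewrite /= !in_itv/= andbT => /andP[].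
rewrite (oy FA); last by move=> t tT; rewrite /FA dfT// normr0 powR0 ?mulr0// gt_eqF.
rewrite (oy FB); last by move=> t tT; rewrite /FB fT// normr0 powR0 ?mul0r// gt_eqF.
rewrite (oy FC); last first.
  move=> t tT; rewrite /FC fT// dfT// mulr0 mul0r subr0 (Cp_id p1) normr0.
  by rewrite powR0 ?mulr0// gt_eqF.
have := half_chord_identity; rewrite fT// normr0 powR0 ?gt_eqF// mul0r !mulr0.
by rewrite adde0 add0e.
Qed.

End half_chord.

(** * Directional derivatives *)

Section strict_derivative.
Context {R : realType} (n : nat).
Implicit Types (f : 'rV[R]_n -> R) (x y v w : 'rV[R]_n).

(* Strict differentiability along a direction, being uniform in the base point,
   is additive in the direction; continuous partial derivatives give it along
   the axes. *)
Definition strict_derive f x v (l : R) := forall e : R, 0 < e ->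
  exists2 d : R, 0 < d & forall y (h : R), `|y - x| < d -> `|h| < d ->
    `|f (y + h *: v) - f y - h * l| <= e * `|h|.

Lemma strict_deriveD f x v w l m :
  strict_derive f x v l -> strict_derive f x w m -> strict_derive f x (v + w) (l + m).
Proof.
move=> sv sw e e0.
have e2 : 0 < e / 2 by rewrite divr_gt0.
have [d1 d10 h1] := sv _ e2; have [d2 d20 h2] := sw _ e2.
have v0 : 0 < 1 + `|v| by rewrite ltr_pwDl.
(* The increment along [w] starts from y + h v, which must stay within [d2] of x: half of [d2] is
   spent on y - x, half on h v. The summand 1 avoids a division by 0. *)
exists (Num.min d1 (Num.min (d2 / 2) (d2 / 2 / (1 + `|v|)))).
  by rewrite !lt_min d10 !divr_gt0.
move=> y h; rewrite !lt_min => /andP[y1 /andP[y2 _]] /andP[hd1 /andP[hd2 hd3]].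
have -> : f (y + h *: (v + w)) - f y - h * (l + m) =
    (f (y + h *: v + h *: w) - f (y + h *: v) - h * m) + (f (y + h *: v) - f y - h * l).
  by rewrite scalerDr addrA; ring.
rewrite (le_trans (ler_normD _ _))//.
have -> : e * `|h| = e / 2 * `|h| + e / 2 * `|h| by field.
apply: lerD; last exact: h1.
apply: h2; last by apply: (lt_trans hd2); rewrite ltr_pdivrMr// mulr_natr mulr2n ltrDl.
have -> : y + h *: v - x = (y - x) + h *: v by rewrite addrAC.
rewrite (le_lt_trans (ler_normD _ _))// (splitr d2) ltrD//.
rewrite normrZ (@le_lt_trans _ _ (`|h| * (1 + `|v|)))//.
  by rewrite ler_wpM2l// lerDr.
by rewrite -ltr_pdivlMr.
Qed.

Lemma strict_deriveZ f x v l c : strict_derive f x v l -> strict_derive f x (c *: v) (c * l).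
Proof.
move=> sv e e0; have c0 : 0 < 1 + `|c| by rewrite ltr_pwDl.
have ec : 0 < e / (1 + `|c|) by rewrite divr_gt0.
have [d d0 hd] := sv _ ec.
exists (Num.min d (d / (1 + `|c|))); first by rewrite lt_min d0 divr_gt0.
move=> y h; rewrite !lt_min => /andP[y1 _] /andP[_ h2].
rewrite scalerA mulrA.
have hcc : `|h * c| <= `|h| * (1 + `|c|) by rewrite normrM ler_wpM2l// lerDr.
rewrite (le_trans (hd y (h * c) y1 _))//.
  by rewrite (le_lt_trans hcc)// -ltr_pdivlMr.
rewrite -mulrA ler_pM2l// ler_pdivrMl// [leRHS]mulrC//.
Qed.

Lemma strict_derive0 f x : strict_derive f x 0 0.
Proof.
move=> e e0; exists 1 => // y h _ _.
by rewrite scaler0 addr0 subrr mulr0 subr0 normr0 mulr_ge0// ltW.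
Qed.

Lemma is_derive_shift f y i (t : R) : derivable f (y + t *: delta_mx ord0 i) (delta_mx ord0 i) ->
  is_derive t 1 (fun s : R => f (y + s *: delta_mx ord0 i)) (partial i f (y + t *: delta_mx ord0 i)).
Proof.
move=> df.
have E : (fun h : R => h^-1 *: ((f (y + (h *: 1 + t) *: delta_mx ord0 i)) - f (y + t *: delta_mx ord0 i))) =
   (fun h : R => h^-1 *: (f (h *: delta_mx ord0 i + (y + t *: delta_mx ord0 i)) - f (y + t *: delta_mx ord0 i))).
  apply/funext => h; congr (_ *: (f _ - _)).
  by rewrite scalerDl /GRing.scale/= mulr1 addrCA.
apply: DeriveDef; first by rewrite /derivable E.
by rewrite /partial /derive E.
Qed.

(** Mean value theorem for t -> f(y + t e_i) - t d_i f(x): its derivative is the oscillation of the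
    partial derivative, small uniformly in y near x. *)
Lemma strict_derive_partial f x i : (forall y, derivable f y (delta_mx ord0 i)) ->
  continuous (partial i f) -> strict_derive f x (delta_mx ord0 i) (partial i f x).
Proof.
move=> df cp e e0.
have : \forall y \near x, `|partial i f x - partial i f y| < e.
  by move/cvgrPdist_lt : (cp x); apply.
move=> /nbhs_ballP[d /= d0 hd].
have v0 : 0 < 1 + `|delta_mx ord0 i : 'rV[R]_n| by rewrite ltr_pwDl.
exists (Num.min (d / 2) (d / 2 / (1 + `|delta_mx ord0 i : 'rV[R]_n|))).
  by rewrite lt_min !divr_gt0.
move=> y h; rewrite !lt_min => /andP[yx _] /andP[_ hd2].
pose g (t : R) := f (y + t *: delta_mx ord0 i) - t * partial i f x.
pose dg (t : R) := partial i f (y + t *: delta_mx ord0 i) - partial i f x.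
have Hg (t : R) : is_derive t 1 g (dg t).
  apply: is_deriveB; first exact: is_derive_shift.
  have := @is_deriveM R R id (cst (partial i f x)) t 1 1 0.
  by rewrite /GRing.scale/= mulr0 add0r mulr1; apply.
have gd (t : R) : `|t| <= `|h| -> `|dg t| <= e.
  move=> th; rewrite /dg distrC ltW//; apply: hd; rewrite -ball_normE/=.
  rewrite opprD addrA (le_lt_trans (ler_normB _ _))// (splitr d) ltrD//.
    by rewrite distrC.
  rewrite normrZ (@le_lt_trans _ _ (`|h| * (1 + `|delta_mx ord0 i : 'rV[R]_n|)))//.
    by rewrite ler_pM// lerDr.
  by rewrite -ltr_pdivlMr.
have cg : continuous g.
  move=> t; apply: differentiable_continuous; apply/derivable1_diffP; by have [] := Hg t.
have -> : f (y + h *: delta_mx ord0 i) - f y - h * partial i f x = g h - g 0.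
  by rewrite /g scale0r addr0 mul0r subr0; ring.
have [h0|h0] := leP 0 h.
  have [c] := MVT_segment h0 (fun t _ => Hg t) (continuous_subspaceT cg).
  rewrite in_itv/= => /andP[c0 ch] ->; rewrite subr0 normrM ler_wpM2r// gd//.
  by rewrite !ger0_norm.
have [c] := MVT_segment (ltW h0) (fun t _ => Hg t) (continuous_subspaceT cg).
rewrite in_itv/= => /andP[c0 ch] E; rewrite distrC E sub0r normrM normrN ler_wpM2r// gd//.
by rewrite (ler0_norm ch) (ler0_norm (ltW h0)) lerN2.
Qed.

Lemma strict_derive_class_C1 f x v : class_C 1 f ->
  strict_derive f x v (dotp v (grad f x)).
Proof.
move=> [_ [df cf]].
rewrite [X in strict_derive _ _ X](_ : v = \sum_i v ord0 i *: delta_mx ord0 i); last first.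
  by rewrite [LHS]row_sum_delta.
rewrite /dotp.
elim/big_ind2 : _ => [|w l w' l' h1 h2|i _].
- exact: strict_derive0.
- exact: strict_deriveD.
- rewrite mxE; apply: strict_deriveZ; apply: strict_derive_partial => //.
  by have [] := cf i.
Qed.

Lemma strict_derive_is_derive f x v l : strict_derive f x v l -> is_derive x v f l.
Proof.
move=> sf.
have H : (fun h : R => h^-1 *: (f (h *: v + x) - f x)) @ 0^' --> l.
  apply/cvgrPdist_le => e e0; have [d d0 hd] := sf _ e0.
  near=> h.
  have h0 : h != 0 by near: h; exact: nbhs_dnbhs_neq.
  have hsmall : `|h| < d.
    by near: h; apply: dnbhs0_lt.
  have := hd x h; rewrite subrr normr0 => /(_ d0 hsmall).
  rewrite (addrC x) => H; rewrite distrC.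
  have -> : h^-1 *: (f (h *: v + x) - f x) - l = h^-1 * (f (h *: v + x) - f x - h * l).
    by rewrite /GRing.scale/=; field.
  by rewrite normrM normfV ler_pdivrMl ?normr_gt0// [leRHS]mulrC.
by apply: DeriveDef; [apply/cvg_ex; exists l|apply/cvg_lim].
Unshelve. all: by end_near. Qed.

Lemma is_derive_class_C1 f x v : class_C 1 f -> is_derive x v f (dotp v (grad f x)).
Proof. by move=> /strict_derive_class_C1 h; exact/strict_derive_is_derive. Qed.

Lemma derive_class_C1 f x v : class_C 1 f -> 'D_v f x = dotp v (grad f x).
Proof. by move=> /is_derive_class_C1 h; have [] := h x v. Qed.

Lemma is_derive_line_C1 f x v (t : R) : class_C 1 f ->
  is_derive t 1 (fun s : R => f (x + s *: v)) (dotp v (grad f (x + t *: v))).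
Proof.
move=> Cf; have [df <-] := is_derive_class_C1 (x + t *: v) v Cf.
have E : (fun h : R => h^-1 *: ((f (x + (h *: 1 + t) *: v)) - f (x + t *: v))) =
   (fun h : R => h^-1 *: (f (h *: v + (x + t *: v)) - f (x + t *: v))).
  apply/funext => h; congr (_ *: (f _ - _)).
  by rewrite scalerDl /GRing.scale/= mulr1 addrCA.
apply: DeriveDef; first by rewrite /derivable E.
by rewrite /derive E.
Qed.

Lemma continuous_grad_line f x v : class_C 1 f ->
  continuous (fun s : R => dotp v (grad f (x + s *: v))).
Proof.
move=> [_ [_ cf]]; rewrite /dotp.
elim: (index_enum _) => [|i r IH] s.
  by under eq_fun do rewrite big_nil; exact: cvg_cst.
under eq_fun do rewrite big_cons mxE.
apply: cvgD; last exact: IH.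
apply: cvgM; first exact: cvg_cst.
apply: (@continuous_comp _ _ _ (fun s : R => x + s *: v) (partial i f)).
  exact: line_continuous.
by have [+ _] := cf i; apply.
Qed.

Lemma measurable_grad f : class_C 1 f -> measurable_fun setT (fun x => grad f x).
Proof.
move=> [_ [_ cf]]; apply: measurable_fun_rV => i; under eq_fun do rewrite mxE.
by apply: continuous_measurable_rV; have [] := cf i.
Qed.

Lemma measurable_dotp d (T : measurableType d) (g h : T -> 'rV[R]_n) :
  measurable_fun setT g -> measurable_fun setT h ->
  measurable_fun setT (fun t => dotp (g t) (h t)).
Proof.
move=> mg mh; rewrite /dotp; apply: measurable_sum => i; apply: measurable_funM.
  exact: measurableT_comp (measurable_rV_coord i) mg.
exact: measurableT_comp (measurable_rV_coord i) mh.
Qed.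

Lemma dotp_cauchy_schwarz v w : `|dotp v w| <= enorm v * enorm w.
Proof.
have [v0|v0] := eqVneq (dotp v v) 0.
  have -> : v = 0.
    apply/rowP => i; rewrite mxE; apply/eqP; rewrite -normr_le0.
    by apply: le_trans (coord_le_enorm v i) _; rewrite /enorm v0 sqrtr0.
  by rewrite /dotp big1 ?normr0 ?mulr_ge0 ?enorm_ge0// => i _; rewrite mxE mul0r.
have vp : 0 < dotp v v by rewrite lt_neqAle eq_sym v0 dotp_ge0.
rewrite /enorm -sqrtrM ?dotp_ge0// -sqrtr_sqr ler_wsqrtr//.
have := dotp_ge0 (dotp v v *: w - dotp v w *: v).
have -> : dotp (dotp v v *: w - dotp v w *: v) (dotp v v *: w - dotp v w *: v) =
    dotp v v * (dotp v v * dotp w w - dotp v w ^+ 2).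
  have bil a b' : dotp (a *: w - b' *: v) (a *: w - b' *: v) =
      a ^+ 2 * dotp w w - 2 * a * b' * dotp v w + b' ^+ 2 * dotp v v.
    rewrite /dotp !mulr_sumr -sumrB -big_split/=; apply: eq_bigr => i _.
    by rewrite !mxE; ring.
  by rewrite bil; ring.
by rewrite pmulr_rge0// subr_ge0.
Qed.

End strict_derivative.

(** * Integrands *)

Section epow.
Context {R : realType}.
Local Open Scope ereal_scope.

Lemma epow_ge0 (x : \bar R) r : 0 <= epow x r.
Proof. by rewrite /epow; case: ifP => _; rewrite ?inve_ge0 poweR_ge0. Qed.

Lemma epow_EFin (x r : R) : (0 < x)%R -> epow x%:E r = (x `^ r)%:E.
Proof.
move=> x0; rewrite /epow; case: ifPn => // r0; rewrite poweR_EFin inver.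
by rewrite gt_eqF ?powR_gt0// -powRN opprK.
Qed.

Lemma epowr0 (x : \bar R) : epow x 0 = 1.
Proof. by rewrite /epow lexx poweRe0. Qed.

Lemma epowy_gt0 (r : R) : (0 < r)%R -> epow +oo r = +oo.
Proof. by move=> r0; rewrite /epow ltW//= gt_eqF. Qed.

Lemma epowy_lt0 (r : R) : (r < 0)%R -> epow +oo r = 0.
Proof.
by move=> r0; rewrite /epow leNgt r0/= oppr_eq0 lt_eqF// invey.
Qed.

Lemma measurable_epow (r : R) : measurable_fun [set: \bar R] (epow ^~ r).
Proof.
have [r0|/negbTE r0] := boolP (0 <= r)%R; rewrite /epow r0; first exact: measurable_poweR.
rewrite (_ : (fun _ => _) = (fun y => if y == 0 then +oo else if y == +oo then 0 else
   (fine y `^ (-1))%:E) \o (fun x : \bar R => x `^ (- r))); last first.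
  apply/funext => x /=; have := poweR_ge0 x (- r); case: (x `^ (- r)) => [y||]//=.
  rewrite lee_fin => y0; rewrite inver eqe; case: ifPn => // _.
  by rewrite powR_inv1.
apply: measurableT_comp (measurable_poweR _).
apply: measurable_fun_ifT => //=; first exact: measurable_fun_eqe.
apply: measurable_fun_ifT => //=; first exact: measurable_fun_eqe.
apply/measurable_EFinP.
exact: (@measurableT_comp _ _ _ _ _ _ (@powR R ^~ (-1)%R)).
Qed.

End epow.

Section fields.
Context {R : realType} {n : nat} (Omega : set 'rV[R]_n).
Hypothesis oO : open Omega.
Variable u : 'rV[R]_n -> R.
Hypothesis Cu : class_C 1 u.
Implicit Types (nu x y : 'rV[R]_n).
Notation fw nu x := (exit_time Omega nu x).
Notation bw nu x := (exit_time Omega (- nu) x).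

Lemma rho_exit nu x : rho Omega nu x = mine (fw nu x) (bw nu x).
Proof.
apply/eqP; rewrite eq_le; apply/andP; split.
  rewrite le_min; apply/andP; split; apply: le_ereal_inf_tmp => _ [s [s0 Os] <-].
    by apply: ereal_inf_lbound; exists s => //=; rewrite ger0_norm.
  apply: ereal_inf_lbound; exists (- s) => /=; first by rewrite scaleNr -scalerN.
  by rewrite normrN ger0_norm.
apply: le_ereal_inf_tmp => _ [s /= Os <-]; rewrite ge_min.
have [s0|s0] := leP 0 s; apply/orP; [left|right]; apply: ereal_inf_lbound.
  by exists s => //; rewrite ger0_norm.
exists (- s) => /=; last by rewrite ler0_norm// ltW.
by rewrite oppr_ge0 ltW// scaleNr scalerN opprK.
Qed.

Lemma measurable_rho : measurable_fun setT (fun z : 'rV[R]_n * 'rV[R]_n => rho Omega z.1 z.2).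
Proof.
under eq_fun do rewrite rho_exit.
apply: measurable_mine; first exact: measurable_exit_time.
have := measurableT_comp (measurable_exit_time oO) (_ : measurable_fun setT
  (fun z : 'rV[R]_n * 'rV[R]_n => (- z.1, z.2))).
apply; apply/measurable_fun_pairP; split => /=; last exact: measurable_snd.
by apply: measurable_rVN; exact: measurable_fst.
Qed.

(* The value of [weighted_derive] on [Omega]. At a midpoint the weighted function
   is not differentiable, unless [b * u x = 0], and ['D_nu] is [0] there. *)
Definition wder (b : R) nu x : R :=
  if (fw nu x < bw nu x)%E then dotp nu (grad u x) + b * u x / fine (fw nu x)
  else if (bw nu x < fw nu x)%E then dotp nu (grad u x) - b * u x / fine (bw nu x)
  else if fw nu x == +oo%E then dotp nu (grad u x)
  else if b * u x == 0 then dotp nu (grad u x) else 0.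

(** On an unbounded chord [fine] replaces the infinite exit time by 0 and the value is meaningless;
    [chord_weight] is 0 there. *)
Definition mid nu x := x + ((fine (fw nu x) - fine (bw nu x)) / 2) *: nu.

Definition halflen nu x : R := (fine (fw nu x) + fine (bw nu x)) / 2.

(* Of integral 1 on a bounded chord, and supported at distance at most 1 from its
   midpoint, so that the skeletal measure is finite on compact sets. *)
Definition chord_weight nu x : R :=
  let t := Num.min (halflen nu x) 1 in
  if ((fw nu x < +oo) && (bw nu x < +oo))%E && (`|fine (fw nu x) - fine (bw nu x)| / 2 < t)
  then (2 * t)^-1 else 0.

Let mfw : measurable_fun setT (fun z : 'rV[R]_n * 'rV[R]_n => fw z.1 z.2).
Proof. exact: measurable_exit_time. Qed.

Let mbw : measurable_fun setT (fun z : 'rV[R]_n * 'rV[R]_n => bw z.1 z.2).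
Proof.
have := measurableT_comp (measurable_exit_time oO) (_ : measurable_fun setT
  (fun z : 'rV[R]_n * 'rV[R]_n => (- z.1, z.2))).
apply; apply/measurable_fun_pairP; split => /=; last exact: measurable_snd.
by apply: measurable_rVN; exact: measurable_fst.
Qed.

Let mffw : measurable_fun setT (fun z : 'rV[R]_n * 'rV[R]_n => fine (fw z.1 z.2)).
Proof. by apply: measurableT_comp mfw; exact: fine_measurable. Qed.

Let mfbw : measurable_fun setT (fun z : 'rV[R]_n * 'rV[R]_n => fine (bw z.1 z.2)).
Proof. by apply: measurableT_comp mbw; exact: fine_measurable. Qed.

Let mu2 : measurable_fun setT (fun z : 'rV[R]_n * 'rV[R]_n => u z.2).
Proof.
apply: measurableT_comp; last exact: measurable_snd.
by apply: continuous_measurable_rV; have [] := Cu.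
Qed.

Let mD : measurable_fun setT (fun z : 'rV[R]_n * 'rV[R]_n => dotp z.1 (grad u z.2)).
Proof.
apply: measurable_dotp; first exact: measurable_fst.
by apply: measurableT_comp; [exact: measurable_grad|exact: measurable_snd].
Qed.

Let measurable_inv_ge0 d (T : measurableType d) (f : T -> R) : (forall t, 0 <= f t) ->
  measurable_fun setT f -> measurable_fun setT (fun t => (f t)^-1).
Proof.
move=> f0 mf; rewrite (_ : (fun _ => _) = (@powR R ^~ (-1)) \o f).
  by apply: measurableT_comp mf; exact: measurable_powR.
by apply/funext => t /=; rewrite powR_inv1.
Qed.

Lemma measurable_mid : measurable_fun setT (fun z : 'rV[R]_n * 'rV[R]_n => mid z.1 z.2).
Proof.
apply: measurable_rVD; first exact: measurable_snd.
apply: measurable_rVZ; last exact: measurable_fst.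
by apply: measurable_funM; [exact: measurable_funB|exact: measurable_cst].
Qed.

Lemma measurable_halflen : measurable_fun setT (fun z : 'rV[R]_n * 'rV[R]_n => halflen z.1 z.2).
Proof. by apply: measurable_funM; [exact: measurable_funD|exact: measurable_cst]. Qed.

Lemma fine_exit_ge0 nu x : 0 <= fine (fw nu x).
Proof. by apply: fine_ge0; exact: exit_time_ge0. Qed.

Lemma halflen_ge0 nu x : 0 <= halflen nu x.
Proof. by rewrite divr_ge0// addr_ge0// fine_exit_ge0. Qed.

Lemma chord_weight_ge0 nu x : 0 <= chord_weight nu x.
Proof.
rewrite /chord_weight; case: ifP => // _.
by rewrite invr_ge0 mulr_ge0// le_min halflen_ge0 ler01.
Qed.

Lemma measurable_chord_weight :
  measurable_fun setT (fun z : 'rV[R]_n * 'rV[R]_n => chord_weight z.1 z.2).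
Proof.
have mt : measurable_fun setT (fun z : 'rV[R]_n * 'rV[R]_n => Num.min (halflen z.1 z.2) 1).
  by apply: measurable_minr; [exact: measurable_halflen|exact: measurable_cst].
apply: measurable_fun_ifT => //.
- apply: measurable_and.
    by apply: measurable_and; apply: measurable_fun_lte.
  apply: measurable_fun_ltr => //; apply: measurable_funM => //.
  by apply: measurableT_comp; [exact: normr_measurable|exact: measurable_funB].
- apply: measurable_inv_ge0; last by apply: measurable_funM.
  by move=> z; rewrite mulr_ge0// le_min halflen_ge0 ler01.
Qed.

Lemma measurable_wder b : measurable_fun setT (fun z : 'rV[R]_n * 'rV[R]_n => wder b z.1 z.2).
Proof.
have mbu : measurable_fun setT (fun z : 'rV[R]_n * 'rV[R]_n => b * u z.2).
  by apply: measurable_funM.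
apply: measurable_fun_ifT; first exact: measurable_fun_lte.
  apply: measurable_funD => //; apply: measurable_funM => //.
  by apply: measurable_inv_ge0; [move=> z; exact: fine_exit_ge0|].
apply: measurable_fun_ifT; first exact: measurable_fun_lte.
  apply: measurable_funB => //; apply: measurable_funM => //.
  by apply: measurable_inv_ge0; [move=> z; exact: fine_exit_ge0|].
apply: measurable_fun_ifT; [exact: measurable_fun_eqe|by []|].
by apply: measurable_fun_ifT => //; exact: measurable_fun_eqr.
Qed.

End fields.

Section integrands.
Context {R : realType} {n : nat} (Omega : set 'rV[R]_n).
Hypothesis oO : open Omega.
Variable u : 'rV[R]_n -> R.
Hypothesis Cu : class_C 1 u.
Variables p lambda : R.
Hypothesis p1 : 1 < p.
Local Open Scope ereal_scope.
Implicit Types (nu x y : 'rV[R]_n).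

Let b : R := ((p + lambda - 1) / p)%R.

Definition gradient_term nu x : \bar R := epow (rho Omega nu x) (- lambda) * (`|dotp nu (grad u x)| `^ p)%:E.
Definition hardy_term nu x : \bar R := (`|u x| `^ p)%:E * epow (rho Omega nu x) (- (lambda + p)).
Definition Cp_term nu x : \bar R :=
  epow (rho Omega nu x) (- lambda) * (Cp p (dotp nu (grad u x)) (wder Omega u b nu x))%:E.
(** The first two factors are constant on a bounded chord, where [halflen] is the value of [rho] at
    the midpoint. As the weight has integral 1, the chord contributes exactly its skeletal value. *)
Definition midpoint_term nu x : \bar R :=
  (`|u (mid Omega nu x)| `^ p * halflen Omega nu x `^ (1 - p - lambda)
   * chord_weight Omega nu x)%:E.

Lemma gradient_term_ge0 nu x : 0 <= gradient_term nu x. Proof. by rewrite mule_ge0 ?epow_ge0// lee_fin powR_ge0. Qed.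
Lemma hardy_term_ge0 nu x : 0 <= hardy_term nu x. Proof. by rewrite mule_ge0 ?epow_ge0// lee_fin powR_ge0. Qed.
Lemma Cp_term_ge0 nu x : 0 <= Cp_term nu x. Proof. by rewrite mule_ge0 ?epow_ge0// lee_fin Cp_ge0. Qed.
Lemma midpoint_term_ge0 nu x : 0 <= midpoint_term nu x.
Proof. by rewrite lee_fin !mulr_ge0 ?powR_ge0// chord_weight_ge0. Qed.

Let mrho r : measurable_fun setT (fun z : 'rV[R]_n * 'rV[R]_n => epow (rho Omega z.1 z.2) r).
Proof. apply: measurableT_comp (measurable_epow r) _; exact: measurable_rho. Qed.

Let mnp d (T : measurableType d) (f : T -> R) (r : R) : measurable_fun setT f ->
  measurable_fun setT (fun t => `|f t| `^ r)%R.
Proof.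
move=> mf; apply: (measurableT_comp (measurable_powR r)).
by apply: measurableT_comp; [exact: normr_measurable|].
Qed.

Let mD : measurable_fun setT (fun z : 'rV[R]_n * 'rV[R]_n => dotp z.1 (grad u z.2)).
Proof.
apply: measurable_dotp; first exact: measurable_fst.
by apply: measurableT_comp; [exact: measurable_grad|exact: measurable_snd].
Qed.

Let mu : measurable_fun setT u.
Proof. by apply: continuous_measurable_rV; have [] := Cu. Qed.

Lemma measurable_gradient_term : measurable_fun setT (fun z : 'rV[R]_n * 'rV[R]_n => gradient_term z.1 z.2).
Proof. by apply: emeasurable_funM => //; apply/measurable_EFinP; exact: mnp. Qed.

Lemma measurable_hardy_term : measurable_fun setT (fun z : 'rV[R]_n * 'rV[R]_n => hardy_term z.1 z.2).
Proof.
apply: emeasurable_funM => //; apply/measurable_EFinP; apply: mnp.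
by apply: measurableT_comp; [exact: mu|exact: measurable_snd].
Qed.

Lemma measurable_Cp d (T : measurableType d) (f g : T -> R) : measurable_fun setT f ->
  measurable_fun setT g -> measurable_fun setT (fun t => Cp p (f t) (g t)).
Proof.
move=> mf mg; have mfg : measurable_fun setT (fun t => f t - g t)%R by exact: measurable_funB.
apply: measurable_funB; first by apply: measurable_funB; exact: mnp.
apply: measurable_funM => //; apply: measurable_funM => //.
by apply: measurable_funM; [exact: measurable_cst|exact: mnp].
Qed.

Lemma measurable_Cp_term : measurable_fun setT (fun z : 'rV[R]_n * 'rV[R]_n => Cp_term z.1 z.2).
Proof.
apply: emeasurable_funM => //; apply/measurable_EFinP; apply: measurable_Cp => //.
exact: measurable_wder.
Qed.

Lemma measurable_midpoint_term : measurable_fun setT (fun z : 'rV[R]_n * 'rV[R]_n => midpoint_term z.1 z.2).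
Proof.
apply/measurable_EFinP; apply: measurable_funM; last exact: measurable_chord_weight.
apply: measurable_funM.
  by apply: mnp; apply: measurableT_comp; [exact: mu|exact: measurable_mid].
apply: (measurableT_comp (measurable_powR _)); exact: measurable_halflen.
Qed.

End integrands.

(** * The derivative of the weighted quotient *)

Section weighted_derive.
Context {R : realType} {n : nat} (Omega : set 'rV[R]_n).
Hypothesis oO : open Omega.
Implicit Types (nu x y : 'rV[R]_n).
Notation fw nu x := (exit_time Omega nu x).
Notation bw nu x := (exit_time Omega (- nu) x).

Lemma line_quotientE (G : 'rV[R]_n -> R) x v :
  (fun h : R => h^-1 *: ((fun s : R => G (x + s *: v)) (h *: 1 + 0) - (fun s : R => G (x + s *: v)) 0)) =
  (fun h : R => h^-1 *: (G (h *: v + x) - G x)).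
Proof.
apply/funext => h /=; have -> : h *: (1 : R) + 0 = h by rewrite addr0 /GRing.scale/= mulr1.
by rewrite scale0r addr0 (addrC x).
Qed.

Lemma is_derive_line (G : 'rV[R]_n -> R) x v l :
  is_derive (0 : R) 1 (fun s : R => G (x + s *: v)) l <-> is_derive x v G l.
Proof.
split => -[d <-].
  apply: DeriveDef; first by rewrite /derivable -line_quotientE.
  by rewrite /derive -line_quotientE.
apply: DeriveDef; first by rewrite /derivable line_quotientE.
by rewrite /derive line_quotientE.
Qed.

(** Away from midpoints [rho] is c + e h along the line, with e = -1 if the forward end is nearer
    and e = 1 if the backward one is. At a midpoint both formulas hold, one on each side. *)
Lemma is_derive_quot (f : R -> R) (D0 c e b : R) : 0 < c -> is_derive (0 : R) 1 f D0 ->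
  is_derive (0 : R) 1 (fun h : R => f h / (c + e * h) `^ b) (c `^ (- b) * (D0 - b * e * f 0 / c)).
Proof.
move=> c0 fD.
have H1 : is_derive (0 : R) 1 (fun h : R => c + e * h) e.
  have := @is_deriveD R R R (cst c) ( *%R e) 0 1 0 e (is_derive_cst _ _ _).
  rewrite add0r; apply.
  by have := @is_deriveM R R (cst e) id 0 1 0 1; rewrite /GRing.scale/= mulr1 mulr0 addr0; apply.
have H2 : is_derive (0 : R) 1 (fun h : R => @powR R (c + e * h) (- b)) (- b * c `^ (- b - 1) * e).
  have H3 : is_derive (c + e * 0) 1 (fun t : R => @powR R t (- b)) (- b * c `^ (- b - 1)).
    by rewrite mulr0 addr0; exact: is_derive1_powR.
  exact: (@is_derive1_comp R (fun t : R => @powR R t (- b)) (fun h => c + e * h) 0 _ _ H3 H1).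
have := is_deriveM fD H2; rewrite /GRing.scale/= mulr0 addr0.
rewrite (_ : f * _ = (fun h : R => f h / (c + e * h) `^ b)); last first.
  by apply/funext => h /=; rewrite -powRN.
congr (is_derive _ _ _ _).
rewrite [c `^ (- b - 1)]powRD ?(gt_eqF c0) ?implybT// powR_inv1 ?ltW//.
by field; rewrite gt_eqF.
Qed.

Variable u : 'rV[R]_n -> R.
Hypothesis Cu : class_C 1 u.
Variable b : R.

Let G nu y := u y / fine (rho Omega nu y) `^ b.

Let is_derive_u nu x : is_derive (0 : R) 1 (fun s : R => u (x + s *: nu)) (dotp nu (grad u x)).
Proof. by apply/is_derive_line; exact: is_derive_class_C1. Qed.

Let is_derive_G nu x (c e : R) : 0 < c ->
  (\forall h \near (0 : R), rho Omega nu (x + h *: nu) = (c + e * h)%:E) ->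
  is_derive x nu (G nu) (c `^ (- b) * (dotp nu (grad u x) - b * e * u x / c)).
Proof.
move=> c0 H; apply/is_derive_line.
have := is_derive_quot e b c0 (is_derive_u nu x).
rewrite scale0r addr0; apply: near_eq_is_derive.
by near=> h; rewrite /G (_ : rho _ _ _ = (c + e * h)%:E)//; near: h.
Unshelve. all: by end_near. Qed.

Let near0_lt (e : R) : 0 < e -> \forall h \near (0 : R), `|h| < e.
Proof.
by move=> e0; apply/nbhs_ballP; exists e => // h; rewrite -ball_normE/= sub0r normrN.
Qed.

Let near_chord nu x : Omega x -> \forall h \near (0 : R), chord Omega nu x h.
Proof.
move=> Ox; have [e e0 he] := chord_ball oO nu Ox.
near=> h; apply: he; near: h; exact: near0_lt.
Unshelve. all: by end_near. Qed.

Let rho_lt nu x (c : R) : Omega x -> fw nu x = c%:E -> (c%:E < bw nu x)%E ->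
  \forall h \near (0 : R), rho Omega nu (x + h *: nu) = (c + -1 * h)%:E.
Proof.
move=> Ox fc cb.
have [e e0 he] : exists2 e : R, 0 < e & ((c + e)%:E < bw nu x)%E.
  case: (bw nu x) cb => [d||]//; last by exists 1 => //; rewrite ltry.
  by rewrite lte_fin => cd; exists ((d - c) / 2); rewrite ?lte_fin; lra.
near=> h.
have ch : chord Omega nu x h by near: h; exact: near_chord.
have [E1 E2] := chord_exit oO ch.
have h2 : `|h| < e / 2 by near: h; apply: near0_lt; rewrite divr_gt0.
rewrite rho_exit E1 E2 fc -EFinB mulN1r; apply: min_idPl.
move: h2; rewrite ltr_norml => /andP[h1 h2].
apply: (@le_trans _ _ ((c + e)%:E + h%:E)%E).
  by rewrite -EFinD lee_fin; lra.
by rewrite leeD2r// ltW.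
Unshelve. all: by end_near. Qed.

Let rho_gt nu x (c : R) : Omega x -> bw nu x = c%:E -> (c%:E < fw nu x)%E ->
  \forall h \near (0 : R), rho Omega nu (x + h *: nu) = (c + 1 * h)%:E.
Proof.
move=> Ox fc cb.
have [e e0 he] : exists2 e : R, 0 < e & ((c + e)%:E < fw nu x)%E.
  case: (fw nu x) cb => [d||]//; last by exists 1 => //; rewrite ltry.
  by rewrite lte_fin => cd; exists ((d - c) / 2); rewrite ?lte_fin; lra.
near=> h.
have ch : chord Omega nu x h by near: h; exact: near_chord.
have [E1 E2] := chord_exit oO ch.
have h2 : `|h| < e / 2 by near: h; apply: near0_lt; rewrite divr_gt0.
rewrite rho_exit E1 E2 fc -EFinD mul1r; apply: min_idPr.
move: h2; rewrite ltr_norml => /andP[h1 h2].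
apply: (@le_trans _ _ ((c + e)%:E - h%:E)%E).
  by rewrite -EFinB lee_fin; lra.
by rewrite leeD2r// ltW.
Unshelve. all: by end_near. Qed.

Let rho_mid nu x (c : R) : Omega x -> bw nu x = c%:E -> fw nu x = c%:E ->
  \forall h \near (0 : R), rho Omega nu (x + h *: nu) = (c - `|h|)%:E.
Proof.
move=> Ox fc cb; near=> h.
have ch : chord Omega nu x h by near: h; exact: near_chord.
have [E1 E2] := chord_exit oO ch.
rewrite rho_exit E1 E2 fc cb -EFinB -EFinD -EFin_min; congr EFin.
have [h0|h0] := leP 0 h.
  by rewrite ger0_norm// min_l//; lra.
by rewrite ltr0_norm// opprK min_r//; lra.
Unshelve. all: by end_near. Qed.

(* At a midpoint the two one-sided derivatives differ by a nonzero multiple of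
   [b * u x]. *)
Let not_derivable_G nu x (c : R) : Omega x -> 0 < c -> bw nu x = c%:E -> fw nu x = c%:E ->
  b * u x != 0 -> ~ derivable (G nu) x nu.
Proof.
move=> Ox c0 bc fc bu dG.
have rm := rho_mid Ox bc fc.
pose q (h : R) := h^-1 *: (G nu (h *: nu + x) - G nu x).
have ql : q @ 0^' --> 'D_nu (G nu) x by [].
(* Along a one-sided filter c - |h| coincides with an affine function c + e h. If the derivative
   exists, it therefore equals the corresponding one-sided value; e = 1 and e = -1 are then
   compared. *)
have side (e : R) (F : set_system R) : ProperFilter F -> F `=>` 0^' ->
    (\forall h \near F, c - `|h| = c + e * h) ->
    'D_nu (G nu) x = c `^ (- b) * (dotp nu (grad u x) - b * e * u x / c).
  move=> PF F0 He; have FF : Filter F by exact: PF.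
  have rm' : \forall h \near 0^', rho Omega nu (x + h *: nu) = (c - `|h|)%:E.
    by apply: cvg_within; exact: rm.
  have rmF := F0 _ rm'.
  have qF : q @ F --> 'D_nu (G nu) x by exact: cvg_trans (cvg_app _ F0) ql.
  have [d dE] := is_derive_quot e b c0 (is_derive_u nu x).
  have : (fun h : R => h^-1 *: ((fun h => u (x + h *: nu) / (c + e * h) `^ b) (h *: 1 + 0) -
     (fun h => u (x + h *: nu) / (c + e * h) `^ b) 0)) @ F -->
     c `^ (- b) * (dotp nu (grad u x) - b * e * u (x + 0 *: nu) / c).
    by apply: cvg_trans (cvg_app _ F0) _; rewrite -dE.
  rewrite scale0r addr0 => H.
  suff : q @ F --> c `^ (- b) * (dotp nu (grad u x) - b * e * u x / c).
    by move=> qF'; exact: (cvg_unique (@Rhausdorff R) qF qF').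
  apply: cvg_trans H; apply: near_eq_cvg.
  near=> h; have h1 : h *: (1 : R) + 0 = h by rewrite addr0 /GRing.scale/= mulr1.
  rewrite /q /G /= h1 mulr0 addr0.
  have r0 : rho Omega nu x = c%:E by rewrite rho_exit bc fc minxx.
  rewrite r0/= (addrC (h *: nu)).
  have -> : rho Omega nu (x + h *: nu) = (c - `|h|)%:E.
    by near: h; exact: rmF.
  by rewrite /= (_ : c - `|h| = c + e * h)//; near: h.
have l0 : (0 : R)^'- `=>` 0^'.
  by move=> P; rewrite /at_left /dnbhs /within/=; apply: filterS => y h y0; apply: h; rewrite lt_eqF.
have r0 : (0 : R)^'+ `=>` 0^'.
  by move=> P; rewrite /at_right /dnbhs /within/=; apply: filterS => y h y0; apply: h; rewrite gt_eqF.
have E1 := side (-1) 0^'+ _ r0 _.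
have E2 := side 1 0^'- _ l0 _.
have : c `^ (- b) * (dotp nu (grad u x) - b * -1 * u x / c) =
       c `^ (- b) * (dotp nu (grad u x) - b * 1 * u x / c).
  rewrite -E1 ?E2//.
  - by near=> h; rewrite ltr0_norm ?mul1r ?opprK.
  - by near=> h; rewrite gtr0_norm ?mulN1r.
move/mulfI => /(_ (lt0r_neq0 (powR_gt0 _ c0))).
move=> H; move: bu; rewrite (_ : b * u x = 0) ?eqxx//.
have cN0 : c != 0 by rewrite gt_eqF.
have : (dotp nu (grad u x) - b * -1 * u x / c) - (dotp nu (grad u x) - b * 1 * u x / c) = 0.
  by rewrite H subrr.
have -> : (dotp nu (grad u x) - b * -1 * u x / c) - (dotp nu (grad u x) - b * 1 * u x / c)
   = 2 / c * (b * u x) by field.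
by move/eqP; rewrite mulf_eq0 mulf_eq0 invr_eq0 (negbTE cN0) pnatr_eq0/= => /eqP.
Unshelve. all: by end_near. Qed.

(** The kink is invisible when [u x = 0]: the difference quotient is the one of [u] times the
    continuous factor (c - |h|)^(-b). *)
Let is_derive_G0 nu x (c : R) : Omega x -> 0 < c -> bw nu x = c%:E -> fw nu x = c%:E ->
  u x = 0 -> is_derive x nu (G nu) (c `^ (- b) * dotp nu (grad u x)).
Proof.
move=> Ox c0 bc fc ux.
have rm := rho_mid Ox bc fc.
have H : (fun h : R => h^-1 *: (G nu (h *: nu + x) - G nu x)) @ 0^' -->
    c `^ (- b) * dotp nu (grad u x).
  have [d dE] := is_derive_class_C1 x nu Cu.
  have H1 : (fun h : R => h^-1 *: (u (h *: nu + x) - u x)) @ 0^' --> dotp nu (grad u x).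
    by rewrite -dE.
  have H2 : (fun h : R => (c - `|h|) `^ (- b)) @ 0^' --> c `^ (- b).
    apply: cvg_within_filter.
    have : {for 0, continuous (fun h : R => @powR R (c - `|h|) (- b))}.
      apply: (@continuous_comp _ _ _ (fun h : R => c - `|h|) (fun t : R => @powR R t (- b))).
        by apply: cvgB; [exact: cvg_cst|exact: norm_continuous].
      apply: differentiable_continuous; apply/derivable1_diffP.
      by apply: derivable_powR; rewrite normr0 subr0 in_itv/= andbT.
    by rewrite /prop_for /continuous_at normr0 subr0.
  apply: cvg_trans (cvgM H2 H1); apply: near_eq_cvg; near=> h.
  rewrite /G ux mul0r !subr0 (addrC (h *: nu)).
  have -> : rho Omega nu (x + h *: nu) = (c - `|h|)%:E.
    by near: h; apply: cvg_within; exact: rm.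
  by rewrite /= subr0 powRN (addrC x) /GRing.scale/= mulrCA mulrA [LHS]mulrAC -mulrA mulrCA; ring.
by apply: DeriveDef; [apply/cvg_ex; eexists; exact: H|apply/cvg_lim].
Unshelve. all: by end_near. Qed.

Lemma weighted_deriveE nu x : Omega x -> weighted_derive Omega nu b u x = wder Omega u b nu x.
Proof.
move=> Ox; rewrite /weighted_derive /wder.
have DE := derive_class_C1 x nu Cu.
have f0 := exit_gt0 oO nu Ox; have b0 := exit_gt0 oO (- nu) Ox.
have [fb|bf|E] := ltgtP (fw nu x) (bw nu x).
- have ff : fw nu x \is a fin_num by rewrite gt0_fin_numE//; apply: lt_le_trans fb (leey _).
  have rE : rho Omega nu x = fw nu x by rewrite rho_exit min_l// ltW.
  rewrite rE ifF; last by apply/negbTE; rewrite -ltey ltey_eq ff.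
  have c0 : 0 < fine (fw nu x) by rewrite fine_gt0// f0/= ltey_eq ff.
  have := is_derive_G c0 (rho_lt Ox (esym (fineK ff)) _); rewrite fineK// => /(_ fb)[_ ->].
  rewrite mulrA -powRD ?(gt_eqF c0) ?implybT// subrr powRr0 mul1r.
  by rewrite mulrN1 mulNr mulNr opprK.
- have ff : bw nu x \is a fin_num by rewrite gt0_fin_numE//; apply: lt_le_trans bf (leey _).
  have rE : rho Omega nu x = bw nu x by rewrite rho_exit min_r// ltW.
  rewrite rE ifF; last by apply/negbTE; rewrite -ltey ltey_eq ff.
  have c0 : 0 < fine (bw nu x) by rewrite fine_gt0// b0/= ltey_eq ff.
  have := is_derive_G c0 (rho_gt Ox (esym (fineK ff)) _); rewrite fineK// => /(_ bf)[_ ->].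
  rewrite mulrA -powRD ?(gt_eqF c0) ?implybT// subrr powRr0 mul1r.
  by rewrite mulr1.
- have rE : rho Omega nu x = fw nu x by rewrite rho_exit -E minxx.
  rewrite rE; case: ifPn => [//|foo].
  have ff : fw nu x \is a fin_num by rewrite gt0_fin_numE// ltey.
  have c0 : 0 < fine (fw nu x) by rewrite fine_gt0// f0/= ltey.
  have fc : fw nu x = (fine (fw nu x))%:E by rewrite fineK.
  have bc : bw nu x = (fine (fw nu x))%:E by rewrite fineK.
  case: ifPn => [|bu]; last first.
    have := not_derivable_G Ox c0 bc fc bu => /dvgP.
    by rewrite -/('D_nu (G nu) x) => ->; rewrite mulr0.
  rewrite mulf_eq0 => /orP[/eqP b0'|/eqP u0].
    rewrite b0' powRr0 mul1r (_ : (fun _ => _) = u)//.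
    by apply/funext => y; rewrite powRr0 divr1.
  have [_ ->] := is_derive_G0 Ox c0 bc fc u0.
  by rewrite mulrA -powRD ?(gt_eqF c0) ?implybT// subrr powRr0 mul1r.
Qed.

End weighted_derive.

(** * The identity on a chord *)

Section line_integrals.
Context {R : realType}.
Local Open Scope ereal_scope.
Notation leb := (@lebesgue_measure R).
Implicit Types (g : R -> \bar R).

Lemma ge0_integral_reflect (c : R) g : measurable_fun setT g -> (forall s, 0 <= g s) ->
  \int[leb]_s g (c - s)%R = \int[leb]_s g s.
Proof.
move=> mg g0; rewrite -(ge0_integral_shift c mg g0).
have mgc : measurable_fun [set: R] (fun s : R => g (c + s)%R).
  by apply: measurableT_comp mg _; apply: measurable_funD => //; exact: measurable_cst.
by rewrite -[RHS](ge0_integral_opp mgc (fun s => g0 _)).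
Qed.

Let patch_ge0 g (D : set R) : (forall s, 0 <= g s) -> forall s, 0 <= (g \_ D) s.
Proof. by move=> g0 s; apply: erestrict_ge0 => // ? _. Qed.

Lemma ge0_integral_shift_sub g (D E : set R) (c : R) : (forall t, E t <-> D (c + t)%R) ->
  measurable D -> measurable_fun setT g -> (forall s, 0 <= g s) ->
  \int[leb]_(s in D) g s = \int[leb]_(t in E) g (c + t)%R.
Proof.
move=> DE mD mg g0; rewrite integral_mkcond [RHS]integral_mkcond.
rewrite -(ge0_integral_shift c); last 2 first.
- by apply/(measurable_restrictT _ mD); exact: measurable_funTS.
- exact: patch_ge0.
apply: eq_integral => t _; rewrite !patchE; congr (if _ then _ else _).
by apply/idP/idP => /set_mem h; apply/mem_set/DE.
Qed.

Lemma ge0_integral_reflect_sub g (D E : set R) (c : R) : (forall t, E t <-> D (c - t)%R) ->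
  measurable D -> measurable_fun setT g -> (forall s, 0 <= g s) ->
  \int[leb]_(s in D) g s = \int[leb]_(t in E) g (c - t)%R.
Proof.
move=> DE mD mg g0; rewrite integral_mkcond [RHS]integral_mkcond.
rewrite -(ge0_integral_reflect c); last 2 first.
- by apply/(measurable_restrictT _ mD); exact: measurable_funTS.
- exact: patch_ge0.
apply: eq_integral => t _; rewrite !patchE; congr (if _ then _ else _).
by apply/idP/idP => /set_mem h; apply/mem_set/DE.
Qed.

(** The interval is split at its midpoint T - a and the right half is reflected, so that on both
    halves t is the distance to the nearer end. *)
Lemma ge0_integral_two_halves g (a T : R) : (0 < T)%R ->
  measurable_fun setT g -> (forall s, 0 <= g s) ->
  \int[leb]_(s in `](- a)%R, (2 * T - a)%R[) g s =
  \int[leb]_(t in `]0%R, T[) g (t - a)%R + \int[leb]_(t in `]0%R, T[) g (2 * T - a - t)%R.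
Proof.
move=> T0 mg g0.
have -> : `](- a)%R, (2 * T - a)%R[%classic =
    `](- a)%R, (T - a)%R[%classic `|` `[(T - a)%R, (2 * T - a)%R[%classic :> set R.
  by rewrite -itv_bndbnd_setU// bnd_simp; lra.
rewrite ge0_integral_setU//=; last 2 first.
- exact: measurable_funTS.
- apply/disj_setPS => s [/=]; rewrite !in_itv/= => /andP[_ h1] /andP[h2 _].
  by move: h1; rewrite ltNge h2.
congr (_ + _).
  rewrite (@ge0_integral_shift_sub g _ `]0%R, T[%classic (- a)%R)//.
    by apply: eq_integral => t _; rewrite addrC.
  by move=> t; rewrite /= !in_itv/=; split => /andP[? ?]; apply/andP; split; lra.
rewrite -integral_itv_obnd_cbnd; last exact: measurable_funTS.
apply: ge0_integral_reflect_sub => //.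
by move=> t; rewrite /= !in_itv/=; split => /andP[? ?]; apply/andP; split; lra.
Qed.

End line_integrals.

Section chord_integrals.
Context {R : realType} {n : nat} (Omega : set 'rV[R]_n).
Hypothesis oO : open Omega.
Local Open Scope ereal_scope.
Notation leb := (@lebesgue_measure R).
Implicit Types (nu x y : 'rV[R]_n) (F : 'rV[R]_n -> \bar R).
Notation fw nu x := (exit_time Omega nu x).
Notation bw nu x := (exit_time Omega (- nu) x).

Lemma measurable_line F nu y : measurable_fun setT F ->
  measurable_fun [set: R] (fun s : R => F (y + s *: nu)%R).
Proof.
move=> mF; apply: measurableT_comp mF _; apply: measurable_rVD; first exact: measurable_cst.
by apply: measurable_rVZ => //; exact: measurable_cst.
Qed.

Lemma chord_bounded nu y (a b : R) : bw nu y = a%:E -> fw nu y = b%:E ->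
  chord Omega nu y = `](- a)%R, b[%classic.
Proof.
move=> ba fb; apply/seteqP; split => s; rewrite /chord /= in_itv/= ba fb -EFinN !lte_fin//.
Qed.

(** The second half is written in the direction [- nu], which makes it a first half for that
    direction: one identity then serves both. *)
Lemma ge0_integral_chord_bounded nu y (a b : R) F : Omega y -> bw nu y = a%:E -> fw nu y = b%:E ->
  measurable_fun setT F -> (forall x, 0 <= F x) ->
  \int[leb]_(s in chord Omega nu y) F (y + s *: nu)%R =
  \int[leb]_(t in `]0%R, ((a + b) / 2)%R[) F (y + (t - a) *: nu)%R +
  \int[leb]_(t in `]0%R, ((a + b) / 2)%R[) F (y + (t - b) *: (- nu))%R.
Proof.
move=> Oy ba fb mF F0; rewrite (chord_bounded ba fb).
have a0 : (0 < a)%R by rewrite -lte_fin -ba exit_gt0.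
have b0 : (0 < b)%R by rewrite -lte_fin -fb exit_gt0.
have := @ge0_integral_two_halves _ (fun s => F (y + s *: nu)%R) a ((a + b) / 2)%R.
rewrite (_ : 2 * ((a + b) / 2) - a = b)%R; last by field.
move=> ->//; last exact: measurable_line.
  congr (_ + _); apply: eq_integral => t _.
  by rewrite scalerN -scaleNr opprB.
by rewrite divr_gt0// addr_gt0.
Qed.

Lemma ge0_integral_chord_half nu y (a : R) F : bw nu y = a%:E -> fw nu y = +oo ->
  measurable_fun setT F -> (forall x, 0 <= F x) ->
  \int[leb]_(s in chord Omega nu y) F (y + s *: nu)%R =
  \int[leb]_(t in `]0%R, +oo[) F (y + (t - a) *: nu)%R.
Proof.
move=> ba fb mF F0.
rewrite (@ge0_integral_shift_sub _ (fun s => F (y + s *: nu)%R) _ `]0%R, +oo[%classic (- a)%R)//.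
- by apply: eq_integral => t _; rewrite (addrC (- a)%R).
- move=> t; rewrite /chord /= ba fb in_itv/= andbT lte_fin ltry andbT.
  by rewrite ltrDl.
- exact: measurable_chord.
- exact: measurable_line.
Qed.

Lemma ge0_integral_chordN nu y F :
  measurable_fun setT F -> (forall x, 0 <= F x) ->
  \int[leb]_(s in chord Omega nu y) F (y + s *: nu)%R =
  \int[leb]_(s in chord Omega (- nu) y) F (y + s *: (- nu))%R.
Proof.
move=> mF F0.
rewrite (@ge0_integral_reflect_sub _ (fun s => F (y + s *: nu)%R) _ (chord Omega (- nu) y) 0%R)//.
- by apply: eq_integral => t _; rewrite sub0r scalerN scaleNr.
- by move=> t; rewrite sub0r; exact: chordN.
- exact: measurable_chord.
- exact: measurable_line.
Qed.

Lemma mid_chord nu y s : chord Omega nu y s -> fw nu y < +oo -> bw nu y < +oo ->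
  mid Omega nu (y + s *: nu)%R = mid Omega nu y.
Proof.
move=> cs fo bo; rewrite /mid; have [-> ->] := chord_exit oO cs.
rewrite !fineB ?fineD// ?ge0_fin_numE ?exit_time_ge0//= -addrA -scalerDl.
by congr (_ + _ *: _)%R; field.
Qed.

Lemma halflen_chord nu y s : chord Omega nu y s -> fw nu y < +oo -> bw nu y < +oo ->
  halflen Omega nu (y + s *: nu)%R = halflen Omega nu y.
Proof.
move=> cs fo bo; rewrite /halflen; have [-> ->] := chord_exit oO cs.
by rewrite !fineB ?fineD// ?ge0_fin_numE ?exit_time_ge0//=; congr (_ / _)%R; ring.
Qed.

Lemma chord_weight_unbounded nu y s : chord Omega nu y s ->
  fw nu y = +oo \/ bw nu y = +oo -> chord_weight Omega nu (y + s *: nu) = 0%R.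
Proof.
move=> cs; rewrite /chord_weight; have [-> ->] := chord_exit oO cs.
by move=> [->|->]; rewrite ?addye ?addye// ltxx ?andbF.
Qed.

Lemma integral_chord_weight nu y : Omega y -> fw nu y < +oo -> bw nu y < +oo ->
  \int[leb]_(s in chord Omega nu y) (chord_weight Omega nu (y + s *: nu))%:E = 1.
Proof.
move=> Oy fo bo.
have ff : fw nu y \is a fin_num by rewrite ge0_fin_numE ?exit_time_ge0.
have bf : bw nu y \is a fin_num by rewrite ge0_fin_numE ?exit_time_ge0.
pose a := fine (bw nu y); pose b := fine (fw nu y).
have ba : bw nu y = a%:E by rewrite fineK.
have fb : fw nu y = b%:E by rewrite fineK.
have a0 : (0 < a)%R by rewrite -lte_fin -ba exit_gt0.
have b0 : (0 < b)%R by rewrite -lte_fin -fb exit_gt0.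
pose t := Num.min (halflen Omega nu y) 1%R.
have h0 : halflen Omega nu y = ((a + b) / 2)%R by rewrite /halflen addrC.
have t0 : (0 < t)%R by rewrite lt_min ltr01 andbT h0 divr_gt0// addr_gt0.
have tab : (t <= (a + b) / 2)%R by rewrite ge_min h0 lexx.
(* [c] is the parameter of the midpoint, and the bound t <= (a + b)/2 keeps the interval ]c - t, c +
   t[, where the weight is 1/(2t), inside the chord. *)
pose c := ((b - a) / 2)%R.
transitivity (\int[leb]_(s in `](c - t)%R, (c + t)%R[) (2 * t)^-1%:E).
  rewrite integral_mkcond [RHS]integral_mkcond; apply: eq_integral => s _.
  rewrite !patchE; case: ifPn => [/set_mem cs|/negP cs].
    have [E1 E2] := chord_exit oO cs.
    rewrite /chord_weight halflen_chord// -/t E1 E2 fb ba -EFinB -EFinD !ltry/=.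
    rewrite (_ : (s \in _) = (`|b - s - (a + s)| / 2 < t)%R); first by case: ifP.
    have -> : (b - s - (a + s) = 2 * (c - s))%R by rewrite /c; field.
    rewrite normrM ger0_norm// mulrAC divff// mul1r ltr_distlC.
    by apply/idP/idP => [/set_mem|h]; [|apply/mem_set]; rewrite /= in_itv.
  case: ifPn => // /set_mem /=; rewrite in_itv/= => /andP[s1 s2]; exfalso; apply: cs.
  apply/mem_set; rewrite (chord_bounded ba fb) /= in_itv/=.
  by apply/andP; split; move: s1 s2; rewrite /c; lra.
rewrite integral_cst//= lebesgue_measure_itv/= lte_fin.
rewrite (_ : (c - t < c + t)%R); last by lra.
rewrite -EFinB -EFinM; congr EFin.
by rewrite (_ : c + t - (c - t) = 2 * t)%R ?mulVf ?gt_eqF ?mulr_gt0//; ring.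
Qed.

End chord_integrals.

Section chord_identity.
Context {R : realType} {n : nat} (Omega : set 'rV[R]_n).
Hypothesis oO : open Omega.
Variable u : 'rV[R]_n -> R.
Hypothesis Cu : class_C 1 u.
Hypothesis su : compactly_supported_in Omega u.
Variables p lambda : R.
Hypothesis p1 : 1 < p.
Notation leb := (@lebesgue_measure R).
Implicit Types (nu x y : 'rV[R]_n).
Notation fw nu x := (exit_time Omega nu x).
Notation bw nu x := (exit_time Omega (- nu) x).
Notation FA := (gradient_term Omega u p lambda).
Notation FB := (hardy_term Omega u p lambda).
Notation FC := (Cp_term Omega u p lambda).
Notation FG := (midpoint_term Omega u p lambda).

Let b : R := (p + lambda - 1) / p.
Let k : R := spow p b.
Let p0 : 0 < p. Proof. exact: lt_trans p1. Qed.

Lemma out_supp x : ~ supp u x -> u x = 0.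
Proof. by move=> sx; apply: contrapT => ux; apply: sx; apply: subset_closure => /=; apply/eqP. Qed.

Lemma grad_out_supp x : ~ supp u x -> grad u x = 0.
Proof.
move=> sx; apply/rowP => i; rewrite !mxE /partial.
have oS : open (~` supp u) by exact/closed_openC/closed_closure.
have := @near_eq_derive _ _ _ (cst 0) u x (delta_mx ord0 i).
rewrite derive_cst => <-//.
have : nbhs x (~` supp u) by exact: open_nbhs_nbhs.
by apply: filterS => y sy; rewrite out_supp.
Qed.

Lemma supp_sub x : supp u x -> Omega x.
Proof. by have [_] := su; apply. Qed.

Lemma supp_line_bounded nu y : nu != 0 ->
  exists2 S : R, 0 < S & forall s, S <= `|s| -> ~ supp u (y + s *: nu).
Proof.
move=> nu0; have [/compact_bounded[M [_ HM]] _] := su.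
have n0 : 0 < `|nu| by rewrite normr_gt0.
pose S := (`|M| + 1 + `|y| + 1) / `|nu|.
exists S; first by rewrite divr_gt0// !ltr_wpDl// ?addr_ge0.
move=> s; rewrite ler_pdivrMr// => hs /HM.
have MM : M < `|M| + 1 by rewrite (le_lt_trans (ler_norm _))// ltrDl.
move=> /(_ _ MM) /=; apply/negP; rewrite -ltNge.
have : `|s| * `|nu| <= `|y + s *: nu| + `|y|.
  have -> : `|s| * `|nu| = `|(y + s *: nu) - y| by rewrite addrC addKr normrZ.
  exact: ler_normB.
by move: hs; set X := _ * _; lra.
Qed.

Lemma measurable_slice d (T : measurableType d) (F : 'rV[R]_n -> 'rV[R]_n -> T) nu :
  measurable_fun setT (fun z : 'rV[R]_n * 'rV[R]_n => F z.1 z.2) -> measurable_fun setT (F nu).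
Proof. by move=> mF; exact: (measurableT_comp mF (pair1_measurable nu)). Qed.

Lemma rhoN nu x : rho Omega (- nu) x = rho Omega nu x.
Proof. by rewrite !rho_exit opprK minC. Qed.

Lemma dotpNl nu x : dotp (- nu) x = - dotp nu x.
Proof. by rewrite /dotp -sumrN; apply: eq_bigr => i _; rewrite mxE mulNr. Qed.

Lemma wderN c nu x : wder Omega u c (- nu) x = - wder Omega u c nu x.
Proof.
rewrite /wder opprK dotpNl; case: (ltgtP (fw nu x) (bw nu x)) => [_|_|->].
- by rewrite opprD.
- by rewrite opprD opprK.
- by case: ifP => // _; case: ifP => // _; rewrite oppr0.
Qed.

Lemma gradient_termN nu x : FA (- nu) x = FA nu x.
Proof. by rewrite /gradient_term rhoN dotpNl normrN. Qed.

Lemma hardy_termN nu x : FB (- nu) x = FB nu x.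
Proof. by rewrite /hardy_term rhoN. Qed.

Lemma Cp_termN nu x : FC (- nu) x = FC nu x.
Proof. by rewrite /Cp_term rhoN dotpNl wderN (CpN p). Qed.

Section left_half.
Variables (nu y : 'rV[R]_n) (a : R).
Hypothesis Oy : Omega y.
Hypothesis ba : bw nu y = a%:E.

Let z (t : R) := y + (t - a) *: nu.
Let f (t : R) := u (z t).
Let df (t : R) := dotp nu (grad u (z t)).

Let zE t : z t = (y - a *: nu) + t *: nu.
Proof. by rewrite /z scalerBl addrCA addrC. Qed.

Let fd (t : R) : is_derive t 1 f (df t).
Proof.
rewrite /df zE (_ : f = fun s => u ((y - a *: nu) + s *: nu)).
  exact: is_derive_line_C1.
by apply/funext => s; rewrite /f zE.
Qed.

Let cdf : continuous df.
Proof.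
rewrite (_ : df = fun s => dotp nu (grad u ((y - a *: nu) + s *: nu))).
  exact: continuous_grad_line.
by apply/funext => s; rewrite /df zE.
Qed.

(** The end point of the chord is outside [Omega], hence outside the closed support of [u], and so
    is a neighbourhood of it. This provides the [delta] of the half chord identity. *)
Let near0 (T : R) : 0 < T -> exists d : R, [/\ 0 < d, d < T,
  (forall t : R, 0 < t -> t <= d -> f t = 0) & (forall t : R, 0 < t -> t <= d -> df t = 0)].
Proof.
move=> T0.
have nsz : ~ supp u (z 0).
  move=> /supp_sub; rewrite /z sub0r scaleNr -scalerN.
  exact: exit_out ba.
have oS : open (~` supp u) by exact/closed_openC/closed_closure.
have : nbhs (0 : R) (fun t => ~ supp u (z t)).
  have -> : (fun t => ~ supp u (z t)) = (fun s : R => y - a *: nu + s *: nu) @^-1` (~` supp u).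
    by apply/funext => t; rewrite zE.
  rewrite zE in nsz.
  exact: (@line_continuous R n nu (y - a *: nu) 0 _ (open_nbhs_nbhs (conj oS nsz))).
move=> /nbhs_ballP[e /= e0 he].
have hz t : 0 < t -> t <= Num.min (e / 2) (T / 2) -> ~ supp u (z t).
  move=> t0; rewrite le_min => /andP[te _]; apply: he.
  rewrite -ball_normE/= sub0r normrN gtr0_norm//; lra.
exists (Num.min (e / 2) (T / 2)); split.
- by rewrite lt_min !divr_gt0.
- by rewrite gt_min; apply/orP; right; lra.
- by move=> t t0 /hz h; apply: out_supp; exact: h.
- move=> t t0 /hz h; rewrite /df grad_out_supp; last exact: h.
  by rewrite /dotp big1// => i _; rewrite mxE mulr0.
Qed.

Let zO (t : R) : 0 < t -> (t%:E < fw nu y + a%:E)%E ->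
  [/\ chord Omega nu y (t - a), bw nu (z t) = t%:E & fw nu (z t) = (fw nu y + a%:E - t%:E)%E].
Proof.
move=> t0 tf.
have c : chord Omega nu y (t - a).
  by rewrite /chord/= ba -EFinN lte_fin EFinB lteBlDr// tf andbT ltrDr.
have [E1 E2] := chord_exit oO c; split => //.
- by rewrite /z E2 ba -EFinD; congr EFin; ring.
- by rewrite /z E1 EFinB oppeB ?fin_num_adde_defr// addeA addeAC.
Qed.

(** The condition says that 2t is less than the length of the chord: the backward end is then
    strictly nearer, [rho] is t, and the first branch of [wder] for the direction [- nu] is the
    relevant one. *)
Let pointwise (t : R) : 0 < t -> (t%:E + t%:E < fw nu y + a%:E)%E ->
  [/\ FA nu (z t) = (t `^ (- lambda) * `|df t| `^ p)%:E,
      FB nu (z t) = (`|f t| `^ p * t `^ (- lambda - p))%:E &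
      FC nu (z t) = (t `^ (- lambda) * Cp p (df t) (df t - b * f t / t))%:E].
Proof.
move=> t0 tf.
have tt : (t%:E < fw nu y + a%:E)%E by apply: lt_trans tf; rewrite -EFinD lte_fin ltrDl.
have [c E1 E2] := zO t0 tt.
have lt_ : (t%:E < fw nu (z t))%E by rewrite E2 lteBrDr.
have rE : rho Omega nu (z t) = t%:E by rewrite rho_exit E1 min_r// ltW.
rewrite /gradient_term /hardy_term /Cp_term rE !epow_EFin// -!EFinM; split => //.
  by rewrite opprD.
by rewrite /wder E1 ltNge (ltW lt_)/= lt_.
Qed.

Lemma left_half_identity (T : R) : 0 < T -> (T%:E + T%:E <= fw nu y + a%:E)%E ->
  (\int[leb]_(t in `]0%R, T[) FA nu (z t)
   + (Num.max (- k) 0 * (`|u (z T)| `^ p * T `^ (1 - p - lambda)))%:E =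
   (`|b| `^ p)%:E * \int[leb]_(t in `]0%R, T[) FB nu (z t)
   + ((Num.max k 0 * (`|u (z T)| `^ p * T `^ (1 - p - lambda)))%:E
      + \int[leb]_(t in `]0%R, T[) FC nu (z t)))%E.
Proof.
move=> T0 TT; have [d [d0 dT fd0 dfd0]] := near0 T0.
have pw t : t \in `]0%R, T[%classic -> [/\ FA nu (z t) = (t `^ (- lambda) * `|df t| `^ p)%:E,
      FB nu (z t) = (`|f t| `^ p * t `^ (- lambda - p))%:E &
      FC nu (z t) = (t `^ (- lambda) * Cp p (df t) (df t - b * f t / t))%:E].
  move=> /set_mem; rewrite /= in_itv/= => /andP[t0 tT]; apply: pointwise => //.
  by apply: lt_le_trans TT; rewrite -!EFinD lte_fin ltrD.
have -> : (\int[leb]_(t in `]0%R, T[) FA nu (z t) =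
    \int[leb]_(t in `]0%R, T[) (t `^ (- lambda) * `|df t| `^ p)%:E)%E.
  by apply: eq_integral => t /pw[].
have -> : (\int[leb]_(t in `]0%R, T[) FB nu (z t) =
    \int[leb]_(t in `]0%R, T[) (`|f t| `^ p * t `^ (- lambda - p))%:E)%E.
  by apply: eq_integral => t /pw[].
have -> : (\int[leb]_(t in `]0%R, T[) FC nu (z t) =
    \int[leb]_(t in `]0%R, T[) (t `^ (- lambda) * Cp p (df t) (df t - b * f t / t))%:E)%E.
  by apply: eq_integral => t /pw[].
exact: (@half_chord_identity R p lambda p1 f df d T fd cdf d0 dT fd0 dfd0).
Qed.

Lemma half_line_chord_identity : nu != 0 -> fw nu y = +oo%E ->
  (\int[leb]_(t in `]0%R, +oo[) FA nu (z t) =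
   (`|b| `^ p)%:E * \int[leb]_(t in `]0%R, +oo[) FB nu (z t)
      + \int[leb]_(t in `]0%R, +oo[) FC nu (z t))%E.
Proof.
move=> nu0 foo.
have [S S0 hS] := supp_line_bounded (y - a *: nu) nu0.
have [d [d0 dT fd0 dfd0]] := near0 S0.
have pw t : t \in `]0%R, +oo[%classic -> [/\ FA nu (z t) = (t `^ (- lambda) * `|df t| `^ p)%:E,
      FB nu (z t) = (`|f t| `^ p * t `^ (- lambda - p))%:E &
      FC nu (z t) = (t `^ (- lambda) * Cp p (df t) (df t - b * f t / t))%:E].
  move=> /set_mem; rewrite /= in_itv/= andbT => t0; apply: pointwise => //.
  by rewrite foo addye// -EFinD ltry.
have -> : (\int[leb]_(t in `]0%R, +oo[) FA nu (z t) =
    \int[leb]_(t in `]0%R, +oo[) (t `^ (- lambda) * `|df t| `^ p)%:E)%E.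
  by apply: eq_integral => t /pw[].
have -> : (\int[leb]_(t in `]0%R, +oo[) FB nu (z t) =
    \int[leb]_(t in `]0%R, +oo[) (`|f t| `^ p * t `^ (- lambda - p))%:E)%E.
  by apply: eq_integral => t /pw[].
have -> : (\int[leb]_(t in `]0%R, +oo[) FC nu (z t) =
    \int[leb]_(t in `]0%R, +oo[) (t `^ (- lambda) * Cp p (df t) (df t - b * f t / t))%:E)%E.
  by apply: eq_integral => t /pw[].
apply: (@half_line_identity R p lambda p1 f df d S fd cdf d0 dT fd0 dfd0) => t St.
  rewrite /f out_supp// zE; apply: hS; exact: le_trans St (ler_norm _).
rewrite /df grad_out_supp; last by rewrite zE; apply: hS; exact: le_trans St (ler_norm _).
by rewrite /dotp big1// => i _; rewrite mxE mulr0.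
Qed.

End left_half.

Section full_line.
Variables (nu y : 'rV[R]_n).
Hypothesis nu0 : nu != 0.
Hypothesis fy : fw nu y = +oo%E.
Hypothesis by_ : bw nu y = +oo%E.

Let chordT : chord Omega nu y = setT.
Proof. by apply/seteqP; split => // s _; rewrite /chord/= fy by_ /= ltry ltNyr. Qed.

Let exitT s : fw nu (y + s *: nu) = +oo%E /\ bw nu (y + s *: nu) = +oo%E.
Proof.
have cs : chord Omega nu y s by rewrite chordT.
by have [-> ->] := chord_exit oO cs; rewrite fy by_.
Qed.

Let rhoT s : rho Omega nu (y + s *: nu) = +oo%E.
Proof. by rewrite rho_exit; have [-> ->] := exitT s; rewrite minxx. Qed.

Let FACT s : FC nu (y + s *: nu) = FA nu (y + s *: nu).
Proof.
by rewrite /Cp_term /wder; have [-> ->] := exitT s; rewrite ltxx eqxx (Cp_id p1).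
Qed.

(** [u] is nonzero somewhere on the line and zero far out, so by the mean value theorem its
    derivative is nonzero on some interval; there the factor rho^(-lambda) is +oo. *)
Let FA_infinite s0 : u (y + s0 *: nu) != 0 -> lambda < 0 ->
  (\int[leb]_(s in chord Omega nu y) FA nu (y + s *: nu) = +oo)%E.
Proof.
move=> u0 l0; have [S S0 hS] := supp_line_bounded y nu0.
pose f (s : R) := u (y + s *: nu); pose df (s : R) := dotp nu (grad u (y + s *: nu)).
have fd (s : R) : is_derive s 1 f (df s) by exact: is_derive_line_C1.
have cdf : continuous df by exact: continuous_grad_line.
have cf : continuous f.
  by move=> t; apply: differentiable_continuous; apply/derivable1_diffP; have [] := fd t.
have [c dc] : exists c : R, df c != 0.
  pose s1 := `|s0| + S.
  have s01 : s0 <= s1 by rewrite (le_trans (ler_norm _))// lerDl ltW.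
  have f1 : f s1 = 0.
    have s1S : S <= s1 by rewrite lerDr.
    by apply/out_supp/hS; exact: le_trans s1S (ler_norm _).
  have [c _] := MVT_segment s01 (fun s _ => fd s) (continuous_subspaceT cf).
  rewrite f1 sub0r => E; exists c; apply: contra_neq u0 => dc.
  by move: E; rewrite dc mul0r => /eqP; rewrite oppr_eq0 => /eqP.
have : \forall s \near c, df s != 0.
  have := cdf c; move=> /(_ [set r | r != 0]); apply.
  by apply: open_nbhs_nbhs; split => //; exact: open_neq.
move=> /nbhs_ballP[e /= e0 he].
apply/eqP; rewrite -leye_eq.
have <- : (\int[leb]_(s in `](c - e)%R, (c + e)%R[) (cst +oo s) = +oo)%E.
  rewrite integral_cst//= lebesgue_measure_itv/= lte_fin ifT; last by lra.
  by rewrite -EFinB gt0_mulye// lte_fin; lra.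
have mA : measurable_fun [set: R] (fun s : R => FA nu (y + s *: nu)).
  apply: measurable_line.
  apply: measurable_slice; exact: measurable_gradient_term.
apply: (@le_trans _ _ (\int[leb]_(s in `](c - e)%R, (c + e)%R[) FA nu (y + s *: nu)%R)%E).
  apply: ge0_le_integral => //=.
  - exact: measurable_funTS mA.
  move=> s; rewrite in_itv/= => /andP[s1 s2].
  rewrite /gradient_term rhoT epowy_gt0 ?oppr_gt0// gt0_mulye// lte_fin powR_gt0// normr_gt0.
  by apply: he; rewrite -ball_normE/= ltr_norml; apply/andP; split; lra.
rewrite chordT; apply: ge0_subset_integral => //=.
by move=> s _; exact: gradient_term_ge0.
Qed.

(** Here [rho] is +oo and the gradient and C_p terms coincide, so the Hardy term has to be absorbed.
    It is 0 if lambda + p > 0; otherwise lambda < 0, and either [u] vanishes on the line or both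
    sides are +oo. *)
Lemma full_line_identity :
  (\int[leb]_(s in chord Omega nu y) FA nu (y + s *: nu) =
   (`|b| `^ p)%:E * \int[leb]_(s in chord Omega nu y) FB nu (y + s *: nu)
      + \int[leb]_(s in chord Omega nu y) FC nu (y + s *: nu))%E.
Proof.
have -> : (\int[leb]_(s in chord Omega nu y) FC nu (y + s *: nu) =
  \int[leb]_(s in chord Omega nu y) FA nu (y + s *: nu))%E.
  by apply: eq_integral => s _; exact: FACT.
have [lp|lp] := ltP 0 (lambda + p).
  rewrite (_ : (\int[leb]_(s in chord Omega nu y) FB nu (y + s *: nu) = 0)%E) ?mule0 ?add0e//.
  rewrite integral0_eq// => s _; rewrite /hardy_term rhoT epowy_lt0 ?mule0//.
  by rewrite oppr_lt0.
have l0 : lambda < 0 by rewrite (lt_le_trans _ lp)// ltrDl.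
have [[s0 us0]|nu_] := pselect (exists s, u (y + s *: nu) != 0).
  rewrite (FA_infinite us0 l0) addeC addye// -ltNye (lt_le_trans (ltNyr 0))//.
  by rewrite mule_ge0 ?lee_fin ?powR_ge0//; apply: integral_ge0 => s _; exact: hardy_term_ge0.
rewrite (_ : (\int[leb]_(s in chord Omega nu y) FB nu (y + s *: nu) = 0)%E) ?mule0 ?add0e//.
rewrite integral0_eq// => s _; rewrite /hardy_term (_ : u _ = 0).
  by rewrite normr0 powR0 ?gt_eqF// mul0e.
by apply: contrapT => us; apply: nu_; exists s; apply/eqP.
Qed.

End full_line.

Let half_case nu y (a : R) : nu != 0 -> Omega y -> bw nu y = a%:E -> fw nu y = +oo%E ->
  measurable_fun setT (FA nu) -> measurable_fun setT (FB nu) -> measurable_fun setT (FC nu) ->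
  (\int[leb]_(s in chord Omega nu y) FA nu (y + s *: nu) =
   (`|b| `^ p)%:E * \int[leb]_(s in chord Omega nu y) FB nu (y + s *: nu)
      + \int[leb]_(s in chord Omega nu y) FC nu (y + s *: nu))%E.
Proof.
move=> nu0 Oy ba fo mA mB mC.
rewrite (ge0_integral_chord_half ba fo mA (@gradient_term_ge0 _ _ _ _ _ _ nu)).
rewrite (ge0_integral_chord_half ba fo mB (@hardy_term_ge0 _ _ _ _ _ _ nu)).
rewrite (ge0_integral_chord_half ba fo mC (@Cp_term_ge0 _ _ _ _ _ _ p1 nu)).
exact: half_line_chord_identity.
Qed.

Let mirror nu y (F : 'rV[R]_n -> 'rV[R]_n -> \bar R) : (forall x, F (- nu) x = F nu x) ->
  measurable_fun setT (F nu) -> (forall x, (0 <= F nu x)%E) ->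
  (\int[leb]_(s in chord Omega (- nu) y) F (- nu)%R (y + s *: (- nu))%R =
   \int[leb]_(s in chord Omega nu y) F nu (y + s *: nu)%R)%E.
Proof.
move=> FN mF F0; rewrite (ge0_integral_chordN Omega nu y mF F0).
by apply: eq_integral => s _; rewrite FN.
Qed.

Lemma integral_chord_midpoint_term nu y : Omega y -> (fw nu y < +oo)%E -> (bw nu y < +oo)%E ->
  (\int[leb]_(s in chord Omega nu y) FG nu (y + s *: nu) =
  (`|u (mid Omega nu y)| `^ p * halflen Omega nu y `^ (1 - p - lambda))%:E)%E.
Proof.
move=> Oy fo bo.
set H := (_ * _).
have H0 : 0 <= H by rewrite mulr_ge0// powR_ge0.
transitivity (\int[leb]_(s in chord Omega nu y)
    (H%:E * (chord_weight Omega nu (y + s *: nu))%:E))%E.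
  apply: eq_integral => s /set_mem cs.
  have Em := mid_chord oO cs fo bo; have Eh := halflen_chord oO cs fo bo.
  by rewrite /midpoint_term Em Eh.
have mw : measurable_fun (chord Omega nu y)
    (fun s : R => (chord_weight Omega nu (y + s *: nu))%:E).
  apply/measurable_EFinP; apply: measurable_funTS.
  apply: measurableT_comp (measurable_slice nu (measurable_chord_weight oO)) _.
  apply: measurable_rVD; first exact: measurable_cst.
  by apply: measurable_rVZ => //; exact: measurable_cst.
rewrite ge0_integralZl_EFin//.
- by rewrite integral_chord_weight// mule1.
- exact: measurable_chord.
- by move=> s _; rewrite lee_fin chord_weight_ge0.
Qed.

Let add_halves (A1 A2 B1 B2 C1 C2 : \bar R) (c r s H : R) : (0 <= B1)%E -> (0 <= B2)%E ->
  (A1 + (r * H)%:E = c%:E * B1 + ((s * H)%:E + C1))%E ->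
  (A2 + (r * H)%:E = c%:E * B2 + ((s * H)%:E + C2))%E ->
  (A1 + A2 + (2 * r)%:E * H%:E = c%:E * (B1 + B2) + ((2 * s)%:E * H%:E + (C1 + C2)))%E.
Proof.
move=> B10 B20 e1 e2.
have kk (q : R) : ((2 * q)%:E * H%:E = (q * H)%:E + (q * H)%:E)%E.
  by rewrite -EFinM -EFinD; congr EFin; ring.
rewrite !kk addeACA e1 e2 (ge0_muleDr _ B10 B20) addeACA; congr (_ + _)%E.
by rewrite addeACA.
Qed.

(** The identity of a first half is used for [nu] and for [- nu]. Both halves end at the same
    midpoint, whence the factor 2, and the integrands are even in the direction. *)
Let bounded_case nu y : Omega y -> (fw nu y < +oo)%E -> (bw nu y < +oo)%E ->
  measurable_fun setT (FA nu) -> measurable_fun setT (FB nu) -> measurable_fun setT (FC nu) ->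
  (\int[leb]_(s in chord Omega nu y) FA nu (y + s *: nu)
   + (2 * Num.max (- k) 0)%:E * \int[leb]_(s in chord Omega nu y) FG nu (y + s *: nu) =
   (`|b| `^ p)%:E * \int[leb]_(s in chord Omega nu y) FB nu (y + s *: nu)
      + ((2 * Num.max k 0)%:E * \int[leb]_(s in chord Omega nu y) FG nu (y + s *: nu)
         + \int[leb]_(s in chord Omega nu y) FC nu (y + s *: nu)))%E.
Proof.
move=> Oy fo bo mA mB mC; rewrite integral_chord_midpoint_term//.
pose c := fine (fw nu y); pose a := fine (bw nu y).
have fc : fw nu y = c%:E by rewrite fineK// ge0_fin_numE ?exit_time_ge0.
have ba : bw nu y = a%:E by rewrite fineK// ge0_fin_numE ?exit_time_ge0.
have a0 : 0 < a by rewrite -lte_fin -ba exit_gt0.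
have c0 : 0 < c by rewrite -lte_fin -fc exit_gt0.
rewrite (ge0_integral_chord_bounded oO Oy ba fc mA (@gradient_term_ge0 _ _ _ _ _ _ nu)).
rewrite (ge0_integral_chord_bounded oO Oy ba fc mB (@hardy_term_ge0 _ _ _ _ _ _ nu)).
rewrite (ge0_integral_chord_bounded oO Oy ba fc mC (@Cp_term_ge0 _ _ _ _ _ _ p1 nu)).
pose T := (a + c) / 2; rewrite -/T.
have T0 : 0 < T by rewrite divr_gt0// addr_gt0.
have TT : T + T = a + c by rewrite /T; field.
have hT : halflen Omega nu y = T by rewrite /halflen -/c -/a /T addrC.
have m1 : y + (T - a) *: nu = mid Omega nu y.
  by rewrite /mid -/c -/a; congr (_ + _ *: _); rewrite /T; field.
have m2 : y + (T - c) *: (- nu) = mid Omega nu y.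
  by rewrite /mid -/c -/a scalerN -scaleNr; congr (_ + _ *: _); rewrite /T; field.
have fc' : exit_time Omega (- - nu) y = c%:E by rewrite opprK.
have e1 := @left_half_identity nu y a ba T T0.
have e2 := @left_half_identity (- nu) y c fc' T T0.
have {}e1 := e1 ltac:(by rewrite fc -!EFinD lee_fin TT addrC).
have {}e2 := e2 ltac:(by rewrite ba -!EFinD lee_fin TT).
rewrite m1 -hT in e1; rewrite m2 in e2.
have E (F : 'rV[R]_n -> 'rV[R]_n -> \bar R) : (forall x, F (- nu) x = F nu x) ->
  (\int[leb]_(t in `]0%R, T[) F (- nu)%R (y + (t - c) *: - nu)%R =
   \int[leb]_(t in `]0%R, T[) F nu (y + (t - c) *: - nu)%R)%E.
  by move=> FN; apply: eq_integral => t _; rewrite FN.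
rewrite (E FA (gradient_termN nu)) (E FB (hardy_termN nu)) (E FC (Cp_termN nu)) -hT in e2.
rewrite -hT.
set H := (_ * halflen Omega nu y `^ _) in e1 e2 *.
apply: add_halves e1 e2.
- by apply: integral_ge0 => t _; exact: hardy_term_ge0.
- by apply: integral_ge0 => t _; exact: hardy_term_ge0.
Qed.

(** The cases are the numbers of infinite ends; if only the backward end is infinite, the chord is
    mirrored. The midpoint term is 0 on unbounded chords, so one formula covers all the cases. *)
Lemma chord_identity nu y : nu != 0 -> Omega y ->
  (\int[leb]_(s in chord Omega nu y)
     (FA nu (y + s *: nu) + (2 * Num.max (- k) 0)%:E * FG nu (y + s *: nu)) =
   \int[leb]_(s in chord Omega nu y)
     ((`|b| `^ p)%:E * FB nu (y + s *: nu)
      + ((2 * Num.max k 0)%:E * FG nu (y + s *: nu) + FC nu (y + s *: nu))))%E.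
Proof.
move=> nu0 Oy.
have mc := measurable_chord Omega nu y.
have mA mu : measurable_fun setT (FA mu) by apply: measurable_slice; exact: measurable_gradient_term.
have mB mu : measurable_fun setT (FB mu) by apply: measurable_slice; exact: measurable_hardy_term.
have mC mu : measurable_fun setT (FC mu) by apply: measurable_slice; exact: measurable_Cp_term.
have mG mu : measurable_fun setT (FG mu) by apply: measurable_slice; exact: measurable_midpoint_term.
have lin (F : 'rV[R]_n -> \bar R) : measurable_fun setT F ->
    measurable_fun (chord Omega nu y) (fun s : R => F (y + s *: nu)).
  by move=> mF; apply: measurable_funTS; exact: measurable_line.
have km0 : (0 <= (2 * Num.max (- k) 0)%:E)%E by rewrite lee_fin mulr_ge0// le_max lexx orbT.
have kp0 : (0 <= (2 * Num.max k 0)%:E)%E by rewrite lee_fin mulr_ge0// le_max lexx orbT.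
have bp0 : (0 <= (`|b| `^ p)%:E)%E by rewrite lee_fin powR_ge0.
have A0 := @gradient_term_ge0 R n Omega u p lambda nu.
have B0 := @hardy_term_ge0 R n Omega u p lambda nu.
have C0 := @Cp_term_ge0 R n Omega u p lambda p1 nu.
have G0 := @midpoint_term_ge0 R n Omega u p lambda nu.
have lA := lin _ (mA nu); have lB := lin _ (mB nu).
have lC := lin _ (mC nu); have lG := lin _ (mG nu).
have lcG c : measurable_fun (chord Omega nu y) (fun s : R => (c%:E * FG nu (y + s *: nu))%E).
  by apply: emeasurable_funM => //; exact: measurable_cst.
have lcB c : measurable_fun (chord Omega nu y) (fun s : R => (c%:E * FB nu (y + s *: nu))%E).
  by apply: emeasurable_funM => //; exact: measurable_cst.
have cG0 c s : (0 <= c%:E)%E -> (0 <= c%:E * FG nu (y + s *: nu))%E by move=> c0; exact: mule_ge0.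
have cB0 c s : (0 <= c%:E)%E -> (0 <= c%:E * FB nu (y + s *: nu))%E by move=> c0; exact: mule_ge0.
have -> : (\int[leb]_(s in chord Omega nu y)
     (FA nu (y + s *: nu) + (2 * Num.max (- k) 0)%:E * FG nu (y + s *: nu)) =
   \int[leb]_(s in chord Omega nu y) FA nu (y + s *: nu)
   + (2 * Num.max (- k) 0)%:E * \int[leb]_(s in chord Omega nu y) FG nu (y + s *: nu))%E.
  rewrite (@ge0_integralD _ _ _ leb _ mc _ _ (fun s _ => A0 _) lA (fun s _ => cG0 _ s km0) (lcG _)).
  by rewrite (ge0_integralZl leb mc lG (fun s _ => G0 _) km0).
have -> : (\int[leb]_(s in chord Omega nu y)
     ((`|b| `^ p)%:E * FB nu (y + s *: nu)
      + ((2 * Num.max k 0)%:E * FG nu (y + s *: nu) + FC nu (y + s *: nu))) =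
   (`|b| `^ p)%:E * \int[leb]_(s in chord Omega nu y) FB nu (y + s *: nu)
      + ((2 * Num.max k 0)%:E * \int[leb]_(s in chord Omega nu y) FG nu (y + s *: nu)
         + \int[leb]_(s in chord Omega nu y) FC nu (y + s *: nu)))%E.
  have mGC := emeasurable_funD (lcG (2 * Num.max k 0)) lC.
  have GC0 (s : R) : chord Omega nu y s ->
      (0 <= (2 * Num.max k 0)%:E * FG nu (y + s *: nu)%R + FC nu (y + s *: nu)%R)%E.
    by move=> _; rewrite adde_ge0// cG0.
  rewrite (@ge0_integralD _ _ _ leb _ mc _ _ (fun s _ => cB0 _ s bp0) (lcB _) GC0 mGC).
  rewrite (@ge0_integralD _ _ _ leb _ mc _ _ (fun s _ => cG0 _ s kp0) (lcG _) (fun s _ => C0 _) lC).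
  rewrite (ge0_integralZl leb mc lG (fun s _ => G0 _) kp0).
  by rewrite (ge0_integralZl leb mc lB (fun s _ => B0 _) bp0).
have [fo|fo] := eqVneq (fw nu y) +oo%E.
  have G00 : (\int[leb]_(s in chord Omega nu y) FG nu (y + s *: nu) = 0)%E.
    rewrite integral0_eq// => s cs; rewrite /midpoint_term chord_weight_unbounded ?mulr0//.
    by left.
  rewrite G00 !mule0 adde0 add0e.
  have [bo|bo] := eqVneq (bw nu y) +oo%E; first exact: full_line_identity.
  have ba : bw nu y = (fine (bw nu y))%:E by rewrite fineK// ge0_fin_numE ?exit_time_ge0// ltey.
  exact: (half_case nu0 Oy ba fo (mA _) (mB _) (mC _)).
have [bo|bo] := eqVneq (bw nu y) +oo%E; last first.
  by rewrite -!ltey in fo bo; exact: (bounded_case Oy fo bo (mA _) (mB _) (mC _)).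
have fa : fw nu y = (fine (fw nu y))%:E by rewrite fineK// ge0_fin_numE ?exit_time_ge0// ltey.
have G00 : (\int[leb]_(s in chord Omega nu y) FG nu (y + s *: nu) = 0)%E.
  rewrite integral0_eq// => s cs; rewrite /midpoint_term chord_weight_unbounded ?mulr0//.
  by right.
rewrite G00 !mule0 adde0 add0e.
have fa' : exit_time Omega (- - nu) y = (fine (fw nu y))%:E by rewrite opprK.
have nuN0 : - nu != 0 by rewrite oppr_eq0.
have := half_case nuN0 Oy fa' bo (mA _) (mB _) (mC _).
rewrite (mirror y (gradient_termN nu) (mA nu) A0) (mirror y (hardy_termN nu) (mB nu) B0).
by rewrite (mirror y (Cp_termN nu) (mC nu) C0).
Qed.

End chord_identity.

(** * The skeletal measure *)

Section measures.
Context {R : realType}.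
Local Open Scope ereal_scope.
Notation leb := (@lebesgue_measure R).

Lemma ge0_integral_mrestr d (T : measurableType d) (m : {measure set T -> \bar R})
    (D : set T) (mD : measurable D) (f : T -> \bar R) : measurable_fun setT f -> (forall x, 0 <= f x) ->
  \int[mrestr m mD]_x f x = \int[m]_(x in D) f x.
Proof.
move=> mf f0; rewrite -(setUv D) ge0_integral_setU//.
- rewrite [X in _ + X](_ : _ = 0) ?adde0.
    apply: eq_measure_integral => A mA AD.
    by transitivity (m (A `&` D)) => //; rewrite setIidl.
  apply: null_set_integral; first exact: measurableC.
    exact: measurable_funTS.
  by transitivity (m (~` D `&` D)) => //; rewrite setICl measure0.
- exact: measurableC.
- by rewrite setUv.
- by rewrite disj_set2E setICr.
Qed.

Lemma ge0_integral_image_measure d1 d2 (T1 : measurableType d1) (T2 : measurableType d2)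
    (m : {measure set T1 -> \bar R}) (phi : T1 -> T2) (mphi : measurable_fun setT phi)
    (f : T2 -> \bar R) : measurable_fun setT f -> (forall x, 0 <= f x) ->
  \int[image_measure m mphi]_x f x = \int[m]_x f (phi x).
Proof.
move=> mf f0.
by rewrite (@ge0_integral_pushforward _ _ _ _ _ _ mphi m setT f)// preimage_setT.
Qed.

End measures.

(** * Image of a measure with density *)

Section weighted_image.
Context {R : realType} d1 d2 (T1 : measurableType d1) (T2 : measurableType d2).
Variables (m : {sigma_finite_measure set T1 -> \bar R}) (phi : T1 -> T2) (w : T1 -> R).
Hypothesis mphi : measurable_fun setT phi.
Hypothesis mw : measurable_fun setT w.
Hypothesis w0 : forall x, 0 <= w x.
Local Open Scope ereal_scope.
Notation leb := (@lebesgue_measure R).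

Definition subgraph (w : T1 -> R) : set (T1 * measurableTypeR R) :=
  [set z | (0 < z.2 /\ z.2 < w z.1)%R].

Lemma measurable_subgraph : measurable (subgraph w).
Proof.
have m2 : measurable_fun setT (fun z : T1 * measurableTypeR R => z.2 : R) by exact: measurable_snd.
have m1 : measurable_fun setT (fun z : T1 * measurableTypeR R => w z.1).
  by apply: measurableT_comp mw _; exact: measurable_fst.
have h1 : measurable_fun setT (fun z : T1 * measurableTypeR R => (0 < z.2)%R).
  exact: measurable_fun_ltr.
have h2 : measurable_fun setT (fun z : T1 * measurableTypeR R => (z.2 < w z.1)%R).
  exact: measurable_fun_ltr.
have := measurable_and h1 h2 measurableT (Y := [set true]) I.
by rewrite setTI; congr measurable; apply/seteqP; split => z /=; [move/andP|move=> ?; apply/andP].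
Qed.

Let mphi1 : measurable_fun setT (fun z : T1 * measurableTypeR R => phi z.1).
Proof. by apply: measurableT_comp mphi _; exact: measurable_fst. Qed.

(** The image under [phi] of the measure with density [w] with respect to [m]: the density comes
    from restricting the product with Lebesgue measure to the region under the graph of [w], whose
    section over x has length [w x]. *)
Definition weighted_image : {measure set T2 -> \bar R} :=
  image_measure (mrestr (m \x leb) measurable_subgraph) mphi1.

Lemma ge0_integral_weighted_image (f : T2 -> \bar R) : measurable_fun setT f -> (forall x, 0 <= f x) ->
  \int[weighted_image]_x f x = \int[m]_x (f (phi x) * (w x)%:E).
Proof.
move=> mf f0; rewrite ge0_integral_image_measure//.
have mfp : measurable_fun setT (fun z : T1 * measurableTypeR R => f (phi z.1)).
  exact: measurableT_comp mf mphi1.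
rewrite (@ge0_integral_mrestr _ _ _ _ _ measurable_subgraph (fun z => f (phi z.1)) mfp (fun z => f0 _)).
rewrite integral_mkcond fubini_tonelli1; last 2 first.
- by apply/(measurable_restrictT _ measurable_subgraph); exact: measurable_funTS.
- by apply: erestrict_ge0 => z _.
apply: eq_integral => x _; rewrite /fubini_F.
transitivity (\int[leb]_(y in `]0%R, w x[) (f (phi x))).
  rewrite [RHS]integral_mkcond; apply: eq_integral => y _; rewrite !patchE.
  congr (if _ then _ else _); apply/idP/idP => /set_mem h; apply/mem_set.
    by case: h => /= h1 h2; rewrite /= in_itv/= h1.
  by move: h; rewrite /= in_itv/= => /andP[].
rewrite integral_cst//= lebesgue_measure_itv/= lte_fin -EFinB subr0.
by case: ltP => // h; congr (_ * _%:E); apply/eqP; rewrite eq_le w0 h.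
Qed.

End weighted_image.

(** * Measures determined by continuous functions of compact support *)

Section C0_measures.
Context {R : realType} {n : nat}.
Local Open Scope ereal_scope.
Implicit Types (W K : set 'rV[R]_n).

Lemma rV_measurable_openE : (@measurable _ 'rV[R]_n) = <<s open >>.
Proof.
apply/seteqP; split; last first.
  apply: smallest_sub; last by move=> A; exact: open_measurable_rV.
  split => //.
  - by move=> A mA; rewrite setTD; exact: measurableC.
  - by move=> F mF; exact: bigcupT_measurable.
apply: smallest_sub; first exact: smallest_sigma_algebra.
rewrite -bigcup_seq/= => A [i _ [B mB <-]] /=.
have h : measurable_fun (T := g_sigma_algebraType (@open 'rV[R]_n)) setT (fun x : 'rV[R]_n => x ord0 i).
  apply: (measurability _ (RGenOInfty.measurableE R)) => _ [_ [a ->] <-].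
  rewrite setTI; apply: sub_sigma_algebra.
  have : open `]a, +oo[%classic by exact: interval_open.
  by move: (`]a, +oo[%classic) => U; apply: open_comp => x _; exact: coord_continuous.
exact: h.
Qed.

(** Continuous functions that increase with k to the indicator of [W] when [W] is open. *)
Definition cutoff W (k : nat) (x : 'rV[R]_n) : R := Num.min 1%R (k%:R * cdist (~` W) x)%R.

Lemma cutoff_ge0 W k x : (0 <= cutoff W k x)%R.
Proof. by rewrite le_min ler01 mulr_ge0// cdist_ge0. Qed.

Lemma cutoff_C0 Omega W K k : open W -> W `<=` K -> compact K -> K `<=` Omega ->
  C0 Omega (cutoff W k).
Proof.
move=> oW WK cK KO.
have sW : supp (cutoff W k) `<=` K.
  rewrite (closure_id K).1; last by apply: compact_closed; first exact: norm_hausdorff.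
  apply: closure_subset => x /=; apply: contra_neqP => Kx.
  by rewrite /cutoff cdist_eq0 ?mulr0 ?min_r// => /WK.
split; last split.
- have c1 : continuous (fun _ : 'rV[R]_n => 1%R : R) by exact: cst_continuous.
  have c2 : continuous (fun x : 'rV[R]_n => k%:R * cdist (~` W) x)%R.
    move=> x; have h := @cdist_continuous R 'rV[R]_n (~` W) x.
    exact: (@cvgMl_tmp R _ _ _ _ k%:R%R _ h).
  by move=> x; exact: (continuous_min (c1 x) (c2 x)).
- by apply: subclosed_compact sW => //; exact: closed_closure.
- exact: subset_trans KO.
Qed.

Lemma cutoff_nd W x : {homo (cutoff W ^~ x) : k l / (k <= l)%N >-> (k <= l)%R}.
Proof.
move=> k l kl; rewrite /cutoff le_min2// ler_wpM2r ?cdist_ge0//.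
by rewrite ler_nat.
Qed.

Lemma limn_cutoff W x : open W -> limn (fun k => (cutoff W k x)%:E) = (\1_W x : R)%:E.
Proof.
move=> oW; apply/cvg_lim => //.
rewrite indicE; case: (boolP (x \in W)) => [/set_mem Wx|/negP Wx].
  have c0 : (0 < cdist (~` W) x)%R by apply: cdist_gt0; [exact: open_closedC|move=> /(_ Wx)].
  apply: cvg_near_cst; near=> k; rewrite /cutoff min_l//.
  rewrite -ler_pdivrMr// div1r.
  by near: k; exact: nbhs_infty_ger.
apply: cvg_near_cst; apply: nearW => k.
rewrite /cutoff cdist_eq0 ?mulr0 ?min_r//.
by move=> h; apply: Wx; exact/mem_set.
Unshelve. all: by end_near. Qed.

Section agree.
Variables (Omega D : set 'rV[R]_n) (m1 m2 : {measure set 'rV[R]_n -> \bar R}).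
Hypotheses (oO : open Omega) (mD : measurable D) (DO : D `<=` Omega).
Hypothesis m12 : forall f, C0 Omega f -> (forall x, 0 <= f x)%R ->
  \int[m1]_(x in D) (f x)%:E = \int[m2]_(x in D) (f x)%:E.
Hypothesis m2oo : forall K, compact K -> K `<=` Omega -> m2 (K `&` D) < +oo.

Let integral_cutoff (m : {measure set 'rV[R]_n -> \bar R}) W : open W ->
  \int[m]_(x in D) (cutoff W k x)%:E @[k --> \oo] --> m (W `&` D).
Proof.
move=> oW; rewrite -integral_indic//; last exact: open_measurable_rV.
under [X in _ --> X]eq_integral => x _ do rewrite -(limn_cutoff x oW).
apply: (cvg_monotone_convergence mD) => [k|k x _|x _ k l kl].
- apply: measurable_funTS; apply/measurable_EFinP; apply: measurable_minr => //.
  apply: measurable_funM => //; apply: continuous_measurable_rV; exact: cdist_continuous.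
- by rewrite lee_fin cutoff_ge0.
- by rewrite lee_fin cutoff_nd.
Qed.

Let agree_open W K : open W -> W `<=` K -> compact K -> K `<=` Omega ->
  m1 (W `&` D) = m2 (W `&` D).
Proof.
move=> oW WK cK KO.
have := @integral_cutoff m1 W oW.
under eq_cvg => k.
  rewrite (m12 (cutoff_C0 k oW WK cK KO)); last by move=> x; exact: cutoff_ge0.
  over.
by move=> h; apply: cvg_unique h (@integral_cutoff m2 W oW).
Qed.

(** Exhaustion of [Omega] by open sets contained in compact subsets of [Omega]. Restricted to one of
    them both measures are finite, so agreement on open sets, which are closed under intersection,
    extends to all measurable sets. *)
Let inner (j : nat) : set 'rV[R]_n :=
  [set x | (j.+1%:R^-1 < cdist (~` Omega) x)%R] `&` [set x | (`|x| < j.+1%:R)%R].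
Let inner_cl (j : nat) : set 'rV[R]_n :=
  [set x | (j.+1%:R^-1 <= cdist (~` Omega) x)%R] `&` [set x | (`|x| <= j.+1%:R)%R].

Let open_inner j : open (inner j).
Proof.
apply: openI.
  apply: (@open_comp _ _ (cdist (~` Omega)) [set r | (j.+1%:R^-1 < r)%R]); last exact: open_gt.
  by move=> x _; exact: cdist_continuous.
apply: (@open_comp _ _ (fun x : 'rV[R]_n => `|x|%R) [set r | (r < j.+1%:R)%R]); last exact: open_lt.
by move=> x _; exact: norm_continuous.
Qed.

Let compact_inner_cl j : compact (inner_cl j).
Proof.
apply: bounded_closed_compact.
  by exists j.+1%:R; split; [exact: num_real|move=> M jM x [_ /=] /le_trans; apply; exact: ltW].
apply: closedI.
  apply: (@closed_comp _ _ (cdist (~` Omega)) [set r | (j.+1%:R^-1 <= r)%R]); last exact: closed_ge.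
  by move=> x _; exact: cdist_continuous.
apply: (@closed_comp _ _ (fun x : 'rV[R]_n => `|x|%R) [set r | (r <= j.+1%:R)%R]); last exact: closed_le.
by move=> x _; exact: norm_continuous.
Qed.

Let inner_sub j : inner j `<=` inner_cl j.
Proof. by move=> x [h1 h2]; split => /=; exact: ltW. Qed.

Let inner_clO j : inner_cl j `<=` Omega.
Proof.
move=> x [h _]; apply: contrapT => Ox; move: h => /=.
by rewrite cdist_eq0// leNgt invr_gt0 ltr0Sn.
Qed.

Let agree_inner j A : measurable A -> m1 (A `&` (inner j `&` D)) = m2 (A `&` (inner j `&` D)).
Proof.
have mI : measurable (inner j `&` D) by apply: measurableI => //; exact: open_measurable_rV.
move=> mA.
have H : mrestr m1 mI A = mrestr m2 mI A; last exact: H.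
apply: (@measure_unique _ R 'rV[R]_n open (fun _ => setT) rV_measurable_openE) => //.
- by move=> U V; exact: openI.
- by move=> _; exact: openT.
- by rewrite bigcup_const.
- move=> U oU; have EI m : mrestr m mI U = m ((U `&` inner j) `&` D) by rewrite /mrestr setIA.
  rewrite [LHS]EI [RHS]EI.
  apply: (@agree_open _ (inner_cl j)) => //; first exact: openI.
  exact: subset_trans (@inner_sub j).
- move=> _; have EI : mrestr m1 mI setT = m1 (inner j `&` D) by rewrite /mrestr setTI.
  rewrite [X in X < _]EI.
  rewrite (agree_open (@open_inner j) (@inner_sub j) (@compact_inner_cl j) (@inner_clO j)).
  apply: le_lt_trans (m2oo (@compact_inner_cl j) (@inner_clO j)).
  apply: le_measure; rewrite ?inE//.
    apply: measurableI => //; apply: closed_measurable_rV.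
    by apply: compact_closed; first exact: norm_hausdorff.
  exact: setSI.
Qed.

Let inner_cover : D = \bigcup_j (D `&` inner j).
Proof.
apply/seteqP; split => [x Dx|x [j _ []//]].
have c0 : (0 < cdist (~` Omega) x)%R.
  apply: cdist_gt0; first exact: open_closedC.
  by apply; exact: DO.
pose X : R := Num.max (`|x|)%R ((cdist (~` Omega) x)^-1)%R.
have X0 : (0 <= X)%R by rewrite le_max normr_ge0.
have hX : (X < (Num.bound X).+1%:R)%R by rewrite (lt_trans (Num.Theory.archi_boundP X0))// ltr_nat.
exists (Num.bound X) => //; split => //; split => /=.
  rewrite -[ltRHS]invrK ltf_pV2 ?posrE ?invr_gt0//.
  by apply: le_lt_trans hX; rewrite le_max lexx orbT.
by apply: le_lt_trans hX; rewrite le_max lexx.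
Qed.

(* The uniqueness part of Riesz' theorem. *)
Lemma C0_integral_agree (g : 'rV[R]_n -> \bar R) :
  \int[m1]_(x in D) g x = \int[m2]_(x in D) g x.
Proof.
apply: eq_measure_integral => A mA AD.
have E : A = \bigcup_j (A `&` (inner j `&` D)).
  rewrite -setI_bigcupr.
  under eq_bigcupr do rewrite setIC.
  by rewrite -inner_cover setIidl.
have nd : {homo (fun j => A `&` (inner j `&` D)) : k l / (k <= l)%N >-> (k <= l)%O}.
  move=> k l kl; apply/subsetPset; apply: setIS; apply: setSI => x [h1 h2]; split => /=.
    by apply: le_lt_trans h1; rewrite lef_pV2 ?posrE ?ltr0Sn// ler_nat.
  by apply: lt_le_trans h2 _; rewrite ler_nat.
have mA' j : measurable (A `&` (inner j `&` D)).
  by apply: measurableI => //; apply: measurableI => //; exact: open_measurable_rV.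
have mU : measurable (\bigcup_j (A `&` (inner j `&` D))) by exact: bigcupT_measurable.
have c1 := @nondecreasing_cvg_mu _ _ _ m1 _ mA' mU nd.
have c2 := @nondecreasing_cvg_mu _ _ _ m2 _ mA' mU nd.
rewrite -E in c1 c2.
rewrite (_ : m1 \o _ = m2 \o (fun j => A `&` (inner j `&` D))) in c1; last first.
  by apply/funext => j /=; exact: agree_inner.
exact: cvg_unique c1 c2.
Qed.

End agree.
End C0_measures.

(** * Chords as connected components, and their midpoints *)

Section components.
Context {R : realType} {n : nat} (Omega : set 'rV[R]_n).
Hypothesis oO : open Omega.
Variable nu : 'rV[R]_n.
Hypothesis nu0 : nu != 0.
Implicit Types (x y z : 'rV[R]_n).
Notation fw x := (exit_time Omega nu x).
Notation bw x := (exit_time Omega (- nu) x).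
Notation comp x a := (connected_component (Omega `&` line nu x) (x + a *: nu)).

Lemma line_coord x : exists2 c : 'rV[R]_n -> R,
  continuous c & forall s, c (x + s *: nu) = s.
Proof.
have [i nui] : exists i, nu ord0 i != 0.
  apply: contrapT => h; move/negP: nu0; apply; apply/eqP/rowP => i; rewrite mxE.
  by apply: contrapT => hi; apply: h; exists i; exact/eqP.
exists (fun z => (z ord0 i - x ord0 i) * (nu ord0 i)^-1); last first.
  move=> s; have -> : (x + s *: nu) ord0 i = x ord0 i + s * nu ord0 i by rewrite !mxE.
  by rewrite addrC addKr mulfK.
move=> z; have h := @coord_continuous R 1 n ord0 i z.
have h2 : continuous_at z (fun M : 'rV[R]_n => M ord0 i - x ord0 i).
  by apply: continuousB => //; exact: cst_continuous.
exact: (@cvgMr_tmp R _ _ _ _ _ (nu ord0 i)^-1 h2).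
Qed.

(** A connected subset through x + a nu has as parameters an interval contained in [Omega], which
    the exit times cannot cut; conversely the chord is the continuous image of an interval. *)
Lemma component_chord x a : Omega (x + a *: nu) ->
  comp x a = [set x + s *: nu | s in chord_at Omega nu x a].
Proof.
move=> Oa; apply/seteqP; split.
  move=> z [C [Ca CO cC] Cz].
  have [c cc cE] := line_coord x.
  have [_ [r _ rz]] := CO _ Cz; exists r => //.
  have itv : is_interval (c @` C).
    by apply/connected_intervalP; apply: connected_continuous_connected => //; exact: continuous_subspaceT.
  have Ia : (c @` C) a by exists (x + a *: nu).
  have Ir : (c @` C) r by exists z => //; rewrite -rz cE.
  have between s : (c @` C) s -> Omega (x + s *: nu).
    by move=> [z' Cz' <-]; have [Oz' [s' _ sz']] := CO _ Cz'; rewrite -sz' cE sz'.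
  have [ar|ra] := leP a r; rewrite /chord_at/chord/=; apply/andP; split.
  - by apply: (@lt_le_trans _ _ 0%E); rewrite ?oppe_lt0 ?exit_gt0// lee_fin subr_ge0.
  - apply/exit_time_gtP => //; first by rewrite subr_ge0.
    move=> s /andP[s0 sr]; rewrite -addrA -scalerDl; apply: between.
    by apply: (itv _ _ Ia Ir); apply/andP; split; lra.
  - rewrite -[ltRHS]oppeK lteN2 -EFinN opprB; apply/exit_time_gtP => //; first by lra.
    move=> s /andP[s0 sr]; rewrite scalerN -scaleNr -addrA -scalerDl; apply: between.
    by apply: (itv _ _ Ir Ia); apply/andP; split; lra.
  - by apply: (@le_lt_trans _ _ 0%E); rewrite ?exit_gt0// lee_fin; lra.
apply: connected_component_max.
- by exists a => //; rewrite /chord_at/= subrr; exact: chord0.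
- by move=> _ [s cs <-]; split; [exact: chord_at_sub cs|exists s].
- apply: connected_continuous_connected.
    apply/connected_intervalP => s r /andP[s1 s2] /andP[r1 r2] t /andP[st tr].
    rewrite /chord_at/chord/=; apply/andP; split.
      by apply: lt_le_trans s1 _; rewrite lee_fin; lra.
    by apply: le_lt_trans r2; rewrite lee_fin; lra.
  by apply: continuous_subspaceT; exact: line_continuous.
Qed.

Lemma component_coords x a : Omega (x + a *: nu) ->
  [set s | comp x a (x + s *: nu)] = chord_at Omega nu x a.
Proof.
move=> Oa; rewrite component_chord//; apply/seteqP; split => s /=; last by exists s.
move=> [r cr rs]; have [c _ cE] := line_coord x.
by rewrite -(cE s) -rs cE.
Qed.

Lemma midpoint_bounded x a (T B : R) : Omega (x + a *: nu) ->
  fw (x + a *: nu) = T%:E -> bw (x + a *: nu) = B%:E ->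
  midpoint nu x (comp x a) = Some (mid Omega nu (x + a *: nu)).
Proof.
move=> Oa fT bB; have cI : chord_at Omega nu x a = `]a - B, a + T[%classic.
  apply/seteqP; split => s; rewrite /chord_at/chord/= fT bB -EFinN !lte_fin in_itv/= => /andP[? ?];
  by apply/andP; split; lra.
have T0 : 0 < T by rewrite -lte_fin -fT exit_gt0.
have B0 : 0 < B by rewrite -lte_fin -bB exit_gt0.
rewrite /midpoint component_coords// cI; case: asboolP => [_|].
  rewrite sup_itv; last by rewrite bnd_simp; lra.
  rewrite inf_itv; last by rewrite bnd_simp; lra.
  by rewrite /mid fT bB/= -(addrA x) -scalerDl; congr (Some (_ + _ *: _)); field.
case; rewrite component_chord// cI.
exists (`|x| + (`|a| + B + T) * `|nu|); split; first exact: num_real.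
move=> M hM _ [s + <-]; rewrite /= in_itv/= => /andP[s1 s2].
apply: le_trans (ltW hM); apply: le_trans (ler_normD _ _) _.
rewrite lerD2l normrZ ler_wpM2r// ler_norml; have := ler_norm a; have := ler_norm (- a).
by rewrite normrN => ? ?; apply/andP; split; lra.
Qed.

Lemma midpoint_unbounded x a : Omega (x + a *: nu) ->
  fw (x + a *: nu) = +oo%E \/ bw (x + a *: nu) = +oo%E -> midpoint nu x (comp x a) = None.
Proof.
move=> Oa oo; rewrite /midpoint; case: asboolP => // -[M0 [_ HM]]; exfalso.
have large (B : R) : exists2 s, chord_at Omega nu x a s & B <= `|s|.
  have Ba : 0 <= `|B| + `|a| by rewrite addr_ge0.
  have := ler_norm B; have := ler_norm a; have := ler_norm (- a); rewrite normrN => *.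
  case: oo => oo.
    exists (a + (`|B| + `|a|)).
      rewrite /chord_at/chord/= oo ltry andbT (@lt_le_trans _ _ 0%E)//.
        by rewrite oppe_lt0 exit_gt0.
      by rewrite lee_fin; lra.
    by apply: le_trans (ler_norm _); lra.
  exists (a - (`|B| + `|a|)).
    rewrite /chord_at/chord/= oo /= ltNyr/= (@le_lt_trans _ _ 0%E)//.
      by rewrite lee_fin; lra.
    by rewrite exit_gt0.
  by rewrite -normrN; apply: le_trans (ler_norm _); lra.
have n0 : 0 < `|nu| by rewrite normr_gt0.
have [s cs] := large ((`|M0| + 1 + `|x| + 1) / `|nu|).
rewrite ler_pdivrMr// leNgt => /negP; apply.
have M1 : M0 < `|M0| + 1 by rewrite (le_lt_trans (ler_norm _))// ltrDl.
have := HM _ M1 (x + s *: nu).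
rewrite component_chord// => /(_ (ex_intro2 _ _ s cs erefl)) /= h.
have : `|s| * `|nu| <= `|x + s *: nu| + `|x|.
  have -> : `|s| * `|nu| = `|(x + s *: nu) - x| by rewrite addrC addKr normrZ.
  exact: ler_normB.
by move: h; set X := _ * _; lra.
Qed.

Lemma mid_Omega x : Omega x -> (fw x < +oo)%E -> (bw x < +oo)%E -> Omega (mid Omega nu x).
Proof.
move=> Ox fo bo; apply: (@chord_sub _ _ _ oO nu).
have fT : fw x = (fine (fw x))%:E by rewrite fineK// ge0_fin_numE ?exit_time_ge0.
have bT : bw x = (fine (bw x))%:E by rewrite fineK// ge0_fin_numE ?exit_time_ge0.
have T0 : 0 < fine (fw x) by rewrite -lte_fin -fT exit_gt0.
have B0 : 0 < fine (bw x) by rewrite -lte_fin -bT exit_gt0.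
rewrite /chord/= fT bT -EFinN !lte_fin /=; move: T0 B0.
by set T := fine _; set B := fine _; lra.
Qed.

Lemma mid_skeleton x : usphere nu -> Omega x -> (fw x < +oo)%E -> (bw x < +oo)%E ->
  skeleton Omega nu (mid Omega nu x).
Proof.
move=> /usphere_dotp nunu Ox fo bo; split; last exact: mid_Omega.
apply: subset_closure.
pose a := dotp x nu; pose x' := x - a *: nu.
have xE : x = x' + a *: nu by rewrite /x' subrK.
exists x', (comp x' a); split.
- rewrite /perp/= /x' dotpE mulmxBl mxE [X in _ + X]mxE -scalemxAl [X in _ - X]mxE.
  by rewrite -!dotpE nunu mulr1 subrr.
- by exists (x' + a *: nu) => //; split; [rewrite -xE|exists a].
- rewrite (@midpoint_bounded _ _ (fine (fw x)) (fine (bw x))) -xE//.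
  + by rewrite fineK// ge0_fin_numE ?exit_time_ge0.
  + by rewrite fineK// ge0_fin_numE ?exit_time_ge0.
Qed.

Lemma open_chord_at x a : open (chord_at Omega nu x a : set R).
Proof.
rewrite openE => r cr; have := chord_at_sub oO cr => Or.
have [e e0 he] := chord_ball oO nu Or.
apply/nbhs_ballP; exists e => //= s; rewrite -ball_normE/= => rs.
rewrite -(chord_at_eq oO cr) /chord_at/=; apply: he.
by rewrite distrC.
Qed.

End components.

(** * Sums over the chords of a line *)

Section line_sums.
Context {R : realType} {n : nat} (Omega : set 'rV[R]_n).
Hypothesis oO : open Omega.
Variable nu : 'rV[R]_n.
Hypothesis nu0 : nu != 0.
Implicit Types (x y z : 'rV[R]_n).
Notation fw x := (exit_time Omega nu x).
Notation bw x := (exit_time Omega (- nu) x).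
Notation comp x a := (connected_component (Omega `&` line nu x) (x + a *: nu)).
Notation leb := (@lebesgue_measure R).

Let g (f : 'rV[R]_n -> R) x l := eval_infty f (midpoint nu x l).

Lemma chordsP x l : chords Omega nu x l -> exists2 a, Omega (x + a *: nu) & l = comp x a.
Proof. by move=> [y [Oy [a _ ay]] <-]; exists a; rewrite ay. Qed.

Lemma chords_component x a : Omega (x + a *: nu) -> chords Omega nu x (comp x a).
Proof. by move=> Oa; exists (x + a *: nu) => //; split => //; exists a. Qed.

Lemma component_eq x a s : Omega (x + a *: nu) -> comp x a (x + s *: nu) -> comp x s = comp x a.
Proof.
move=> Oa cs.
have cas : chord_at Omega nu x a s by rewrite -(component_coords oO nu0 Oa).
have Os := chord_at_sub oO cas.
by rewrite !(component_chord oO nu0)// (chord_at_eq oO cas).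
Qed.

Lemma eval_midpoint f x a : Omega (x + a *: nu) ->
  g f x (comp x a) = if (fw (x + a *: nu) < +oo)%E && (bw (x + a *: nu) < +oo)%E
                     then f (mid Omega nu (x + a *: nu)) else 0.
Proof.
move=> Oa; rewrite /g; case: ifPn => [/andP[fo bo]|].
  rewrite (midpoint_bounded (T := fine (fw (x + a *: nu))) (B := fine (bw (x + a *: nu))) oO nu0)//.
    by rewrite fineK// ge0_fin_numE ?exit_time_ge0.
  by rewrite fineK// ge0_fin_numE ?exit_time_ge0.
rewrite negb_and -!leNgt !leye_eq => /orP oo.
by rewrite midpoint_unbounded//; case: oo => /eqP ->; [left|right].
Qed.

Definition relevant_chords f x := chords Omega nu x `&` [set l | g f x l != 0].

(** The parameters of points of the support form a compact set, covered by finitely many of the open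
    chords. A chord with a nonzero value contains such a parameter, that of its midpoint, and
    therefore is one of these. *)
Lemma finite_relevant_chords f x : C0 Omega f -> finite_set (relevant_chords f x).
Proof.
move=> [cf sf]; pose T : set R := [set s | supp f (x + s *: nu)].
have cT : compact T.
  have [S S0 hS] := supp_line_bounded sf x nu0.
  apply: (@subclosed_compact _ _ `[- S, S]%classic); last 2 first.
  - exact: segment_compact.
  - move=> s Ts; rewrite /= in_itv/= -ler_norml leNgt; apply/negP => h.
    by apply: (hS s _ Ts); rewrite ltW.
  apply: (@closed_comp _ _ (fun s : R => x + s *: nu) (supp f)); last exact: closed_closure.
  by move=> s _; exact: line_continuous.
move: cT; rewrite compact_cover => /(_ R T (fun a => chord_at Omega nu x a)).
case.
- by move=> a _; exact: open_chord_at.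
- move=> s Ts; exists s => //; rewrite /chord_at/= subrr; apply: chord0 => //.
  by have [_ sO] := sf; exact: sO.
move=> D' D'T; set D := (X in classical_sets.cover X _) => cover.
suff sub : relevant_chords f x `<=` (fun a => comp x a) @` D.
  by apply: sub_finite_set sub _; apply: finite_image; exact: finite_fset.
move=> l [/chordsP[b Ob ->]] /=; rewrite eval_midpoint//.
case: ifPn; last by rewrite eqxx.
move=> /andP[fo bo] fmid.
pose s0 := b + (fine (fw (x + b *: nu)) - fine (bw (x + b *: nu))) / 2.
have Em : mid Omega nu (x + b *: nu) = x + s0 *: nu by rewrite /mid -addrA -scalerDl.
have Ts0 : T s0 by rewrite /T/= -Em; apply: subset_closure.
have [a aD ca] := cover _ Ts0.
have Oa : Omega (x + a *: nu).
  by have [_ sO] := sf; apply: sO; have := D'T _ aD => /set_mem.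
exists a => //.
have cb : chord_at Omega nu x b s0.
  have fT : fw (x + b *: nu) = (fine (fw (x + b *: nu)))%:E by rewrite fineK// ge0_fin_numE ?exit_time_ge0.
  have bT : bw (x + b *: nu) = (fine (bw (x + b *: nu)))%:E by rewrite fineK// ge0_fin_numE ?exit_time_ge0.
  have T0 : 0 < fine (fw (x + b *: nu)) by rewrite -lte_fin -fT exit_gt0.
  have B0 : 0 < fine (bw (x + b *: nu)) by rewrite -lte_fin -bT exit_gt0.
  rewrite /chord_at/chord/= fT bT -EFinN !lte_fin /s0 /=; move: T0 B0.
  by set A := fine _; set B := fine _ => ? ?; apply/andP; split; lra.
by rewrite !(component_chord oO nu0)// -(chord_at_eq oO ca) -(chord_at_eq oO cb).
Qed.

(** On each chord the integrand is the value of [f] at the midpoint times a weight of integral 1,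
    and finitely many chords contribute. *)
Lemma integral_line_midpoints f x : C0 Omega f -> (forall y, 0 <= f y) ->
  (\int[leb]_(s in [set s | Omega (x + s *: nu)%R])
     (f (mid Omega nu (x + s *: nu)) * chord_weight Omega nu (x + s *: nu))%:E =
  (\sum_(l \in chords Omega nu x) g f x l)%:E)%E.
Proof.
move=> fC f0; have fin := finite_relevant_chords x fC.
set F := relevant_chords f x in fin.
have mw : measurable_fun setT (chord_weight Omega nu).
  exact: measurable_slice (measurable_chord_weight oO).
have g0 l : 0 <= g f x l by rewrite /g /eval_infty; case: midpoint => //= m; exact: f0.
pose U := [set s : R | Omega (x + s *: nu)].
have oU : open U.
  by apply: (@open_comp _ _ (fun s : R => x + s *: nu)) => // s _; exact: line_continuous.
have mU : measurable U by exact: open_measurable.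
pose S l := [set s : R | l (x + s *: nu)].
(* The multiplicity is 1 on [F] and 0 elsewhere; it makes [t l] measurable for every set l, and not
   for chords only. *)
pose t l s := (g f x l * (\1_(S l) s * chord_weight Omega nu (x + s *: nu))) *+ (l \in F).
have SF a : Omega (x + a *: nu) -> S (comp x a) = chord_at Omega nu x a.
  by move=> Oa; exact: component_coords.
have t0 l s : 0 <= t l s by rewrite mulrn_wge0// !mulr_ge0// chord_weight_ge0.
have mt l : measurable_fun U (fun s => (t l s)%:E).
  apply/measurable_EFinP; rewrite /t; case: (boolP (l \in F)) => [/set_mem [/chordsP[a Oa ->] _]|_].
    apply: measurable_funM => //; apply: measurable_funM.
      by apply: measurable_indic; rewrite SF//; exact: measurable_chord_at.
    apply: measurable_funTS; apply: measurableT_comp mw _; apply: measurable_rVD => //.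
    by apply: measurable_rVZ => //; exact: measurable_cst.
  exact: measurable_cst.
have pw s : s \in U ->
  (f (mid Omega nu (x + s *: nu)) * chord_weight Omega nu (x + s *: nu))%:E =
  \sum_(l \in F) (t l s)%:E.
  move=> /set_mem Us; rewrite fsumEFin//; congr EFin.
  have refl : comp x s (x + s *: nu).
    by apply: connected_component_refl; split => //; exists s.
  have uniq l : F l -> S l s -> l = comp x s.
    by move=> [/chordsP[a Oa ->] _] Sl; rewrite (component_eq Oa Sl).
  have gs : g f x (comp x s) * chord_weight Omega nu (x + s *: nu) =
      f (mid Omega nu (x + s *: nu)) * chord_weight Omega nu (x + s *: nu).
    rewrite eval_midpoint//; case: ifPn => // h; rewrite mul0r /chord_weight (negbTE h)/=.
    by rewrite mulr0.
  rewrite -gs; have [Fs|nFs] := pselect (F (comp x s)).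
    rewrite -(@fsbig_widen _ _ _ _ [set comp x s])//; last 2 first.
    - by move=> _ ->.
    - move=> l [Fl /= ls]; rewrite /t indicE memNset ?mul0r ?mulr0 ?mul0rn// => Sl.
      by apply: ls; exact: uniq.
    by rewrite fsbig_set1 /t indicE !mem_set// mul1r mulr1n.
  rewrite fsbig1; last first.
    move=> l Fl; rewrite /t indicE memNset ?mul0r ?mulr0 ?mul0rn// => Sl.
    by apply: nFs; rewrite -(uniq _ Fl Sl).
  have [->|gn0] := eqVneq (g f x (comp x s)) 0; first by rewrite mul0r.
  by exfalso; apply: nFs; split => //; exact: chords_component.
transitivity (\int[leb]_(s in U) (\sum_(l \in F) (t l s)%:E)%R)%E; first by apply: eq_integral => s Us; exact: pw.
rewrite ge0_integral_fsum//; last by move=> l s _; rewrite lee_fin.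
have -> : \sum_(l \in chords Omega nu x) g f x l = \sum_(l \in F) g f x l.
  apply/esym; apply: fsbig_widen; first by move=> l [].
  by move=> l [cl /= nF]; apply: contrapT => /eqP gl; apply: nF.
rewrite -fsumEFin//; apply: eq_fsbigr => l /set_mem Fl.
have [cl gl] := Fl; have [a Oa la] := chordsP cl.
have [fo bo] : (fw (x + a *: nu) < +oo)%E /\ (bw (x + a *: nu) < +oo)%E.
  by move: gl; rewrite /= la eval_midpoint//; case: ifPn => [/andP[]//|_]; rewrite eqxx.
transitivity (\int[leb]_(s in chord_at Omega nu x a)
   ((g f x l)%:E * (chord_weight Omega nu (x + s *: nu))%:E))%E.
  rewrite integral_mkcond [RHS]integral_mkcond; apply: eq_integral => s _.
  rewrite !patchE; case: ifPn => [_|/negP nU]; last first.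
    case: ifPn => // /set_mem /(chord_at_sub oO) Us; exfalso; apply: nU; exact/mem_set.
  rewrite /t mem_set// mulr1n indicE la SF//.
  by case: ifPn => _; rewrite ?mul0r ?mulr0// mul1r EFinM.
have mwE : measurable_fun setT (fun y => (chord_weight Omega nu y)%:E) by exact/measurable_EFinP.
rewrite ge0_integralZl_EFin//; last 3 first.
- exact: measurable_chord_at.
- by move=> s _; rewrite lee_fin chord_weight_ge0.
- apply: measurable_funTS; exact: (measurable_line nu x mwE).
rewrite (ge0_integral_chord_at Omega nu x a mwE); last by move=> y; rewrite lee_fin chord_weight_ge0.
by rewrite integral_chord_weight// mule1.
Qed.

End line_sums.

Lemma coord_le_norm (R : realType) n (x : 'rV[R]_n) i : `|x ord0 i| <= `|x|.
Proof.
rewrite [leRHS]/Num.norm/= mx_normrE.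
exact: (@le_bigmax _ _ _ _ (fun ij : 'I_1 * 'I_n => `|x ij.1 ij.2|) (ord0, i)).
Qed.

Lemma usphere_neq0 (R : realType) n (nu : 'rV[R]_n) : usphere nu -> nu != 0.
Proof.
move=> /usphere_dotp nunu; apply/eqP => nu0; move: nunu.
by rewrite nu0 /dotp big1 => [/esym/eqP|i _]; rewrite ?oner_eq0// mxE mul0r.
Qed.

(** * The midpoint measure *)

Section skeletal.
Context {R : realType} {n : nat} (Omega : set 'rV[R]_n.+1).
Hypothesis oO : open Omega.
Variable nu : 'rV[R]_n.+1.
Hypothesis Snu : usphere nu.
Implicit Types (x y z : 'rV[R]_n.+1) (f : 'rV[R]_n.+1 -> R).
Notation fw x := (exit_time Omega nu x).
Notation bw x := (exit_time Omega (- nu) x).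
Local Open Scope ereal_scope.
Notation leb := (@lebesgue_measure R).

Let nu0 : nu != 0%R. Proof. exact: usphere_neq0. Qed.

Let mO : measurable Omega. Proof. exact: open_measurable_rV. Qed.

Let w x : R := (chord_weight Omega nu x * \1_Omega x)%R.

Let w0 x : (0 <= w x)%R. Proof. by rewrite mulr_ge0// chord_weight_ge0. Qed.

Let mcw : measurable_fun setT (chord_weight Omega nu).
Proof. exact: measurable_slice (measurable_chord_weight oO). Qed.

Let mw : measurable_fun setT w.
Proof. by apply: measurable_funM. Qed.

Let mmid : measurable_fun setT (mid Omega nu).
Proof. exact: measurable_slice (measurable_mid oO). Qed.

Let weight_neq0 x : chord_weight Omega nu x != 0%R -> (fw x < +oo) /\ (bw x < +oo).
Proof. by rewrite /chord_weight; case: ifPn => [/andP[/andP[]]//|]; rewrite eqxx. Qed.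

Definition midpoint_measure : {measure set 'rV[R]_n.+1 -> \bar R} :=
  weighted_image (lebesgue_rV n.+1) mmid mw.

Lemma measurable_skeleton : measurable (skeleton Omega nu).
Proof.
by apply: measurableI => //; apply: closed_measurable_rV; exact: closed_closure.
Qed.

(** Restricting to the skeleton loses nothing: a point of nonzero weight lies on a bounded chord,
    whose midpoint is in the skeleton. *)
Lemma integral_midpoint_measure (F : 'rV[R]_n.+1 -> \bar R) :
  measurable_fun setT F -> (forall x, 0 <= F x) ->
  \int[midpoint_measure]_(x in skeleton Omega nu) F x =
  \int[lebesgue_rV n.+1]_(x in Omega) (F (mid Omega nu x) * (chord_weight Omega nu x)%:E).
Proof.
move=> mF F0; rewrite integral_mkcond (ge0_integral_weighted_image (lebesgue_rV n.+1) mmid mw w0); last 2 first.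
- by apply/(measurable_restrictT _ measurable_skeleton); exact: measurable_funTS.
- by apply: erestrict_ge0 => x _.
rewrite [RHS]integral_mkcond; apply: eq_integral => x _.
rewrite /w patchE indicE patchE; case: ifPn => [_|xO]; case: ifPn => [/set_mem Ox|nO].
- by rewrite mulr1.
- by rewrite mulr0 mule0.
- rewrite mulr1 mul0e.
  have [->|/weight_neq0[fo bo]] := eqVneq (chord_weight Omega nu x) 0%R; first by rewrite mule0.
  by exfalso; move/negP: xO; apply; apply/mem_set; exact: mid_skeleton.
- by rewrite mul0e.
Qed.

Lemma midpoint_measure_null : midpoint_measure (~` skeleton Omega nu) = 0.
Proof.
have mc : measurable (~` skeleton Omega nu) by apply: measurableC; exact: measurable_skeleton.
rewrite -[~` _]setIT -integral_indic//.
rewrite (ge0_integral_weighted_image (lebesgue_rV n.+1) mmid mw w0); last 2 first.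
- by apply/measurable_EFinP; exact: measurable_indic.
- by move=> x; rewrite lee_fin.
rewrite integral0_eq// => x _; rewrite /w (indicE _ Omega).
case: (boolP (x \in Omega)) => [/set_mem Ox|_]; last by rewrite mulr0 mule0.
have [->|/weight_neq0[fo bo]] := eqVneq (chord_weight Omega nu x) 0%R; first by rewrite mul0r mule0.
by rewrite indicE memNset ?mul0e// => /(_ (mid_skeleton oO nu0 Snu Ox fo bo)).
Qed.

(** If the midpoint lies in [K], the half length is at least the truncated distance of [K] to the
    complement divided by |nu|, so the weight is at most 1/(2 eta). Moreover the weight lives at
    parameter distance less than 1 from the midpoint, so x stays in a fixed cube. *)
Lemma midpoint_measure_compact K : compact K -> K `<=` Omega -> midpoint_measure K < +oo.
Proof.
move=> cK KO; have [->|K0] := eqVneq K set0; first by rewrite measure0.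
have clK : closed K by apply: compact_closed; first exact: norm_hausdorff.
have mK : measurable K by exact: closed_measurable_rV.
have [c cK' hc] : exists2 c, c \in K & forall t, t \in K ->
    (cdist (~` Omega) c <= cdist (~` Omega) t)%R.
  apply: EVT_min_rV => //; first exact/set0P.
  by apply: continuous_subspaceT => x; exact: cdist_continuous.
set del := cdist (~` Omega) c in hc.
have del0 : (0 < del)%R.
  apply: cdist_gt0; first exact: open_closedC.
  by apply; apply: KO; exact/set_mem.
have [M [_ HM]] := compact_bounded cK.
have M1 : (M < `|M| + 1)%R by rewrite (le_lt_trans (ler_norm _))// ltrDl.
have n0 : (0 < `|nu|)%R by rewrite normr_gt0.
pose eta := Num.min (del / `|nu|)%R 1%R.
have eta0 : (0 < eta)%R by rewrite lt_min ltr01 andbT divr_gt0.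
pose r := (`|M| + 1 + `|nu|)%R.
rewrite -[K]setIT -integral_indic//.
rewrite (ge0_integral_weighted_image (lebesgue_rV n.+1) mmid mw w0); last 2 first.
- by apply/measurable_EFinP; exact: measurable_indic.
- by move=> x; rewrite lee_fin.
apply: (@le_lt_trans _ _ (\int[lebesgue_rV n.+1]_x ((2 * eta)^-1%:E * (\1_(cube n.+1 r) x)%:E))).
  apply: ge0_le_integral => //.
  - by move=> x _; rewrite mule_ge0// lee_fin.
  - apply: emeasurable_funM; last exact/measurable_EFinP.
    by apply/measurable_EFinP; apply: measurableT_comp mmid; exact: measurable_indic.
  - apply: emeasurable_funM; first exact: measurable_cst.
    by apply/measurable_EFinP; apply: measurable_indic; exact: measurable_cube.
  move=> x _; rewrite -!EFinM lee_fin.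
  have rhs0 : (0 <= (2 * eta)^-1 * \1_(cube n.+1 r) x)%R.
    by rewrite mulr_ge0// invr_ge0 mulr_ge0// ltW.
  rewrite indicE; case: (boolP (mid Omega nu x \in K)) => [/set_mem Km|_]; last by rewrite mul0r.
  rewrite mul1r /w indicE; case: (boolP (x \in Omega)) => [/set_mem Ox|_]; last by rewrite mulr0.
  rewrite mulr1; rewrite /chord_weight.
  case: ifPn => // /andP[/andP[fo bo] hx].
  have hl : (del / `|nu| <= halflen Omega nu x)%R.
    rewrite ler_pdivrMr//.
    have fT : fw x = (fine (fw x))%:E by rewrite fineK// ge0_fin_numE ?exit_time_ge0.
    have out := exit_out oO fT.
    apply: le_trans (hc _ (mem_set Km)) _.
    apply: le_trans (cdist_le _ out) _.
    rewrite /mid opprD addrACA subrr add0r -scalerBl normrZ ler_wpM2r//.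
    rewrite (_ : _ - _ = - halflen Omega nu x)%R; last by rewrite /halflen; field.
    by rewrite normrN ger0_norm// halflen_ge0.
  have et : (eta <= Num.min (halflen Omega nu x) 1)%R.
    by rewrite le_min; apply/andP; split; rewrite ge_min ?hl ?lexx ?orbT.
  have xr : cube n.+1 r x.
    move=> i; apply: le_trans (coord_le_norm _ _) _.
    have -> : x = (mid Omega nu x - ((fine (fw x) - fine (bw x)) / 2) *: nu)%R by rewrite /mid addrK.
    apply: le_trans (ler_normB _ _) _; apply: lerD; first exact: HM M1 _ Km.
    rewrite normrZ ler_piMl// normrM (ger0_norm (_ : 0 <= 2^-1)%R) ?invr_ge0//.
    by apply: ltW; apply: lt_le_trans hx _; rewrite ge_min lexx orbT.
  rewrite indicE mem_set// mulr1 lef_pV2 ?posrE ?mulr_gt0//; last exact: lt_le_trans et.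
  by rewrite ler_pM2l.
rewrite ge0_integralZl_EFin//; last 2 first.
- by apply/measurable_EFinP; apply: measurable_indic; exact: measurable_cube.
- by rewrite invr_ge0 mulr_ge0// ltW.
rewrite integral_indic//; last exact: measurable_cube.
by rewrite setIT lte_mul_pinfty ?lee_fin ?invr_ge0 ?mulr_ge0 ?(ltW eta0)// ltey_cube.
Qed.

Let chord_sum f x : R := \sum_(l \in chords Omega nu x) eval_infty f (midpoint nu x l).

Let line_ind f y : (forall x, 0 <= f x)%R -> C0 Omega f ->
  \int[leb]_s ((fun x => (f (mid Omega nu x) * w x)%:E) (y + s *: nu)%R) = (chord_sum f y)%:E.
Proof.
move=> f0 fC; rewrite /chord_sum -(integral_line_midpoints oO nu0)// [RHS]integral_mkcond.
apply: eq_integral => s _; rewrite patchE /w indicE.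
have -> : (s \in [set s | Omega (y + s *: nu)]%R) = (y + s *: nu \in Omega)%R.
  by apply/idP/idP => /set_mem h; exact/mem_set.
by case: ifPn => _; rewrite ?mulr1 ?mulr0.
Qed.

Let mline f : (forall x, 0 <= f x)%R -> C0 Omega f ->
  measurable_fun setT (fun x => (f (mid Omega nu x) * w x)%:E).
Proof.
move=> f0 [cf _]; apply/measurable_EFinP; apply: measurable_funM => //.
by apply: measurableT_comp mmid; exact: continuous_measurable_rV.
Qed.

Let lineF f : (forall x, 0 <= f x)%R -> forall x, 0 <= (f (mid Omega nu x) * w x)%:E.
Proof. by move=> f0 x; rewrite lee_fin mulr_ge0. Qed.

Lemma measurable_chord_sum f : (forall x, 0 <= f x)%R -> C0 Omega f ->
  measurable_fun setT (fun y : 'rV[R]_n => (chord_sum f (y *m perp_frame nu))%:E).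
Proof.
move=> f0 fC; have := @measurable_lines _ _ nu _ (mline f0 fC) (lineF f0).
apply: eq_measurable_fun => y _; exact: line_ind.
Qed.

Lemma integral_midpoints f : (forall x, 0 <= f x)%R -> C0 Omega f ->
  \int[midpoint_measure]_(x in skeleton Omega nu) (f x)%:E =
  \int[lebesgue_rV n]_y (chord_sum f (y *m perp_frame nu))%:E.
Proof.
move=> f0 fC; have [cf _] := fC.
rewrite integral_midpoint_measure; last 2 first.
- by apply/measurable_EFinP; exact: continuous_measurable_rV.
- by move=> x; rewrite lee_fin.
transitivity (\int[lebesgue_rV n.+1]_x (f (mid Omega nu x) * w x)%:E).
  rewrite integral_mkcond; apply: eq_integral => x _; rewrite patchE /w indicE.
  by case: ifPn => _; rewrite ?mulr0// mulr1 EFinM.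
rewrite (ge0_integral_lines Snu (mline f0 fC) (lineF f0)).
by apply: eq_integral => y _; exact: line_ind.
Qed.

Lemma integral_C0_lty f : (forall x, 0 <= f x)%R -> C0 Omega f ->
  \int[midpoint_measure]_(x in skeleton Omega nu) (f x)%:E < +oo.
Proof.
move=> f0 [cf [cs sO]].
have ms := measurable_skeleton.
have mf : measurable_fun setT f by exact: continuous_measurable_rV.
have [s0|s0] := eqVneq (supp f) set0.
  rewrite integral0_eq// => x _; rewrite out_supp ?s0//.
have [c _ hc] : exists2 c, c \in supp f & forall t, t \in supp f -> (f t <= f c)%R.
  apply: EVT_max_rV => //; first exact/set0P.
  by apply: continuous_subspaceT => x; exact: cf.
have mS : measurable (supp f) by apply: closed_measurable_rV; exact: closed_closure.
apply: (@le_lt_trans _ _ (\int[midpoint_measure]_(x in skeleton Omega nu) ((f c)%:E * (\1_(supp f) x)%:E))).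
  apply: ge0_le_integral => //.
  - by move=> x _; rewrite lee_fin.
  - by apply/measurable_EFinP; exact: measurable_funTS.
  - apply: measurable_funTS; apply: emeasurable_funM; first exact: measurable_cst.
    by apply/measurable_EFinP; exact: measurable_indic.
  move=> x _; rewrite -EFinM lee_fin indicE; case: (boolP (x \in supp f)) => [/hc|/negP nx].
    by rewrite mulr1.
  by rewrite mulr0 out_supp// => h; apply: nx; exact/mem_set.
rewrite ge0_integralZl_EFin//; last first.
  by apply/measurable_EFinP; apply: measurable_funTS; exact: measurable_indic.
rewrite integral_indic// lte_mul_pinfty ?lee_fin//.
apply: le_lt_trans (midpoint_measure_compact cs sO).
by apply: le_measure; rewrite ?inE//; exact: measurableI.
Qed.

End skeletal.

Section skeletal_measure.
Context {R : realType} {n : nat} (Omega : set 'rV[R]_n.+1).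
Hypothesis oO : open Omega.
Variable nu : 'rV[R]_n.+1.
Hypothesis Snu : usphere nu.
Implicit Types (x y z : 'rV[R]_n.+1) (f : 'rV[R]_n.+1 -> R).
Local Open Scope ereal_scope.

Let nu0 : nu != 0%R. Proof. exact: usphere_neq0. Qed.

Lemma C0_funrpos f : C0 Omega f -> C0 Omega (f^\+)%R.
Proof.
move=> [cf [cs sO]]; have sub : supp (f^\+)%R `<=` supp f.
  by apply: closure_subset => x /=; apply: contra_neq => fx; rewrite /funrpos fx maxxx.
split; last split.
- have c0 : continuous (fun _ : 'rV[R]_n.+1 => 0%R : R) by exact: cst_continuous.
  by move=> x; exact: (continuous_max (cf x) (c0 x)).
- by apply: subclosed_compact sub => //; exact: closed_closure.
- exact: subset_trans sO.
Qed.

Lemma C0_funrneg f : C0 Omega f -> C0 Omega (f^\-)%R.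
Proof.
move=> [cf [cs sO]]; rewrite -funrposN; apply: C0_funrpos; split; last first.
  by rewrite /compactly_supported_in (_ : supp _ = supp f)//; congr closure;
    apply/seteqP; split => x /=; rewrite oppr_eq0.
by move=> x; apply: continuousN; exact: cf.
Qed.

Let chord_sum f x : R := \sum_(l \in chords Omega nu x) eval_infty f (midpoint nu x l).

Let chord_sumE f x (F : set (set 'rV[R]_n.+1)) : relevant_chords Omega nu f x `<=` F ->
  F `<=` chords Omega nu x ->
  chord_sum f x = (\sum_(l \in F) eval_infty f (midpoint nu x l))%R.
Proof.
move=> rF Fc; apply/esym; apply: fsbig_widen => // l [cl /= nF].
by apply: contrapT => /eqP gl; apply: nF; apply: rF.
Qed.

(** The three sums have different supports; they are first rewritten over the common finite set
    [F]. *)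
Lemma chord_sum_posneg f x : C0 Omega f ->
  chord_sum f x = (chord_sum (f^\+)%R x - chord_sum (f^\-)%R x)%R.
Proof.
move=> fC; have Cp := C0_funrpos fC; have Cn := C0_funrneg fC.
pose F := relevant_chords Omega nu f x `|` (relevant_chords Omega nu (f^\+)%R x `|`
  relevant_chords Omega nu (f^\-)%R x).
have finF : finite_set F.
  by rewrite !finite_setU; split; [|split]; exact: finite_relevant_chords.
have Fc : F `<=` chords Omega nu x by move=> l [[]//|[[]//|[]//]].
have sf : relevant_chords Omega nu f x `<=` F by move=> l; left.
have sp : relevant_chords Omega nu (f^\+)%R x `<=` F by move=> l; right; left.
have sn : relevant_chords Omega nu (f^\-)%R x `<=` F by move=> l; right; right.
rewrite (chord_sumE sf Fc) (chord_sumE sp Fc) (chord_sumE sn Fc).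
apply/eqP; rewrite eq_sym subr_eq -fsbig_split//; apply/eqP; apply: eq_fsbigr => l _.
rewrite /eval_infty; case: midpoint => [m|]/=; last by rewrite addr0.
by have /= <- := congr1 (fun h => h m) (funrposBneg f); rewrite subrK.
Qed.

(** The defining formula concerns functions of any sign, while Tonelli gives it for nonnegative
    ones. The positive and negative parts have finite integrals, the measure of compact sets being
    finite, and can be subtracted. *)
Theorem midpoint_measure_skeletal : is_skeletal_measure Omega nu (midpoint_measure oO nu).
Proof.
have ms := measurable_skeleton oO nu.
split.
- exact: midpoint_measure_null.
- by move=> K cK Ks; apply: midpoint_measure_compact => // x /Ks[].
move=> f fC; have Cp := C0_funrpos fC; have Cn := C0_funrneg fC.
have p0 x : (0 <= (f^\+)%R x)%R by exact: funrpos_ge0.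
have q0 x : (0 <= (f^\-)%R x)%R by exact: funrneg_ge0.
have int h : C0 Omega h -> (forall x, 0 <= h x)%R -> (lebesgue_rV n).-integrable setT
    (EFin \o (fun y : 'rV[R]_n => chord_sum h (y *m perp_frame nu))).
  move=> hC h0; apply/integrableP; split; first exact: measurable_chord_sum.
  apply: le_lt_trans (integral_C0_lty oO Snu h0 hC); rewrite integral_midpoints//.
  rewrite le_eqVlt; apply/orP; left; apply/eqP; apply: eq_integral => y _ /=.
  rewrite ger0_norm//; apply: fsumr_ge0 => l _.
  by rewrite /eval_infty; case: midpoint => //= m; exact: h0.
transitivity (\int[midpoint_measure oO nu]_(x in skeleton Omega nu) (f^\+ x)%R%:E -
    \int[midpoint_measure oO nu]_(x in skeleton Omega nu) (f^\- x)%R%:E).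
  rewrite integralE; congr (_ - _); apply: eq_integral => x _.
    by rewrite (congr1 (fun h => h x) (funerpos f)).
  by rewrite (congr1 (fun h => h x) (funerneg f)).
rewrite (integral_midpoints oO Snu p0 Cp) (integral_midpoints oO Snu q0 Cn).
rewrite -integralB_EFin//; last 2 first.
- exact: int.
- exact: int.
by apply: eq_integral => y _; rewrite -EFinB -chord_sum_posneg.
Qed.

(** Existence rules out the default value of [skeletal_measure]. The measure chosen there agrees
    with the midpoint measure on functions in C_0(Omega), hence on all integrands over the
    skeleton. *)
Theorem integral_skeletal_measure (F : 'rV[R]_n.+1 -> \bar R) :
  measurable_fun setT F -> (forall x, 0 <= F x) ->
  \int[skeletal_measure Omega nu]_(x in skeleton Omega nu) F x =
  \int[lebesgue_rV n.+1]_(x in Omega) (F (mid Omega nu x) * (chord_weight Omega nu x)%:E).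
Proof.
move=> mF F0; rewrite -(integral_midpoint_measure oO Snu)//.
have [_ _ H2] := midpoint_measure_skeletal.
rewrite /skeletal_measure; case: pselect => [ex|nex]; last first.
  by exfalso; apply: nex; exists (midpoint_measure oO nu); exact: midpoint_measure_skeletal.
have [_ _ H1] := projT2 (cid ex).
apply: (@C0_integral_agree _ _ Omega) => //.
- exact: measurable_skeleton.
- by move=> x [].
- by move=> f fC f0; rewrite H1// H2.
move=> K cK KO; apply: le_lt_trans (midpoint_measure_compact oO Snu cK KO).
have mK : measurable K.
  by apply: closed_measurable_rV; apply: compact_closed => //; exact: norm_hausdorff.
by apply: le_measure; rewrite ?inE//; apply: measurableI => //; exact: measurable_skeleton.
Qed.

End skeletal_measure.

(** * Integration over the domain and the sphere *)

Section mean_distance.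
Context {R : realType}.
Local Open Scope ereal_scope.

Lemma epow0_gt0 (r : R) : (0 < r)%R -> epow 0 r = 0.
Proof. by move=> r0; rewrite /epow ltW// poweR0r ?gt_eqF. Qed.

Lemma epow0_lt0 (r : R) : (r < 0)%R -> epow 0 r = +oo.
Proof.
by move=> r0; rewrite /epow leNgt r0 [X in X^-1]poweR0r ?inve0// oppr_eq0 lt_eqF.
Qed.

(** The conventions of [epow] at 0 and +oo make the two powers inverse on all of [0, +oo], for q of
    either sign. Thus a degenerate mean distance still gives back the integral that defines it. *)
Lemma epowK (x : \bar R) (q : R) : (q != 0)%R -> 0 <= x -> epow (epow x (- q^-1)) (- q) = x.
Proof.
move=> q0; case: x => [x| |]//.
  rewrite lee_fin le_eqVlt => /predU1P[<-|x0].
    have [q1|q1] := ltP q 0%R.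
      by rewrite !epow0_gt0// oppr_gt0 ?invr_lt0.
    have {}q1 : (0 < q)%R by rewrite lt_neqAle eq_sym q0.
    by rewrite epow0_lt0 ?oppr_lt0 ?invr_gt0// epowy_lt0// oppr_lt0.
  rewrite epow_EFin// epow_EFin ?powR_gt0// -powRrM mulrNN mulVf// powRr1//.
  exact: ltW.
move=> _; have [q1|q1] := ltP q 0%R.
  by rewrite !epowy_gt0// oppr_gt0 ?invr_lt0.
have {}q1 : (0 < q)%R by rewrite lt_neqAle eq_sym q0.
by rewrite epowy_lt0 ?oppr_lt0 ?invr_gt0// epow0_lt0// oppr_lt0.
Qed.

Lemma mean_dist_powNE N (Omega : set 'rV[R]_N) (q : R) (x : 'rV[R]_N) : 0 <= Xi N q ->
  mean_dist_powN Omega q x = mean_dist_integral Omega q x.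
Proof.
move=> X0; rewrite /mean_dist_powN; case: ifPn => // q0; rewrite /mean_dist epowK//.
by rewrite mule_ge0//; apply: integral_ge0 => nu _; exact: epow_ge0.
Qed.

End mean_distance.

Local Open Scope ereal_scope.
Lemma integral_combination (R : realType) d (T : measurableType d) (m : {measure set T -> \bar R}) (D : set T)
    (f g : T -> \bar R) (a c : R) (h : T -> \bar R) : measurable D ->
  measurable_fun D f -> (forall x, 0 <= f x) -> measurable_fun D g -> (forall x, 0 <= g x) ->
  measurable_fun D h -> (forall x, 0 <= h x) -> (0 <= a)%R -> (0 <= c)%R ->
  \int[m]_(x in D) (a%:E * f x + (c%:E * g x + h x)) =
  a%:E * \int[m]_(x in D) f x + (c%:E * \int[m]_(x in D) g x + \int[m]_(x in D) h x).
Proof.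
move=> mD mf f0 mg g0 mh h0 a0 c0.
have maf : measurable_fun D (fun x => a%:E * f x).
  by apply: emeasurable_funM => //; exact: measurable_cst.
have mcg : measurable_fun D (fun x => c%:E * g x).
  by apply: emeasurable_funM => //; exact: measurable_cst.
have mcgh := emeasurable_funD mcg mh.
have af0 x : D x -> 0 <= a%:E * f x by move=> _; rewrite mule_ge0// lee_fin.
have cg0 x : D x -> 0 <= c%:E * g x by move=> _; rewrite mule_ge0// lee_fin.
have cgh0 x : D x -> 0 <= c%:E * g x + h x by move=> Dx; rewrite adde_ge0// cg0.
rewrite (@ge0_integralD _ _ _ m _ mD _ _ af0 maf cgh0 mcgh).
rewrite (@ge0_integralD _ _ _ m _ mD _ _ cg0 mcg (fun x _ => h0 x) mh).
rewrite (ge0_integralZl_EFin m mD (fun x _ => f0 x) mf a0).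
by rewrite (ge0_integralZl_EFin m mD (fun x _ => g0 x) mg c0).
Qed.

Local Close Scope ereal_scope.

(** * Integration over the sphere and the domain *)

Section omega.
Context {R : realType} {n : nat} (Omega : set 'rV[R]_n.+1).
Hypothesis oO : open Omega.
Variable u : 'rV[R]_n.+1 -> R.
Hypothesis Cu : class_C 1 u.
Hypothesis su : compactly_supported_in Omega u.
Variables p lambda : R.
Hypothesis p1 : (1 < p)%R.
Local Open Scope ereal_scope.
Implicit Types (nu x y : 'rV[R]_n.+1).
Notation FA := (gradient_term Omega u p lambda).
Notation FB := (hardy_term Omega u p lambda).
Notation FC := (Cp_term Omega u p lambda).
Notation FG := (midpoint_term Omega u p lambda).
Notation L := (lebesgue_rV n.+1).
Notation S := (sphere_measure R n.+1).

Let b : R := ((p + lambda - 1) / p)%R.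
Let k : R := spow p b.
Let mO : measurable Omega. Proof. exact: open_measurable_rV. Qed.

Let cn : R := (2 * Num.max (- k) 0)%R.
Let cp : R := (2 * Num.max k 0)%R.
Let cn0 : (0 <= cn)%R. Proof. by rewrite mulr_ge0// le_max lexx orbT. Qed.
Let cp0 : (0 <= cp)%R. Proof. by rewrite mulr_ge0// le_max lexx orbT. Qed.
Let bp0 : (0 <= `|b| `^ p)%R. Proof. exact: powR_ge0. Qed.

Let mA : measurable_fun setT (fun z : 'rV[R]_n.+1 * 'rV[R]_n.+1 => FA z.1 z.2).
Proof. exact: measurable_gradient_term. Qed.
Let mB : measurable_fun setT (fun z : 'rV[R]_n.+1 * 'rV[R]_n.+1 => FB z.1 z.2).
Proof. exact: measurable_hardy_term. Qed.
Let mC : measurable_fun setT (fun z : 'rV[R]_n.+1 * 'rV[R]_n.+1 => FC z.1 z.2).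
Proof. exact: measurable_Cp_term. Qed.
Let mG : measurable_fun setT (fun z : 'rV[R]_n.+1 * 'rV[R]_n.+1 => FG z.1 z.2).
Proof. exact: measurable_midpoint_term. Qed.
Let A0 nu x : 0 <= FA nu x. Proof. exact: gradient_term_ge0. Qed.
Let B0 nu x : 0 <= FB nu x. Proof. exact: hardy_term_ge0. Qed.
Let C0 nu x : 0 <= FC nu x. Proof. exact: Cp_term_ge0. Qed.
Let G0 nu x : 0 <= FG nu x. Proof. exact: midpoint_term_ge0. Qed.

Lemma omega_identity nu : usphere nu ->
  \int[L]_(x in Omega) FA nu x + cn%:E * \int[L]_(x in Omega) FG nu x =
  (`|b| `^ p)%:E * \int[L]_(x in Omega) FB nu x +
    (cp%:E * \int[L]_(x in Omega) FG nu x + \int[L]_(x in Omega) FC nu x).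
Proof.
move=> Snu.
have lA := measurable_slice nu mA; have lB := measurable_slice nu mB.
have lC := measurable_slice nu mC; have lG := measurable_slice nu mG.
have cG c : measurable_fun setT (fun x => c%:E * FG nu x).
  by apply: emeasurable_funM => //; exact: measurable_cst.
have cB c : measurable_fun setT (fun x => c%:E * FB nu x).
  by apply: emeasurable_funM => //; exact: measurable_cst.
have := @integral_combination R _ _ L Omega (FB nu) (FG nu) (`|b| `^ p) cp (FC nu) mO
  (measurable_funTS lB) (B0 nu) (measurable_funTS lG) (G0 nu) (measurable_funTS lC) (C0 nu) bp0 cp0.
move=> <-.
(* The zero function with coefficient 0 brings the two-term side into the form of the three-term
   lemma. *)
have := @integral_combination R _ _ L Omega (cst 0) (FG nu) 0 cn (FA nu) mO
  (measurable_cst _) (fun=> lexx _) (measurable_funTS lG) (G0 nu) (measurable_funTS lA) (A0 nu) (lexx _) cn0.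
rewrite mul0e add0e addeC => <-.
apply: (@ge0_integral_chords R n Omega nu) => //.
- by apply: emeasurable_funD; [exact: emeasurable_funM|exact: emeasurable_funD].
- by move=> x; rewrite mul0e add0e adde_ge0// mule_ge0// lee_fin.
- by apply: emeasurable_funD => //; exact: emeasurable_funD.
- by move=> x; rewrite !adde_ge0// mule_ge0// lee_fin.
move=> y Oy; have := @chord_identity R n.+1 Omega oO u Cu su p lambda p1 nu y (usphere_neq0 Snu) Oy.
move=> <-; apply: eq_integral => s _.
by rewrite mul0e add0e addeC.
Qed.

Lemma rho_mid nu x : Omega x -> exit_time Omega nu x < +oo -> exit_time Omega (- nu) x < +oo ->
  rho Omega nu (mid Omega nu x) = (halflen Omega nu x)%:E /\ (0 < halflen Omega nu x)%R.
Proof.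
move=> Ox fo bo.
have fT : exit_time Omega nu x = (fine (exit_time Omega nu x))%:E by rewrite fineK// ge0_fin_numE ?exit_time_ge0.
have bT : exit_time Omega (- nu) x = (fine (exit_time Omega (- nu) x))%:E by rewrite fineK// ge0_fin_numE ?exit_time_ge0.
have f0 : (0 < fine (exit_time Omega nu x))%R by rewrite -lte_fin -fT exit_gt0.
have b0 : (0 < fine (exit_time Omega (- nu) x))%R by rewrite -lte_fin -bT exit_gt0.
rewrite /halflen; split; last by rewrite divr_gt0// addr_gt0.
have c : chord Omega nu x ((fine (exit_time Omega nu x) - fine (exit_time Omega (- nu) x)) / 2)%R.
  rewrite /chord/= fT bT -EFinN !lte_fin /=; move: f0 b0.
  by set T := fine _; set B := fine _ => ? ?; apply/andP; split; lra.
rewrite rho_exit /mid; have [-> ->] := chord_exit oO c; rewrite fT bT -EFinB -EFinD /=.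
rewrite (_ : _ - _ = (fine (exit_time Omega nu x) + fine (exit_time Omega (- nu) x)) / 2)%R; last by field.
rewrite (_ : _ + _ / 2 = (fine (exit_time Omega nu x) + fine (exit_time Omega (- nu) x)) / 2)%R; last by field.
by rewrite minxx.
Qed.

Lemma integral_skeletal_midpoint_term nu : usphere nu ->
  \int[skeletal_measure Omega nu]_(m in skeleton Omega nu)
     ((`|u m| `^ p)%:E * epow (rho Omega nu m) (1 - p - lambda)) =
  \int[L]_(x in Omega) FG nu x.
Proof.
move=> Snu; rewrite (integral_skeletal_measure oO Snu); last 2 first.
- apply: emeasurable_funM.
    apply/measurable_EFinP; apply: (measurableT_comp (measurable_powR p)).
    apply: measurableT_comp; first exact: normr_measurable.
    by apply: continuous_measurable_rV; have [] := Cu.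
  apply: measurableT_comp (measurable_epow _) _.
  exact: (measurable_slice nu (measurable_rho oO)).
- by move=> x; rewrite mule_ge0 ?epow_ge0// lee_fin powR_ge0.
apply: eq_integral => x /set_mem Ox; rewrite /midpoint_term.
have [->|] := eqVneq (chord_weight Omega nu x) 0%R; first by rewrite mule0 mulr0.
rewrite {1}/chord_weight; case: ifPn; last by rewrite eqxx.
move=> /andP[/andP[fo bo] _] _; have [-> h0] := rho_mid Ox fo bo.
by rewrite epow_EFin// -!EFinM.
Qed.

Let mS : measurable (@usphere R n.+1).
Proof.
rewrite (_ : usphere = [set: 'rV[R]_n.+1] `&` enorm @^-1` [set 1%R]); last by rewrite setTI.
by apply: measurable_enorm => //; exact: measurable_set1.
Qed.

(** Extension by 0 off the product of the sphere and [Omega], so that Tonelli applies on the whole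
    product space. *)
Let patch2 (F : 'rV[R]_n.+1 -> 'rV[R]_n.+1 -> \bar R) (z : 'rV[R]_n.+1 * 'rV[R]_n.+1) :=
  F z.1 z.2 * (\1_(@usphere R n.+1) z.1 * \1_Omega z.2)%:E.

Let mpatch2 F : measurable_fun setT (fun z : 'rV[R]_n.+1 * 'rV[R]_n.+1 => F z.1 z.2) ->
  measurable_fun setT (patch2 F).
Proof.
move=> mF; apply: emeasurable_funM => //; apply/measurable_EFinP; apply: measurable_funM.
  by apply: measurableT_comp; [exact: measurable_indic|exact: measurable_fst].
by apply: measurableT_comp; [exact: measurable_indic|exact: measurable_snd].
Qed.

Let patch2_ge0 F : (forall nu x, 0 <= F nu x) -> forall z, 0 <= patch2 F z.
Proof. by move=> F0 z; rewrite mule_ge0// lee_fin mulr_ge0. Qed.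

Let patch2_x F nu : usphere nu ->
  \int[L]_(x in Omega) F nu x = \int[L]_x patch2 F (nu, x).
Proof.
move=> Snu; rewrite integral_mkcond; apply: eq_integral => x _.
rewrite /patch2/= patchE !indicE (mem_set Snu) mul1r.
by case: ifPn => _; rewrite ?mule1 ?mule0.
Qed.

Let patch2_nu F x : Omega x ->
  \int[S]_(nu in usphere) F nu x = \int[S]_nu patch2 F (nu, x).
Proof.
move=> Ox; rewrite integral_mkcond; apply: eq_integral => nu _.
rewrite /patch2/= patchE !indicE (mem_set Ox) mulr1.
by case: ifPn => _; rewrite ?mule1 ?mule0.
Qed.

Lemma sphere_omega_tonelli F : measurable_fun setT (fun z : 'rV[R]_n.+1 * 'rV[R]_n.+1 => F z.1 z.2) ->
  (forall nu x, 0 <= F nu x) ->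
  \int[S]_(nu in usphere) \int[L]_(x in Omega) F nu x =
  \int[L]_(x in Omega) \int[S]_(nu in usphere) F nu x.
Proof.
move=> mF F0.
transitivity (\int[S]_nu \int[L]_x patch2 F (nu, x)).
  rewrite integral_mkcond; apply: eq_integral => nu _; rewrite patchE.
  case: ifPn => [/set_mem /patch2_x->//|/negP nS].
  rewrite integral0_eq// => x _; rewrite /patch2/= indicE memNset ?mul0r ?mule0// => Snu.
  by apply: nS; exact/mem_set.
rewrite (@fubini_tonelli _ _ _ _ _ S L (patch2 F) (mpatch2 mF) (patch2_ge0 F0)).
rewrite [RHS]integral_mkcond; apply: eq_integral => x _; rewrite patchE.
case: ifPn => [/set_mem /patch2_nu->//|/negP nO].
rewrite integral0_eq// => nu _; by rewrite /patch2/= !indicE (negbTE (introN idP nO)) mulr0 mule0.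
Qed.

Lemma measurable_omega_integral F :
  measurable_fun setT (fun z : 'rV[R]_n.+1 * 'rV[R]_n.+1 => F z.1 z.2) ->
  (forall nu x, 0 <= F nu x) ->
  measurable_fun usphere (fun nu => \int[L]_(x in Omega) F nu x).
Proof.
move=> mF F0.
have := @measurable_fun_fubini_tonelli_F _ _ _ _ _ L (patch2 F) (mpatch2 mF) (patch2_ge0 F0).
move=> /(measurable_funTS (D := usphere)).
by apply: eq_measurable_fun => nu /set_mem Snu; rewrite /fubini_F -patch2_x.
Qed.

Lemma measurable_sphere_integral F :
  measurable_fun setT (fun z : 'rV[R]_n.+1 * 'rV[R]_n.+1 => F z.1 z.2) ->
  (forall nu x, 0 <= F nu x) ->
  measurable_fun Omega (fun x => \int[S]_(nu in usphere) F nu x).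
Proof.
move=> mF F0.
have := @measurable_fun_fubini_tonelli_G _ _ _ _ _ S (patch2 F) (mpatch2 mF) (patch2_ge0 F0).
move=> /(measurable_funTS (D := Omega)).
by apply: eq_measurable_fun => x /set_mem Ox; rewrite /fubini_G -patch2_nu.
Qed.

Lemma sphere_identity :
  \int[L]_(x in Omega) \int[S]_(nu in usphere) FA nu x +
    cn%:E * \int[S]_(nu in usphere) \int[L]_(x in Omega) FG nu x =
  (`|b| `^ p)%:E * \int[L]_(x in Omega) \int[S]_(nu in usphere) FB nu x +
    (cp%:E * \int[S]_(nu in usphere) \int[L]_(x in Omega) FG nu x +
     \int[L]_(x in Omega) \int[S]_(nu in usphere) FC nu x).
Proof.
have iA := measurable_omega_integral mA A0; have iB := measurable_omega_integral mB B0.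
have iC := measurable_omega_integral mC C0; have iG := measurable_omega_integral mG G0.
have i0 F : (forall nu x, 0 <= F nu x) -> forall nu, 0 <= \int[L]_(x in Omega) F nu x.
  by move=> F0 nu; exact: integral_ge0.
have tA := sphere_omega_tonelli mA A0; have tB := sphere_omega_tonelli mB B0.
have tC := sphere_omega_tonelli mC C0.
rewrite -[X in X + _ = _]tA -[X in _ = _ * X + _]tB -[X in _ = _ + (_ + X)]tC.
have := @integral_combination R _ _ S usphere _ _ (`|b| `^ p) cp _ mS iB (i0 _ B0) iG (i0 _ G0) iC (i0 _ C0) bp0 cp0.
move=> <-.
have := @integral_combination R _ _ S usphere (cst 0) _ 0 cn _ mS
  (measurable_cst _) (fun=> lexx _) iG (i0 _ G0) iA (i0 _ A0) (lexx _) cn0.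
rewrite mul0e add0e addeC => <-.
apply: eq_integral => nu /set_mem Snu; rewrite mul0e add0e addeC; exact: omega_identity.
Qed.

Lemma skeletal_mean_midpoint_term :
  skeletal_mean Omega (fun nu m => (`|u m| `^ p)%:E * epow (rho Omega nu m) (1 - p - lambda)) =
  \int[S]_(nu in usphere) \int[L]_(x in Omega) FG nu x.
Proof. by apply: eq_integral => nu /set_mem; exact: integral_skeletal_midpoint_term. Qed.

End omega.

(** * Gamma functions and moments of the sphere *)

Section gamma.
Context {R : realType}.
Local Open Scope ereal_scope.
Notation leb := (@lebesgue_measure R).
Implicit Types a c r s t : R.

(** For a > 1 the primitive |s|^a is differentiable on the whole line, which includes the end point
    c = 0; a = 1 is a constant integrand. *)
Lemma integral_powR a c r : (1 <= a)%R -> (0 <= c)%R -> (c <= r)%R ->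
  \int[leb]_(s in `[c, r]) (a * s `^ (a - 1))%:E = (r `^ a - c `^ a)%:E.
Proof.
move=> a1 c0; rewrite le_eqVlt => /predU1P[<-|cr].
  by rewrite set_itv1 integral_set1 subrr.
move: a1; rewrite le_eqVlt => /predU1P[<-|a1].
  under eq_integral do rewrite subrr powRr0 mulr1.
  rewrite integral_cst//= lebesgue_measure_itv/= lte_fin cr -EFinB -EFinM mul1r.
  by rewrite !powRr1// ltW// (le_lt_trans c0).
transitivity (\int[leb]_(s in `[c, r]) (a * spow a s)%:E).
  apply: eq_integral => s /set_mem /=; rewrite in_itv/= => /andP[cs _].
  have [s0|s0] := eqVneq s 0%R; last by rewrite spow_gt0// lt_neqAle eq_sym s0 (le_trans c0).
  by rewrite s0 spow0 powR0// subr_eq0 gt_eqF.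
have dF (s : R) : is_derive s 1%R (fun t : R => `|t| `^ a)%R (a * spow a s)%R.
  exact: is_derive_norm_powR.
have cF : continuous (fun t : R => `|t| `^ a)%R.
  by apply: continuous_norm_powR; exact: lt_trans a1.
rewrite (@continuous_FTC2 _ _ (fun t : R => `|t| `^ a)%R)//.
- by rewrite -EFinB !ger0_norm// (le_trans c0)// ltW.
- apply: continuous_subspaceT => s; apply: cvgMl_tmp; exact: continuous_spow.
- split.
  + by move=> s _; have [] := dF s.
  + by apply: cvg_at_right_filter; exact: cF.
  + by apply: cvg_at_left_filter; exact: cF.
- by move=> s _; rewrite derive1E; have [_ ->] := dF s.
Qed.

Lemma measurable_expRN : measurable_fun [set: R] (fun t : R => expR (- t)).
Proof.
by apply: continuous_measurable_fun => t; apply: continuous_comp; [exact: opp_continuous|exact: continuous_expR].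
Qed.

Lemma integral_expRN s : \int[leb]_(t in `[s, +oo[) (expR (- t))%:E = (expR (- s))%:E.
Proof.
have dF (t : R) : is_derive t 1%R (fun t : R => - expR (- t))%R (expR (- t)).
  apply: is_derive_eq; rewrite /GRing.scale/=; ring.
rewrite (@ge0_continuous_FTC2y _ _ (fun t : R => - expR (- t))%R s 0%R).
- by rewrite sub0e EFinN oppeK.
- by move=> t _; exact: expR_ge0.
- apply: continuous_subspaceT => t.
  by apply: continuous_comp; [exact: opp_continuous|exact: continuous_expR].
- by rewrite -oppr0; apply: cvgN; exact: cvgr_expR.
- by move=> t _; have [] := dF t.
- apply: cvg_at_right_filter; apply: cvgN.
  by apply: continuous_comp; [exact: opp_continuous|exact: continuous_expR].
- by move=> t _; rewrite derive1E; have [_ ->] := dF t.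
Qed.

Let integrand a t : \bar R := (t `^ (a - 1) * expR (- t))%:E.

Let integrand_ge0 a t : 0 <= integrand a t.
Proof. by rewrite lee_fin mulr_ge0 ?powR_ge0 ?expR_ge0. Qed.

Let measurable_integrand a : measurable_fun [set: R] (integrand a).
Proof.
apply/measurable_EFinP; apply: measurable_funM; last exact: measurable_expRN.
exact: measurable_powR.
Qed.

Lemma Euler_Gamma_gt0 a : (1 <= a)%R -> 0 < Euler_Gamma a.
Proof.
move=> a1.
apply: (@lt_le_trans _ _ (\int[leb]_(t in `[1%R, 2%R]) (expR (- 2))%:E)).
  rewrite integral_cst//= lebesgue_measure_itv/= lte_fin ltr1n -EFinB -EFinM lte_fin.
  by rewrite mulr_gt0 ?expR_gt0// subr_gt0 ltr1n.
apply: (@le_trans _ _ (\int[leb]_(t in `[1%R, 2%R]) integrand a t)).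
  apply: ge0_le_integral => //.
  - by apply: measurable_funTS; exact: measurable_integrand.
  move=> t /=; rewrite in_itv/= => /andP[t1 t2]; rewrite lee_fin -[leLHS]mul1r.
  apply: ler_pM => //; rewrite ?expR_ge0//.
    by rewrite -[leLHS](powRr0 t) ler_powR// subr_ge0.
  by rewrite ler_expR lerN2.
apply: ge0_subset_integral => //.
- by apply: measurable_funTS; exact: measurable_integrand.
- by move=> t /=; rewrite !in_itv/= andbT => /andP[t1 _]; exact: lt_le_trans t1.
Qed.

(** The bound t^(a-1) <= c exp(t/2) leaves a multiple of the exponential density of rate 1/2. In
    [c], the summand 1 covers t <= 1, and the other one comes from the term of degree k + 1 in the
    series of exp(t/2). *)
Lemma Euler_Gamma_lty a : (1 <= a)%R -> Euler_Gamma a < +oo.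
Proof.
move=> a1; pose k := Num.bound (a - 1)%R.
have ak : (a - 1 < k%:R)%R by apply: Num.Theory.archi_boundP; rewrite subr_ge0.
pose c : R := (1 + 2 ^+ k.+1 * (k.+1)`!%:R)%R.
have c0 : (0 <= c)%R by rewrite addr_ge0// mulr_ge0// exprn_ge0.
have bound t : (0 < t)%R -> (t `^ (a - 1) <= c * expR (t / 2))%R.
  move=> t0; have e1 : (1 <= expR (t / 2))%R by rewrite -expR0 ler_expR divr_ge0// ltW.
  have [t1|t1] := leP t 1%R.
    apply: (@le_trans _ _ 1%R).
      have h1 : (1 `^ (a - 1) = 1 :> R)%R by rewrite powR1.
      rewrite -[leRHS]h1 ge0_ler_powR// ?nnegrE ?subr_ge0//.
      exact: ltW.
    by apply: le_trans e1 _; rewrite ler_peMl ?expR_ge0// lerDl mulr_ge0// exprn_ge0.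
  apply: (@le_trans _ _ (t ^+ k.+1)%R).
    rewrite -powR_mulrn ?(ltW t0)// ler_powR ?ltW// (lt_trans ak)// ltr_nat//.
  have := @expR_ge1Dxn R (t / 2)%R k (divr_ge0 (ltW t0) (ler0n _ 2)).
  have f0 : (0 < (k.+1)`!%:R :> R)%R by rewrite ltr0n fact_gt0.
  rewrite exprMn exprVn => h.
  have h' : (t ^+ k.+1 <= 2 ^+ k.+1 * (k.+1)`!%:R * expR (t / 2))%R.
    have p2 : (0 < 2 ^+ k.+1 :> R)%R by rewrite exprn_gt0.
    have h2 : (t ^+ k.+1 / 2 ^+ k.+1 / (k.+1)`!%:R <= expR (t / 2))%R.
      by apply: le_trans h; rewrite lerDr.
    rewrite ler_pdivrMr// ler_pdivrMr// in h2.
    by rewrite [leRHS]mulrC mulrA mulrAC.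
  apply: le_trans h' _; rewrite ler_wpM2r ?expR_ge0// lerDr//.
have h2 : (0 < 2^-1 :> R)%R by rewrite invr_gt0.
apply: (@le_lt_trans _ _ (\int[leb]_(t in `]0%R, +oo[) ((c * 2)%:E * (exponential_pdf 2^-1 t)%:E))).
  apply: ge0_le_integral => //.
  - by move=> t _; exact: integrand_ge0.
  - by apply: measurable_funTS; exact: measurable_integrand.
  - apply: emeasurable_funM; first exact: measurable_cst.
    by apply/measurable_EFinP; apply: measurable_funTS; exact: measurable_exponential_pdf.
  move=> t /=; rewrite in_itv/= andbT => t0; rewrite -EFinM lee_fin.
  apply: le_trans (ler_wpM2r (expR_ge0 _) (bound _ t0)) _.
  rewrite exponential_pdfE ?(ltW t0)// -mulrA -expRD -mulrA ler_wpM2l// mulrA divff// mul1r.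
  by rewrite ler_expR le_eqVlt; apply/orP; left; apply/eqP; field.
rewrite ge0_integralZl_EFin//; last 3 first.
- by move=> t _; rewrite lee_fin exponential_pdf_ge0.
- by apply/measurable_EFinP; apply: measurable_funTS; exact: measurable_exponential_pdf.
- by rewrite mulr_ge0.
rewrite lte_mul_pinfty ?lee_fin ?mulr_ge0//.
apply: (@le_lt_trans _ _ (\int[leb]_t (exponential_pdf 2^-1 t)%:E)).
  apply: ge0_subset_integral => //.
    by apply/measurable_EFinP; exact: measurable_exponential_pdf.
  by move=> t _; rewrite lee_fin exponential_pdf_ge0// ltW.
by rewrite integral_exponential_pdf// ltry.
Qed.

End gamma.

(** * Layer-cake formulas *)

Section layer_cake.
Context {R : realType}.
Local Open Scope ereal_scope.
Notation leb := (@lebesgue_measure R).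
Implicit Types (a c r s t q : R).

Lemma integral_expRN_layer s : (0 <= s)%R ->
  \int[leb]_t (if (0 < t)%R && (s <= t)%R then (expR (- t))%:E else 0) = (expR (- s))%:E.
Proof.
have me D : measurable D -> measurable_fun D (fun t : R => (expR (- t))%:E).
  by move=> mD; apply/measurable_EFinP; apply: measurable_funTS; exact: measurable_expRN.
rewrite le_eqVlt => /predU1P[<-|s0].
  rewrite -integral_expRN -integral_itv_obnd_cbnd; last exact: me.
  rewrite [RHS]integral_mkcond; apply: eq_integral => t _; rewrite patchE mem_setE in_itv/= andbT.
  by case: ltP => //= /ltW ->.
rewrite -integral_expRN [RHS]integral_mkcond; apply: eq_integral => t _.
rewrite patchE mem_setE in_itv/= andbT.
by case: (leP s t) => st; rewrite ?andbF// (lt_le_trans s0 st).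
Qed.

(** Both sides are the integral of a s^(a-1) exp(-t) over 0 < s <= t, so Tonelli takes the place of
    an integration by parts. *)
Lemma Euler_GammaS a : (1 <= a)%R -> Euler_Gamma (a + 1) = a%:E * Euler_Gamma a.
Proof.
move=> a1; have a0 : (0 <= a)%R by exact: le_trans a1.
pose K (z : measurableTypeR R * measurableTypeR R) : \bar R :=
  if ((0 < z.1) && (z.1 <= z.2))%R then (a * z.1 `^ (a - 1) * expR (- z.2))%:E else 0.
have m1 : measurable_fun setT (fun z : measurableTypeR R * measurableTypeR R => z.1 : R) by exact: measurable_fst.
have m2 : measurable_fun setT (fun z : measurableTypeR R * measurableTypeR R => z.2 : R) by exact: measurable_snd.
have mK : measurable_fun setT K.
  apply: measurable_fun_ifT; last exact: measurable_cst.
    by apply: measurable_and; [exact: measurable_fun_ltr|exact: measurable_fun_ler].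
  apply/measurable_EFinP; apply: measurable_funM.
    apply: measurable_funM; first exact: measurable_cst.
    exact: (measurableT_comp (measurable_powR _) m1).
  exact: (measurableT_comp measurable_expRN m2).
have K0 z : 0 <= K z.
  by rewrite /K; case: ifP => // _; rewrite lee_fin !mulr_ge0 ?powR_ge0 ?expR_ge0.
have := @fubini_tonelli _ _ _ _ R leb leb K mK K0.
have -> : \int[leb]_x \int[leb]_y K (x, y) = a%:E * Euler_Gamma a.
  rewrite /Euler_Gamma -ge0_integralZl_EFin//; last 2 first.
  - by move=> t _; rewrite lee_fin mulr_ge0 ?powR_ge0 ?expR_ge0.
  - apply/measurable_EFinP; apply: measurable_funTS; apply: measurable_funM; last exact: measurable_expRN.
    exact: measurable_powR.
  rewrite [RHS]integral_mkcond; apply: eq_integral => s _.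
  rewrite patchE mem_setE in_itv/= andbT /K/=; case: ltP => s0 /=; last by rewrite integral0_eq.
  transitivity (\int[leb]_t ((a * s `^ (a - 1))%:E *
      (if (0 < t)%R && (s <= t)%R then (expR (- t))%:E else 0))).
    apply: eq_integral => t _; case: (leP s t) => st; last by rewrite andbF mule0.
    by rewrite (lt_le_trans s0 st)/= EFinM.
  rewrite ge0_integralZl_EFin//.
  - by rewrite integral_expRN_layer ?(ltW s0)// -!EFinM mulrA.
  - by move=> t _; case: ifP => // _; rewrite lee_fin expR_ge0.
  - apply: measurable_fun_ifT; last exact: measurable_cst.
      by apply: measurable_and; [exact: measurable_fun_ltr|exact: measurable_fun_ler].
    by apply/measurable_EFinP; exact: measurable_expRN.
  - by rewrite mulr_ge0 ?powR_ge0.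
move=> ->; rewrite /Euler_Gamma [LHS]integral_mkcond; apply: eq_integral => t _.
rewrite patchE mem_setE in_itv/= andbT; case: ltP => t0; last first.
  rewrite integral0_eq// => s _; rewrite /K/=; case: ifP => // /andP[s0 st].
  by have := lt_le_trans s0 (le_trans st t0); rewrite ltxx.
rewrite addrK.
transitivity (\int[leb]_(s in `[0%R, t]) ((expR (- t))%:E * (a * s `^ (a - 1))%:E)).
  rewrite ge0_integralZl_EFin//.
  - rewrite integral_powR ?(ltW t0)// powR0 ?gt_eqF ?(lt_le_trans _ a1)// subr0 -EFinM.
    by rewrite mulrC.
  - by move=> s _; rewrite lee_fin mulr_ge0 ?powR_ge0.
  - apply/measurable_EFinP; apply: measurable_funTS; apply: measurable_funM; first exact: measurable_cst.
    exact: measurable_powR.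
rewrite -integral_itv_obnd_cbnd; last first.
  apply: measurable_funTS; apply: emeasurable_funM; first exact: measurable_cst.
  by apply/measurable_EFinP; apply: measurable_funM; [exact: measurable_cst|exact: measurable_powR].
rewrite integral_mkcond; apply: eq_integral => s _; rewrite patchE mem_setE in_itv/= /K/=.
by case: ifP => // _; rewrite -EFinM mulrC.
Qed.

Section homogeneous.
Context {n : nat}.
Implicit Types (x : 'rV[R]_n).

Lemma measurable_dotp_sqr : measurable_fun setT (fun x => dotp x x).
Proof.
apply: measurable_sum => i.
by apply: measurable_funM; exact: measurable_rV_coord.
Qed.

Lemma unit_ball_dotp x : unit_ball x <-> (dotp x x <= 1)%R.
Proof.
rewrite /unit_ball/= /enorm; split => [h|h].
  rewrite -(sqr_sqrtr (dotp_ge0 x)) -[leRHS](expr1n _ 2) ler_sqr ?nnegrE ?sqrtr_ge0//.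
by rewrite -sqrtr1 ler_wsqrtr.
Qed.

Variables (q : R) (g : 'rV[R]_n -> R).
Hypothesis mg : measurable_fun setT g.
Hypothesis g0 : forall x, (0 <= g x)%R.
Hypothesis gh : forall r x, (0 < r)%R -> g (r *: x) = (r `^ q * g x)%R.

Let gE_ge0 x : 0 <= (g x)%:E. Proof. by rewrite lee_fin. Qed.

Lemma homogeneous_ball t : (0 < t)%R ->
  \int[lebesgue_rV n]_x (if (dotp x x <= t)%R then (g x)%:E else 0) =
  (t `^ ((n%:R + q) / 2))%:E * \int[lebesgue_rV n]_(x in unit_ball) (g x)%:E.
Proof.
move=> t0; pose r := Num.sqrt t.
have r0 : (0 < r)%R by rewrite sqrtr_gt0.
rewrite -(ge0_integral_rV_scale r0); last 2 first.
- apply: measurable_fun_ifT; [|exact/measurable_EFinP|exact: measurable_cst].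
  by apply: measurable_fun_ler => //; exact: measurable_dotp_sqr.
- by move=> x; case: ifP.
transitivity ((r ^+ n)%:E * ((r `^ q)%:E * \int[lebesgue_rV n]_(x in unit_ball) (g x)%:E)).
  congr (_ * _); rewrite -ge0_integralZl_EFin//; last 3 first.
  - exact: measurable_unit_ball.
  - by apply/measurable_EFinP; exact: measurable_funTS.
  - exact: powR_ge0.
  rewrite [RHS]integral_mkcond; apply: eq_integral => x _; rewrite patchE.
  have -> : (x \in unit_ball) = (dotp x x <= 1)%R.
    by apply/idP/idP => [/set_mem/unit_ball_dotp|/unit_ball_dotp h]; [|apply/mem_set].
  have -> : (dotp (r *: x) (r *: x) <= t)%R = (dotp x x <= 1)%R.
    have -> : (dotp (r *: x) (r *: x) = t * dotp x x)%R.
      rewrite -[in RHS](sqr_sqrtr (ltW t0)) /dotp mulr_sumr; apply: eq_bigr => i _.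
      by rewrite !mxE -/r; ring.
    by rewrite -[X in (_ <= X)%R = _]mulr1 ler_pM2l.
  by case: ifP => // _; rewrite gh// EFinM.
rewrite muleA -EFinM; congr (_%:E * _).
rewrite -powR_mulrn ?ltW// -powRD; last by rewrite (gt_eqF r0) implybT.
by rewrite /r -powR12_sqrt ?(ltW t0)// -powRrM mulrC.
Qed.

(* Layer cake: exp (-s) is the integral of exp (-t) over t >= s. *)
Lemma homogeneous_gauss :
  \int[lebesgue_rV n]_x (g x * expR (- dotp x x))%:E =
  Euler_Gamma ((n%:R + q) / 2 + 1) * \int[lebesgue_rV n]_(x in unit_ball) (g x)%:E.
Proof.
pose K (z : 'rV[R]_n * measurableTypeR R) : \bar R :=
  if ((0 < z.2) && (dotp z.1 z.1 <= z.2))%R then (g z.1 * expR (- z.2))%:E else 0.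
have m2 : measurable_fun setT (fun z : 'rV[R]_n * measurableTypeR R => z.2 : R) by exact: measurable_snd.
have md : measurable_fun setT (fun z : 'rV[R]_n * measurableTypeR R => dotp z.1 z.1).
  exact: (measurableT_comp measurable_dotp_sqr measurable_fst).
have mK : measurable_fun setT K.
  apply: measurable_fun_ifT; last exact: measurable_cst.
    by apply: measurable_and; [exact: measurable_fun_ltr|exact: measurable_fun_ler].
  apply/measurable_EFinP; apply: measurable_funM; first exact: measurableT_comp mg measurable_fst.
  exact: (measurableT_comp measurable_expRN m2).
have K0 z : 0 <= K z.
  by rewrite /K; case: ifP => // _; rewrite lee_fin mulr_ge0 ?expR_ge0.
have := @fubini_tonelli _ _ _ _ R (lebesgue_rV n) leb K mK K0.
have -> : \int[lebesgue_rV n]_x \int[leb]_t K (x, t) =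
    \int[lebesgue_rV n]_x (g x * expR (- dotp x x))%:E.
  apply: eq_integral => x _; rewrite EFinM -(integral_expRN_layer (dotp_ge0 x)).
  rewrite -ge0_integralZl_EFin//.
  - by apply: eq_integral => t _; rewrite /K/=; case: ifP => _; rewrite ?mule0// EFinM.
  - by move=> t _; case: ifP => // _; rewrite lee_fin expR_ge0.
  - apply: measurable_fun_ifT; last exact: measurable_cst.
      by apply: measurable_and; [exact: measurable_fun_ltr|exact: measurable_fun_ler].
    by apply/measurable_EFinP; exact: measurable_expRN.
move=> ->; rewrite muleC /Euler_Gamma.
have mi : measurable_fun (`]0%R, +oo[%classic : set R)
    (fun t : R => (t `^ ((n%:R + q) / 2 + 1 - 1) * expR (- t))%:E).
  apply/measurable_EFinP; apply: measurable_funTS; apply: measurable_funM; last exact: measurable_expRN.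
  exact: measurable_powR.
rewrite -(ge0_integralZl leb (measurable_itv _) mi)//; last 2 first.
- by move=> t _; rewrite lee_fin mulr_ge0 ?powR_ge0 ?expR_ge0.
- exact: integral_ge0.
rewrite [RHS]integral_mkcond; apply: eq_integral => t _.
rewrite patchE mem_setE in_itv/= andbT addrK /K/=; case: ltP => t0 /=; last by rewrite integral0_eq.
transitivity (\int[lebesgue_rV n]_x ((expR (- t))%:E * (if (dotp x x <= t)%R then (g x)%:E else 0))).
  by apply: eq_integral => x _; case: ifP => _; rewrite ?mule0// EFinM muleC.
rewrite ge0_integralZl_EFin ?expR_ge0//.
- by rewrite homogeneous_ball// EFinM muleCA [RHS]muleCA [X in _ = _ * X]muleC.
- by move=> x _; case: ifP.
- apply: measurable_fun_ifT; [|exact/measurable_EFinP|exact: measurable_cst].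
  by apply: measurable_fun_ler => //; exact: measurable_dotp_sqr.
Qed.

End homogeneous.
End layer_cake.

Section ball_moment.
Context {R : realType} {n : nat}.
Local Open Scope ereal_scope.
Notation leb := (@lebesgue_measure R).
Implicit Types (x : 'rV[R]_n).
Variables (p : R) (h : 'rV[R]_n -> R).
Hypothesis p1 : (1 < p)%R.
Hypothesis mh : measurable_fun setT h.
Hypothesis h0 : forall x, (0 <= h x)%R.
Hypothesis h1 : forall x, (h x <= 1)%R.
Hypothesis hh : forall r x, (0 < r)%R -> h (r *: x) = h x.

Let B := @unit_ball R n.
Let mB : measurable B. Proof. exact: measurable_unit_ball. Qed.

Lemma enorm_le_dotp x (r : R) : (0 <= r)%R -> (enorm x <= r)%R = (dotp x x <= r ^+ 2)%R.
Proof.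
move=> r0; rewrite /enorm -[X in (_ <= X)%R = _](ger0_norm r0) -sqrtr_sqr ler_sqrt ?sqr_ge0//.
Qed.

Lemma ball_moment_lty : \int[lebesgue_rV n]_(x in B) (h x)%:E < +oo.
Proof.
apply: le_lt_trans (@lebesgue_unit_ball_lty R n).
rewrite -[leRHS]mul1e -integral_cst//; apply: ge0_le_integral => //.
- by move=> x _; rewrite lee_fin.
- by apply/measurable_EFinP; exact: measurable_funTS.
- by move=> x _; rewrite lee_fin.
Qed.

(* Layer cake: 1 - s^p is the integral of p r^(p-1) over s <= r <= 1. *)
Lemma ball_moment : \int[lebesgue_rV n]_(x in B) (h x * enorm x `^ p)%:E =
  (n%:R / (n%:R + p))%:E * \int[lebesgue_rV n]_(x in B) (h x)%:E.
Proof.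
have p0 : (0 < p)%R := lt_trans ltr01 p1.
have np0 : (0 < n%:R + p :> R)%R by rewrite ltr_wpDl.
have menorm := @measurable_enorm R n.
have mpe : measurable_fun setT (fun x => enorm x `^ p)%R.
  exact: measurableT_comp (measurable_powR p) menorm.
pose K (z : 'rV[R]_n * measurableTypeR R) : \bar R :=
  if ((enorm z.1 <= z.2) && (z.2 <= 1))%R then (h z.1 * (p * z.2 `^ (p - 1)))%:E else 0.
have m2 : measurable_fun setT (fun z : 'rV[R]_n * measurableTypeR R => z.2 : R) by exact: measurable_snd.
have md : measurable_fun setT (fun z : 'rV[R]_n * measurableTypeR R => enorm z.1).
  exact: (measurableT_comp menorm measurable_fst).
have mK : measurable_fun setT K.
  apply: measurable_fun_ifT; last exact: measurable_cst.
    by apply: measurable_and; exact: measurable_fun_ler.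
  apply/measurable_EFinP; apply: measurable_funM; first exact: measurableT_comp mh measurable_fst.
  apply: measurable_funM; first exact: measurable_cst.
  exact: (measurableT_comp (measurable_powR _) m2).
have K0 z : 0 <= K z.
  by rewrite /K; case: ifP => // _; rewrite lee_fin !mulr_ge0 ?powR_ge0// ltW.
have := @fubini_tonelli _ _ _ _ R (lebesgue_rV n) leb K mK K0.
set H := \int[lebesgue_rV n]_(x in B) (h x)%:E.
have H0 : 0 <= H by apply: integral_ge0 => x _; rewrite lee_fin.
have -> : \int[lebesgue_rV n]_x \int[leb]_r K (x, r) =
    \int[lebesgue_rV n]_(x in B) (h x * (1 - enorm x `^ p))%:E.
  rewrite [RHS]integral_mkcond; apply: eq_integral => x _; rewrite patchE.
  case: ifPn => [/set_mem Bx|/negP nB].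
    transitivity (\int[leb]_(r in `[enorm x, 1%R]) ((h x)%:E * (p * r `^ (p - 1))%:E)).
      rewrite [RHS]integral_mkcond; apply: eq_integral => r _.
      by rewrite patchE mem_setE in_itv/= /K/=; case: ifP => // _; rewrite EFinM.
    rewrite ge0_integralZl_EFin//.
    + by rewrite integral_powR ?enorm_ge0 ?(ltW p1)// powR1 -EFinM.
    + by move=> r _; rewrite lee_fin mulr_ge0 ?powR_ge0// ltW.
    + apply/measurable_EFinP; apply: measurable_funTS; apply: measurable_funM; first exact: measurable_cst.
      exact: measurable_powR.
  rewrite integral0_eq// => r _; rewrite /K/=; case: ifP => // /andP[xr r1].
  by exfalso; apply: nB; apply/mem_set; exact: le_trans r1.
have -> : \int[leb]_r \int[lebesgue_rV n]_x K (x, r) = (p / (n%:R + p))%:E * H.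
  (* [h] being homogeneous of degree 0, its integral over the ball of radius r is r^n H; the
     constants are arranged so that the derivative of r^(n+p) appears. *)
  transitivity (\int[leb]_(r in `[0%R, 1%R]) ((p / (n%:R + p))%:E * H *
      ((n%:R + p) * r `^ (n%:R + p - 1))%:E)).
    rewrite [RHS]integral_mkcond; apply: eq_integral => r _.
    rewrite patchE mem_setE in_itv/=.
    case: (ltgtP r 0%R) => [r0|r0|->]/=.
    - rewrite integral0_eq// => x _; rewrite /K/=; case: ifP => // /andP[xr _].
      by have := le_lt_trans xr r0; rewrite ltNge enorm_ge0.
    - case: ifPn => r1; last first.
        by rewrite integral0_eq// => x _; rewrite /K/= (negbTE r1) andbF.
      transitivity (\int[lebesgue_rV n]_x ((p * r `^ (p - 1))%:E *
          (if (dotp x x <= r ^+ 2)%R then (h x)%:E else 0))).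
        apply: eq_integral => x _; rewrite /K/= r1 andbT enorm_le_dotp ?(ltW r0)//.
        by case: ifP => _; rewrite ?mule0// -EFinM mulrC.
      rewrite ge0_integralZl_EFin//; last 3 first.
      + by move=> x _; case: ifP => // _; rewrite lee_fin.
      + apply: measurable_fun_ifT; [|exact/measurable_EFinP|exact: measurable_cst].
        by apply: measurable_fun_ler => //; exact: measurable_dotp_sqr.
      + by rewrite mulr_ge0 ?powR_ge0// ltW.
      have hq (s : R) x : (0 < s)%R -> h (s *: x) = (s `^ 0 * h x)%R.
        by move=> s0; rewrite powRr0 mul1r hh.
      rewrite (homogeneous_ball mh h0 hq) ?exprn_gt0// -/B -/H addr0 muleA -EFinM.
      rewrite [RHS]muleAC -EFinM; congr (_%:E * _).
      rewrite mulrA divfK ?gt_eqF// -mulrA; congr (_ * _)%R.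
      rewrite -(powR_mulrn 2 (ltW r0)) -powRrM -powRD; last by rewrite (gt_eqF r0) implybT.
      by congr (_ `^ _)%R; field.
    - rewrite ler01 powR0 ?mulr0 ?mule0; last by rewrite subr_eq0 gt_eqF// (lt_le_trans p1)// lerDr.
      rewrite integral0_eq// => x _; rewrite /K/=; case: ifP => // _.
      by rewrite powR0 ?mulr0// subr_eq0 gt_eqF.
  have np1 : (1 <= n%:R + p)%R by rewrite (le_trans (ltW p1))// lerDr.
  have mpw : measurable_fun (`[0%R, 1%R]%classic : set R)
      (fun r : R => ((n%:R + p) * r `^ (n%:R + p - 1))%:E).
    apply/measurable_EFinP; apply: measurable_funTS; apply: measurable_funM; first exact: measurable_cst.
    exact: measurable_powR.
  rewrite (ge0_integralZl leb (measurable_itv _) mpw)//; last 2 first.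
  - by move=> r _; rewrite lee_fin mulr_ge0 ?powR_ge0// ltW.
  - by rewrite mule_ge0// lee_fin divr_ge0// ltW.
  by rewrite integral_powR// powR1 powR0 ?gt_eqF// subr0 mule1.
move=> E.
(* The two parts add up to [H], which is finite, so the second one can be subtracted. *)
have : \int[lebesgue_rV n]_(x in B) (h x * enorm x `^ p)%:E +
    \int[lebesgue_rV n]_(x in B) (h x * (1 - enorm x `^ p))%:E = H.
  have e1 x : B x -> (0 <= 1 - enorm x `^ p)%R.
    move=> Bx; have h1p : (1 `^ p = 1 :> R)%R by rewrite powR1.
    by rewrite subr_ge0 -[leRHS]h1p ge0_ler_powR ?nnegrE ?enorm_ge0// ltW.
  rewrite -ge0_integralD//.
  - by apply: eq_integral => x _; rewrite -EFinD -mulrDr addrC subrK mulr1.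
  - by move=> x _; rewrite lee_fin mulr_ge0 ?powR_ge0.
  - by apply/measurable_EFinP; apply: measurable_funTS; exact: measurable_funM.
  - by move=> x Bx; rewrite lee_fin mulr_ge0 ?e1.
  - apply/measurable_EFinP; apply: measurable_funTS; apply: measurable_funM => //.
    by apply: measurable_funB => //; exact: measurable_cst.
rewrite E.
have Hfin : H \is a fin_num by rewrite ge0_fin_numE// ball_moment_lty.
rewrite -(fineK Hfin) -EFinM => E2.
have -> : (n%:R / (n%:R + p))%:E * (fine H)%:E = (fine H)%:E - (p / (n%:R + p) * fine H)%:E.
  by rewrite -EFinM -EFinB; congr EFin; field; rewrite gt_eqF.
by rewrite -E2 addeK.
Qed.

End ball_moment.

(** * Gaussian integrals and the moment of the first coordinate *)

Section gauss.
Context {R : realType}.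
Local Open Scope ereal_scope.
Notation leb := (@lebesgue_measure R).

Let G n : \bar R := \int[@lebesgue_rV R n]_x (expR (- dotp x x))%:E.

Lemma measurable_gauss_rV n : measurable_fun setT (fun x : 'rV[R]_n => expR (- dotp x x)).
Proof. exact: measurableT_comp (@measurable_expRN R) (@measurable_dotp_sqr R n). Qed.

Lemma gauss_product n (f : R -> R) : measurable_fun setT f -> (forall s, (0 <= f s)%R) ->
  \int[lebesgue_rV n.+1]_x (f (x ord0 ord0) * expR (- dotp x x))%:E =
  (\int[leb]_s (f s * expR (- s ^+ 2))%:E) * G n.
Proof.
move=> mf f0; rewrite ge0_integral_lebesgue_rVS; last 2 first.
- apply/measurable_EFinP; apply: measurable_funM; last exact: measurable_gauss_rV.
  exact: measurableT_comp mf (measurable_rV_coord _).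
- by move=> x; rewrite lee_fin mulr_ge0 ?expR_ge0.
have G0 : 0 <= G n by apply: integral_ge0 => x _; rewrite lee_fin expR_ge0.
have ms : measurable_fun setT (fun s : R => (f s * expR (- s ^+ 2))%:E).
  apply/measurable_EFinP; apply: measurable_funM => //.
  by apply: (measurableT_comp (@measurable_expRN R)); exact: measurable_funX.
have ms0 (s : R) : (0 <= f s * expR (- s ^+ 2))%R by rewrite mulr_ge0 ?expR_ge0.
have mge : measurable_fun setT (fun y : 'rV[R]_n => (expR (- dotp y y))%:E).
  by apply/measurable_EFinP; exact: measurable_gauss_rV.
have ge (y : 'rV[R]_n) : setT y -> 0 <= (expR (- dotp y y))%:E by rewrite lee_fin expR_ge0.
rewrite muleC -(ge0_integralZl leb measurableT ms)//; last first.
  by move=> s _; rewrite lee_fin mulr_ge0 ?expR_ge0.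
apply: eq_integral => s _; rewrite muleC -(ge0_integralZl_EFin _ measurableT ge mge (ms0 s)).
apply: eq_integral => y _; rewrite -EFinM; congr EFin.
have -> : rV_cons (s : measurableTypeR R, y) ord0 ord0 = s by rewrite mxE unlift_none.
have -> : dotp (rV_cons (s : measurableTypeR R, y)) (rV_cons (s : measurableTypeR R, y)) =
    (s ^+ 2 + dotp y y)%R.
  rewrite /dotp big_ord_recl !mxE unlift_none/= -expr2; congr (_ + _)%R.
  by apply: eq_bigr => i _; rewrite !mxE liftK.
by rewrite opprD expRD mulrA.
Qed.

Lemma gauss0 : G 0 = 1.
Proof.
rewrite /G/= integral_dirac//.
  by rewrite diracT mul1e /dotp big_ord0 oppr0 expR0.
by apply/measurable_EFinP; exact: measurable_gauss_rV.
Qed.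

Lemma gaussS n : G n.+1 = (Num.sqrt pi)%:E * G n.
Proof.
have := @gauss_product n (fun=> 1%R) (measurable_cst _) (fun=> ler01).
under eq_integral do rewrite mul1r.
rewrite -/(G n.+1) => ->; congr (_ * _); rewrite -integralT_gauss.
by apply: eq_integral => s _; rewrite mul1r.
Qed.

(** Instead of the substitution t = s^2, the homogeneous formula in dimension 1: there the unit ball
    has length 2 and |s|^p has integral 2/(p + 1) over it, and the functional equation of Gamma
    absorbs the factor. *)
Lemma gauss_moment (p : R) : (1 < p)%R ->
  \int[leb]_s (`|s| `^ p * expR (- s ^+ 2))%:E = Euler_Gamma ((p + 1) / 2).
Proof.
move=> p1; have p0 : (0 < p)%R := lt_trans ltr01 p1.
have mp : measurable_fun setT (fun s : R => `|s| `^ p)%R.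
  by apply: (measurableT_comp (measurable_powR p)); exact: normr_measurable.
have := @gauss_product 0 _ mp (fun s => powR_ge0 _ _).
rewrite -/(G 0) gauss0 mule1 => <-.
rewrite (@homogeneous_gauss R 1 p (fun x => `|x ord0 ord0| `^ p)%R); last 3 first.
- exact: measurableT_comp mp (measurable_rV_coord _).
- by move=> x; exact: powR_ge0.
- by move=> r x r0; rewrite mxE normrM powRM// gtr0_norm.
have en (x : 'rV[R]_1) : enorm x = `|x ord0 ord0|%R.
  by rewrite /enorm /dotp big_ord1 -expr2 sqrtr_sqr.
have := @ball_moment R 1 p (fun=> 1%R) p1 (measurable_cst _) (fun=> ler01) (fun=> lexx _) (fun _ _ _ => erefl).
have -> : \int[lebesgue_rV 1]_(x in unit_ball) (1 * enorm x `^ p)%:E =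
    \int[lebesgue_rV 1]_(x in unit_ball) (`|x ord0 ord0| `^ p)%:E.
  by apply: eq_integral => x _; rewrite mul1r en.
move=> ->; rewrite integral_cst; last exact: measurable_unit_ball.
have -> : @unit_ball R 1 = cube 1 1.
  apply/seteqP; split => x; first exact: unit_ball_cube.
  by move=> /(_ ord0) h; rewrite /unit_ball/= en.
have lc : lebesgue_rV 1 (@cube R 1 1) = 2%:E by rewrite lebesgue_cube// expr1 mulr1.
rewrite mul1e [X in _ * (_ * X)]lc -EFinM.
have a1 : (1 <= (1 + p) / 2)%R by lra.
rewrite Euler_GammaS// addrC muleAC -EFinM.
rewrite (_ : _ * _ = 1)%R ?mul1e//.
by field; rewrite gt_eqF// addr_gt0.
Qed.

(** Elimination of [X], the Gaussian integral of the remaining coordinates, from its two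
    evaluations; the second one forces [X] to be finite. *)
Let cancel_gauss (N p P : R) (g1 g2 g3 h v X : \bar R) : (0 < N)%R -> (0 < p)%R -> (0 < P)%R ->
  g1 \is a fin_num -> g2 \is a fin_num -> g3 \is a fin_num -> h \is a fin_num ->
  v \is a fin_num -> 0 <= X -> g1 * X = ((N + p) / 2)%:E * g2 * ((N / (N + p))%:E * h) ->
  P%:E * X = (N / 2)%:E * g3 * v -> h * g2 * P%:E = v * g1 * g3.
Proof.
move=> N0 p0 P0.
case: g1 => [g1|//|//] _; case: g2 => [g2|//|//] _; case: g3 => [g3|//|//] _.
case: h => [h|//|//] _; case: v => [v|//|//] _.
case: X => [x|_ _|//]; last by rewrite gt0_muley ?lte_fin.
move=> _; rewrite -!EFinM => -[E1] [E2]; congr EFin.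
apply: (@mulIf _ (N / 2)%R); first by rewrite gt_eqF// divr_gt0.
transitivity (g1 * (P * x))%R; last by rewrite E2; ring.
rewrite [RHS]mulrCA E1; field.
by rewrite gt_eqF// addr_gt0.
Qed.

(* [N >= 2]: the arguments of the Gamma functions are then at least 1. *)
Lemma radial_moment n (p : R) : (0 < n)%N -> (1 < p)%R ->
  \int[lebesgue_rV n.+1]_(x in unit_ball) (`|radial x ord0 ord0| `^ p)%:E
    * Euler_Gamma ((n.+1%:R + p) / 2) * (Num.sqrt pi)%:E =
  lebesgue_rV n.+1 unit_ball * Euler_Gamma ((p + 1) / 2) * Euler_Gamma (n.+1%:R / 2).
Proof.
move=> n0 p1; have p0 : (0 < p)%R := lt_trans ltr01 p1.
have n2 : (2 <= n.+1%:R :> R)%R by rewrite ler_nat.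
have mp : measurable_fun setT (fun s : R => `|s| `^ p)%R.
  by apply: (measurableT_comp (measurable_powR p)); exact: normr_measurable.
have r1 (x : 'rV[R]_n.+1) : (`|radial x ord0 ord0| `^ p <= 1 :> R)%R.
  have -> : (1 = 1 `^ p :> R)%R by rewrite powR1.
  rewrite ge0_ler_powR ?nnegrE// ?(ltW p0)//.
  apply: le_trans (coord_le_enorm _ _) _; rewrite /radial enormZ ger0_norm ?invr_ge0 ?enorm_ge0//.
  have [->|x0] := eqVneq (enorm x) 0%R; first by rewrite mulr0.
  by rewrite mulVf.
have mr : measurable_fun setT (fun x : 'rV[R]_n.+1 => `|radial x ord0 ord0| `^ p)%R.
  apply: (measurableT_comp mp); apply: (measurableT_comp (measurable_rV_coord _)).
  exact: measurable_radial.
have hr (r : R) (x : 'rV[R]_n.+1) : (0 < r)%R -> (`|radial (r *: x) ord0 ord0| `^ p = `|radial x ord0 ord0| `^ p)%R.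
  move=> r0; rewrite /radial enormZ (gtr0_norm r0) invfM scalerA.
  by rewrite mulrAC mulVf ?mul1r// gt_eqF.
have := @ball_moment R n.+1 p _ p1 mr (fun x => powR_ge0 _ _) r1 hr.
set H := \int[lebesgue_rV n.+1]_(x in unit_ball) (`|radial x ord0 ord0| `^ p)%:E.
have -> : \int[lebesgue_rV n.+1]_(x in unit_ball) (`|radial x ord0 ord0| `^ p * enorm x `^ p)%:E =
   \int[lebesgue_rV n.+1]_(x in unit_ball) (`|x ord0 ord0| `^ p)%:E.
  apply: eq_integral => x _; congr EFin.
  rewrite -powRM ?enorm_ge0// /radial mxE normrM ger0_norm ?invr_ge0 ?enorm_ge0//.
  have [x0|x0] := eqVneq (enorm x) 0%R; last by rewrite mulrAC mulVf// mul1r.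
  have := coord_le_enorm x ord0; rewrite x0 normr_le0 => /eqP ->.
  by rewrite normr0 mulr0.
move=> EB.
(* Gaussian integral of |x_0|^p, by coordinates on the left and by homogeneity on the right; [E2]
   does the same for the function 1. *)
have E1 : Euler_Gamma ((p + 1) / 2) * G n = Euler_Gamma ((n.+1%:R + p) / 2 + 1) *
    ((n.+1%:R / (n.+1%:R + p))%:E * H).
  rewrite -EB -(gauss_moment p1) -(@gauss_product n _ mp (fun s => powR_ge0 _ _)).
  apply: homogeneous_gauss => [|x|r x rr].
  - exact: (measurableT_comp mp (measurable_rV_coord _)).
  - exact: powR_ge0.
  - by rewrite mxE normrM powRM// gtr0_norm.
have E2 : (Num.sqrt pi)%:E * G n = Euler_Gamma (n.+1%:R / 2 + 1) * lebesgue_rV n.+1 (@unit_ball R n.+1).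
  have hom (r : R) (x : 'rV[R]_n.+1) : (0 < r)%R -> 1%R = (r `^ 0 * 1)%R by rewrite powRr0 mulr1.
  have := @homogeneous_gauss R n.+1 0 (fun=> 1%R) (measurable_cst _) (fun=> ler01) hom.
  rewrite addr0 integral_cst; last exact: measurable_unit_ball.
  rewrite mul1e => <-; rewrite -gaussS; apply: eq_integral => x _.
  by rewrite mul1r.
have a1 : (1 <= (p + 1) / 2)%R by lra.
have a2 : (1 <= (n.+1%:R + p) / 2)%R by move: n2; set m := n.+1%:R; lra.
have a3 : (1 <= n.+1%:R / 2 :> R)%R by move: n2; set m := n.+1%:R; lra.
rewrite Euler_GammaS// in E1; rewrite Euler_GammaS// in E2.
have fin (a : R) : (1 <= a)%R -> Euler_Gamma a \is a fin_num.
  by move=> aa; rewrite ge0_fin_numE ?Euler_Gamma_lty// ltW// Euler_Gamma_gt0.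
have HF : H \is a fin_num.
  rewrite ge0_fin_numE; last by apply: integral_ge0 => x _; rewrite lee_fin powR_ge0.
  exact: ball_moment_lty.
have VF : lebesgue_rV n.+1 (@unit_ball R n.+1) \is a fin_num.
  by rewrite ge0_fin_numE// lebesgue_unit_ball_lty.
have pi0 : (0 < Num.sqrt (pi : R))%R by rewrite sqrtr_gt0 pi_gt0.
have G0 : 0 <= G n by apply: integral_ge0 => x _; rewrite lee_fin expR_ge0.
exact: (cancel_gauss (ltr0Sn _ n) p0 pi0 (fin _ a1) (fin _ a2) (fin _ a3) HF VF G0 E1 E2).
Qed.

End gauss.

(** * Integrals over the sphere and the constant Xi *)

Section sphere_integral.
Context {R : realType} {n : nat}.
Local Open Scope ereal_scope.
Notation S := (sphere_measure R n).

Lemma measurable_usphere : measurable (@usphere R n).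
Proof.
rewrite (_ : usphere = [set: 'rV[R]_n] `&` enorm @^-1` [set 1%R]); last by rewrite setTI.
by apply: measurable_enorm => //; exact: measurable_set1.
Qed.

Lemma enorm0 : enorm (0 : 'rV[R]_n) = 0%R.
Proof. by rewrite /enorm /dotp big1 ?sqrtr0// => i _; rewrite mxE mul0r. Qed.

Lemma enorm_eq0 (x : 'rV[R]_n) : (enorm x == 0%R) = (x == 0%R).
Proof.
apply/eqP/eqP => [x0|->]; last exact: enorm0.
apply/rowP => i; rewrite mxE; apply/eqP; rewrite -normr_le0 -x0; exact: coord_le_enorm.
Qed.

Lemma usphere_radial (x : 'rV[R]_n) : x != 0%R -> usphere (radial x).
Proof.
rewrite -enorm_eq0 => x0.
by rewrite /usphere/= /radial enormZ ger0_norm ?invr_ge0 ?enorm_ge0// mulVf.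
Qed.

Lemma radial0 : radial (0 : 'rV[R]_n) = 0%R.
Proof. by rewrite /radial scaler0. Qed.

(** [radial] maps the origin to itself, off the sphere; the hypothesis [f 0 = 0] makes both sides
    agree at this point. *)
Lemma integral_sphere (f : 'rV[R]_n -> \bar R) : measurable_fun setT f -> (forall x, 0 <= f x) ->
  f 0%R = 0 ->
  \int[S]_(nu in usphere) f nu =
  ((fine (lebesgue_rV n (@unit_ball R n)))^-1)%:E * \int[lebesgue_rV n]_(x in unit_ball) f (radial x).
Proof.
move=> mf f0 f00; pose V := lebesgue_rV n (@unit_ball R n).
have V0 : 0 < V by exact: lebesgue_unit_ball_gt0.
have Voo : V < +oo by exact: lebesgue_unit_ball_lty.
have k0 : (0 <= (fine V)^-1)%R by rewrite invr_ge0 fine_ge0// ltW.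
pose m : {measure set 'rV[R]_n -> \bar R} :=
  image_measure (mrestr (@lebesgue_rV R n) measurable_unit_ball) (@measurable_radial R n).
have mV : m setT = V.
  transitivity (lebesgue_rV n (@radial R n @^-1` setT `&` unit_ball)) => //.
  by rewrite preimage_setT setTI.
rewrite integral_mkcond.
have mfu : measurable_fun setT (f \_ usphere).
  by apply/(measurable_restrictT _ measurable_usphere); exact: measurable_funTS.
have fu0 x : 0 <= (f \_ usphere) x by apply: erestrict_ge0.
transitivity (\int[mscale (NngNum k0) m]_x (f \_ usphere) x).
  apply: eq_measure_integral => A mA _.
  rewrite /= /mnormalize [m _]mV /mscale/= muleC.
  by rewrite gt_eqF//= lt_eqF.
rewrite ge0_integral_mscale//=; congr (_ * _).
rewrite ge0_integral_image_measure//.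
have mfr : measurable_fun setT (fun x => (f \_ usphere) (radial x)).
  exact: measurableT_comp mfu (@measurable_radial R n).
rewrite (ge0_integral_mrestr _ measurable_unit_ball mfr)//.
apply: eq_integral => x _; rewrite patchE; case: ifPn => // /negP xu.
have [->|x0] := eqVneq x 0%R; first by rewrite radial0 f00.
by exfalso; apply: xu; apply/mem_set; exact: usphere_radial.
Qed.

End sphere_integral.

Section Xi.
Context {R : realType} {n : nat}.
Hypothesis n0 : (0 < n)%N.
Variable p : R.
Hypothesis p1 : (1 < p)%R.
Local Open Scope ereal_scope.
Notation S := (sphere_measure R n.+1).
Notation V := (lebesgue_rV n.+1 (@unit_ball R n.+1)).

Let p0 : (0 < p)%R. Proof. exact: lt_trans p1. Qed.

Lemma Gamma_gt0E (x : R) : (0 < x)%R -> Gamma x = Euler_Gamma x.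
Proof. by move=> x0; rewrite /Gamma x0 addr0 gt_eqF// big_ord0 inve1 mule1. Qed.

Lemma Xi_gt0E : exists g1 g2 g3 : R, [/\ (0 < g1)%R, (0 < g2)%R & (0 < g3)%R] /\
  [/\ Xi n.+1 p = (Num.sqrt pi * g2 / (g1 * g3))%:E,
      Euler_Gamma ((p + 1) / 2) = g1%:E, Euler_Gamma ((n.+1%:R + p) / 2) = g2%:E &
      Euler_Gamma (n.+1%:R / 2) = g3%:E].
Proof.
have n2 : (2 <= n.+1%:R :> R)%R by rewrite ler_nat.
have a1 : (1 <= (p + 1) / 2)%R by rewrite ler_pdivlMr// mul1r [leLHS]mulr2n lerD2r ltW.
have a2 : (1 <= (n.+1%:R + p) / 2)%R by rewrite ler_pdivlMr// mul1r (le_trans n2)// lerDl ltW.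
have a3 : (1 <= n.+1%:R / 2 :> R)%R by rewrite ler_pdivlMr// mul1r.
have E a : (1 <= a)%R -> exists2 g : R, (0 < g)%R & Euler_Gamma a = g%:E.
  move=> aa; have gg := Euler_Gamma_gt0 aa; have gf := Euler_Gamma_lty aa.
  have gn : Euler_Gamma a \is a fin_num by rewrite gt0_fin_numE.
  by exists (fine (Euler_Gamma a)); rewrite ?fineK// fine_gt0// gg.
have [g1 g10 E1] := E _ a1; have [g2 g20 E2] := E _ a2; have [g3 g30 E3] := E _ a3.
exists g1, g2, g3; split; split => //.
rewrite /Xi !Gamma_gt0E; [|exact: lt_le_trans a3|exact: lt_le_trans a1|exact: lt_le_trans a2].
by rewrite E1 E2 E3 -!EFinM inver mulf_eq0 !gt_eqF// -EFinM.
Qed.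

Lemma Xi_bounds : 0 < Xi n.+1 p < +oo.
Proof.
have [g1 [g2 [g3 [[h1 h2 h3] [-> _ _ _]]]]] := Xi_gt0E.
by rewrite ltry andbT lte_fin divr_gt0 ?mulr_gt0// sqrtr_gt0 pi_gt0.
Qed.

(** A rotation carrying the first basis vector to [e] preserves the ball and Lebesgue measure, and
    commutes with [radial]. *)
Lemma rotated_moment (e : 'rV[R]_n.+1) : usphere e ->
  \int[lebesgue_rV n.+1]_(x in unit_ball) (`|dotp (radial x) e| `^ p)%:E =
  \int[lebesgue_rV n.+1]_(x in unit_ball) (`|radial x ord0 ord0| `^ p)%:E.
Proof.
move=> Se; have [Q QQ rQ] := orthogonal_first_row Se.
have mb := @measurable_unit_ball R n.+1.
have mp : measurable_fun setT (fun s : R => `|s| `^ p)%R.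
  by apply: (measurableT_comp (measurable_powR p)); exact: normr_measurable.
have md : measurable_fun setT (fun x : 'rV[R]_n.+1 => (`|dotp (radial x) e| `^ p)%:E).
  apply/measurable_EFinP; apply: (measurableT_comp mp).
  apply: measurable_dotp; first exact: measurable_radial.
  exact: measurable_cst.
rewrite integral_mkcond -(ge0_integral_orthogonal QQ); last 2 first.
- by apply/(measurable_restrictT _ mb); exact: measurable_funTS.
- by apply: erestrict_ge0 => x _; rewrite lee_fin powR_ge0.
rewrite [RHS]integral_mkcond; apply: eq_integral => x _; rewrite !patchE.
have -> : (x *m Q \in unit_ball) = (x \in @unit_ball R n.+1).
  by apply/idP/idP => /set_mem h; apply/mem_set; move: h; rewrite /unit_ball/= enorm_mulmx.
case: ifP => // _; congr (`|_| `^ _)%:E.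
rewrite /radial enorm_mulmx// scalemxAl -rQ rowE dotp_mulmx//.
by rewrite /dotp (bigD1 ord0)//= big1 ?addr0 => [|i i0]; rewrite [X in (_ * X)%R]mxE ?eqxx ?mulr1// (negbTE i0) andbF mulr0.
Qed.

(** By homogeneity and rotation the moment is |v|^p times the one of the first coordinate, given by
    [radial_moment], whose Gamma factors are those of [Xi]. *)
Lemma sphere_moment (v : 'rV[R]_n.+1) :
  \int[S]_(nu in usphere) (`|dotp nu v| `^ p)%:E = (Xi n.+1 p)^-1 * (enorm v `^ p)%:E.
Proof.
have mp : measurable_fun setT (fun s : R => `|s| `^ p)%R.
  by apply: (measurableT_comp (measurable_powR p)); exact: normr_measurable.
have [->|v0] := eqVneq v 0%R.
  rewrite enorm0 powR0 ?gt_eqF// mule0 integral0_eq// => nu _.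
  by rewrite /dotp big1 ?normr0 ?powR0 ?gt_eqF// => i _; rewrite mxE mulr0.
have Se := usphere_radial v0; pose e := radial v.
have ve : v = (enorm v *: e)%R.
  by rewrite /e /radial scalerA divff ?enorm_eq0// scale1r.
have de nu : (`|dotp nu v| `^ p = enorm v `^ p * `|dotp nu e| `^ p)%R.
  rewrite {1}ve /dotp -powRM ?enorm_ge0//; congr (_ `^ _)%R.
  rewrite -[X in (X * _)%R](ger0_norm (enorm_ge0 v)) -normrM mulr_sumr; congr `|_|%R.
  by apply: eq_bigr => i _; rewrite mxE mulrCA.
rewrite integral_sphere; last 3 first.
- apply/measurable_EFinP; apply: (measurableT_comp mp).
  by apply: measurable_dotp; [exact: measurable_id|exact: measurable_cst].
- by move=> x; rewrite lee_fin powR_ge0.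
- by rewrite /dotp big1 ?normr0 ?powR0 ?gt_eqF// => i _; rewrite mxE mul0r.
under eq_integral do rewrite de EFinM.
have me : measurable_fun (@unit_ball R n.+1) (fun x => (`|dotp (radial x) e| `^ p)%:E).
  apply/measurable_EFinP; apply: measurable_funTS; apply: (measurableT_comp mp).
  by apply: measurable_dotp; [exact: measurable_radial|exact: measurable_cst].
have e0 x : @unit_ball R n.+1 x -> 0 <= (`|dotp (radial x) e| `^ p)%:E.
  by rewrite lee_fin powR_ge0.
rewrite (ge0_integralZl_EFin (lebesgue_rV n.+1) (@measurable_unit_ball R n.+1) e0 me (powR_ge0 _ _)).
rewrite rotated_moment//.
have := radial_moment n0 p1; have [g1 [g2 [g3 [[h1 h2 h3] [-> -> -> ->]]]]] := Xi_gt0E.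
set H := \int[_]_(_ in _) _.
have H0 : 0 <= H by apply: integral_ge0 => x _; rewrite lee_fin powR_ge0.
have pi0 : (0 < Num.sqrt (pi : R))%R by rewrite sqrtr_gt0 pi_gt0.
have V0 : (0 < fine V)%R by rewrite fine_gt0// lebesgue_unit_ball_gt0 lebesgue_unit_ball_lty.
have VF : V = (fine V)%:E.
  by rewrite fineK// gt0_fin_numE ?lebesgue_unit_ball_gt0// lebesgue_unit_ball_lty.
rewrite [X in _ = X * _ * _]VF; set w := fine V in V0 *.
case: H H0 => [h _|_|//]; last by rewrite !gt0_mulye ?lte_fin// -!EFinM.
rewrite inver gt_eqF ?divr_gt0 ?mulr_gt0// -!EFinM => -[E]; congr EFin.
apply: (@mulIf _ (w * g2 * Num.sqrt pi)%R); first by rewrite !mulf_neq0 ?gt_eqF.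
transitivity (enorm v `^ p * (h * g2 * Num.sqrt pi))%R; first by field; rewrite gt_eqF.
by rewrite E; field; rewrite !gt_eqF.
Qed.

End Xi.

(** * The theorem *)

Section hardy.
Context {R : realType} {n : nat} (Omega : set 'rV[R]_n.+1).
Hypothesis oO : open Omega.
Local Open Scope ereal_scope.
Implicit Types (nu x : 'rV[R]_n.+1).
Notation L := (lebesgue_rV n.+1).
Notation S := (sphere_measure R n.+1).

Let mO : measurable Omega. Proof. exact: open_measurable_rV. Qed.

Lemma inveM_cancel (X Y : \bar R) : 0 < X < +oo -> X^-1 * (X * Y) = Y.
Proof.
move=> /andP[X0 Xoo]; have Xf : X \is a fin_num by rewrite gt0_fin_numE.
move: X0; rewrite -(fineK Xf) lte_fin => x0.
by rewrite inver gt_eqF// muleA -EFinM mulVf ?gt_eqF// mul1e.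
Qed.

Lemma measurable_epow_rho (r : R) :
  measurable_fun setT (fun z : 'rV[R]_n.+1 * 'rV[R]_n.+1 => epow (rho Omega z.1 z.2) r).
Proof. by apply: measurableT_comp (measurable_epow r) _; exact: measurable_rho. Qed.

(** [mean_dist_powN] carries the factor Xi(N,q), which cancels in [0, +oo] as soon as it is positive
    and finite. *)
Lemma integral_mean_dist (q : R) (f : 'rV[R]_n.+1 -> R) : 0 < Xi n.+1 q < +oo ->
  measurable_fun setT f -> (forall x, (0 <= f x)%R) ->
  (Xi n.+1 q)^-1 * \int[L]_(x in Omega) ((f x)%:E * mean_dist_powN Omega q x) =
  \int[L]_(x in Omega) \int[S]_(nu in usphere) ((f x)%:E * epow (rho Omega nu x) (- q)).
Proof.
move=> X0 mf f0; have Xge : 0 <= Xi n.+1 q by case/andP: X0 => /ltW.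
pose F nu x := (f x)%:E * epow (rho Omega nu x) (- q).
have mF : measurable_fun setT (fun z : 'rV[R]_n.+1 * 'rV[R]_n.+1 => F z.1 z.2).
  apply: emeasurable_funM; last exact: measurable_epow_rho.
  by apply/measurable_EFinP; exact: measurableT_comp mf measurable_snd.
have F0 nu x : 0 <= F nu x by rewrite mule_ge0 ?epow_ge0// lee_fin.
rewrite -[RHS](inveM_cancel _ X0); congr (_ * _).
rewrite -(ge0_integralZl L mO (measurable_sphere_integral oO mF F0) _ Xge); last first.
  by move=> x _; exact: integral_ge0.
apply: eq_integral => x _; rewrite mean_dist_powNE// /mean_dist_integral muleCA; congr (_ * _).
rewrite -ge0_integralZl_EFin//; last 2 first.
- by move=> nu _; exact: epow_ge0.
- apply: measurable_funTS; have := measurable_epow_rho (- q).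
  by move=> m; exact: (measurableT_comp m (pair2_measurable x)).
exact: measurable_usphere.
Qed.

(* If [T = +oo] and [k < 0], the left-hand side of the conclusion is [-oo]. *)
Lemma identity_ge (X Y Z T : \bar R) (k : R) : 0 <= X -> 0 <= Y -> 0 <= Z -> 0 <= T ->
  X + (2 * Num.max (- k) 0)%:E * T = Y + ((2 * Num.max k 0)%:E * T + Z) ->
  Y + (2 * k)%:E * T + Z <= X.
Proof.
move=> X0 Y0 Z0 T0; have [k0|k0] := leP 0%R k.
  rewrite (max_r (_ : - k <= 0)%R) ?oppr_le0// mulr0 mul0e adde0 => ->.
  by rewrite addeA.
rewrite (max_l (_ : 0 <= - k)%R) ?oppr_ge0 ?(ltW k0)// mulr0 mul0e add0e.
case: T T0 => [t _|_|//] E; last first.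
  by rewrite lt0_muley ?lte_fin ?pmulr_rlt0// addeNy addNye leNye.
rewrite addeAC -E -EFinM mulrN mulNr EFinN.
by rewrite -EFinM subeK.
Qed.

Variable u : 'rV[R]_n.+1 -> R.
Hypothesis Cu : class_C 1 u.
Hypothesis su : compactly_supported_in Omega u.
Variable p : R.
Hypothesis p1 : (1 < p)%R.

Let p0 : (0 < p)%R. Proof. exact: lt_trans p1. Qed.

Let mnu : measurable_fun setT (fun x => `|u x| `^ p)%R.
Proof.
apply: (measurableT_comp (measurable_powR p)).
apply: measurableT_comp; first exact: normr_measurable.
by apply: continuous_measurable_rV; have [] := Cu.
Qed.

Let mgrad : measurable_fun setT (fun x => enorm (grad u x) `^ p)%R.
Proof.
apply: (measurableT_comp (measurable_powR p)).
apply: measurableT_comp; first exact: measurable_enorm.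
exact: measurable_grad.
Qed.

Lemma Cp_term_weighted_derive (lambda : R) nu x : Omega x ->
  epow (rho Omega nu x) (- lambda) *
    (Cp p ('D_nu u x) (weighted_derive Omega nu ((p + lambda - 1) / p) u x))%:E =
  Cp_term Omega u p lambda nu x.
Proof. by move=> Ox; rewrite derive_class_C1// (weighted_deriveE oO)//. Qed.

Let identity_eq (A B C G : \bar R) (b c : R) : (0 < b)%R -> c = b ->
  A + (2 * Num.max (- spow p c) 0)%:E * G =
    (`|c| `^ p)%:E * B + ((2 * Num.max (spow p c) 0)%:E * G + C) ->
  A = (b `^ p)%:E * B + (2 * b `^ (p - 1))%:E * G + C.
Proof.
move=> b0 ->; rewrite spow_gt0// (gtr0_norm b0).
rewrite (max_l (powR_ge0 _ _)) (max_r (_ : - _ <= 0)%R) ?oppr_le0 ?powR_ge0//.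
by rewrite mulr0 mul0e adde0 addeA.
Qed.

Theorem hardy_identity : (0 < n)%N ->
  (Xi n.+1 p)^-1 * \int[L]_(x in Omega) (enorm (grad u x) `^ p)%:E =
    (((p - 1) / p) `^ p)%:E *
      ((Xi n.+1 p)^-1 * \int[L]_(x in Omega)
         ((`|u x| `^ p)%:E * mean_dist_powN Omega p x))
    + (2 * ((p - 1) / p) `^ (p - 1))%:E *
      skeletal_mean Omega
        (fun nu m => (`|u m| `^ p)%:E * epow (rho Omega nu m) (1 - p)%R)
    + \int[L]_(x in Omega) \int[S]_(nu in usphere)
        (Cp p ('D_nu u x) (weighted_derive Omega nu ((p - 1) / p) u x))%:E.
Proof.
move=> n0; have Xb := Xi_bounds n0 p1.
have Xge : 0 <= (Xi n.+1 p)^-1 by rewrite inve_ge0; case/andP: Xb => /ltW.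
have b0 : (0 < (p - 1) / p)%R by rewrite divr_gt0// subr_gt0.
have bE : ((p + 0 - 1) / p = (p - 1) / p)%R by rewrite addr0.
have EA : \int[L]_(x in Omega) \int[S]_(nu in usphere) gradient_term Omega u p 0 nu x =
    (Xi n.+1 p)^-1 * \int[L]_(x in Omega) (enorm (grad u x) `^ p)%:E.
  have mg : measurable_fun Omega (fun x => (enorm (grad u x) `^ p)%:E).
    by apply/measurable_EFinP; exact: measurable_funTS.
  have g0 x : Omega x -> 0 <= (enorm (grad u x) `^ p)%:E by rewrite lee_fin powR_ge0.
  rewrite -(ge0_integralZl L mO mg g0 Xge).
  apply: eq_integral => x _; rewrite -(sphere_moment n0 p1); apply: eq_integral => nu _.
  by rewrite /gradient_term oppr0 epowr0 mul1e.
have EB : \int[L]_(x in Omega) \int[S]_(nu in usphere) hardy_term Omega u p 0 nu x =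
    \int[L]_(x in Omega) \int[S]_(nu in usphere) ((`|u x| `^ p)%:E * epow (rho Omega nu x) (- p)).
  by apply: eq_integral => x _; apply: eq_integral => nu _; rewrite /hardy_term add0r.
have EC : \int[L]_(x in Omega) \int[S]_(nu in usphere) Cp_term Omega u p 0 nu x =
    \int[L]_(x in Omega) \int[S]_(nu in usphere)
        (Cp p ('D_nu u x) (weighted_derive Omega nu ((p - 1) / p) u x))%:E.
  apply: eq_integral => x /set_mem Ox; apply: eq_integral => nu _.
  have E := Cp_term_weighted_derive 0%R nu Ox; rewrite bE oppr0 epowr0 mul1e in E.
  exact: esym E.
have EG := skeletal_mean_midpoint_term oO Cu p 0%R.
rewrite subr0 in EG.
have id := sphere_identity oO Cu su 0%R p1.
rewrite (integral_mean_dist Xb mnu (fun x => powR_ge0 _ _)) -[LHS]EA -[X in _ = _ * X + _ + _]EB.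
rewrite -[X in _ = _ + X]EC [X in _ = _ + _ * X + _]EG.
exact: (identity_eq b0 bE id).
Qed.

Theorem weighted_hardy_inequality (lambda : R) :
  0 < Xi n.+1 lambda < +oo -> 0 < Xi n.+1 (lambda + p)%R < +oo ->
  let b := ((p + lambda - 1) / p)%R in
  (Xi n.+1 lambda)^-1 * \int[L]_(x in Omega)
      ((enorm (grad u x) `^ p)%:E * mean_dist_powN Omega lambda x) >=
    (`|b| `^ p)%:E *
      ((Xi n.+1 (lambda + p)%R)^-1 * \int[L]_(x in Omega)
         ((`|u x| `^ p)%:E * mean_dist_powN Omega (lambda + p)%R x))
    + (2 * (b * `|b| `^ (p - 2)))%:E *
      skeletal_mean Omega
        (fun nu m => (`|u m| `^ p)%:E * epow (rho Omega nu m) (1 - p - lambda)%R)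
    + \int[L]_(x in Omega) \int[S]_(nu in usphere)
        (epow (rho Omega nu x) (- lambda)%R *
         (Cp p ('D_nu u x) (weighted_derive Omega nu b u x))%:E).
Proof.
move=> X1 X2; cbv zeta; set b : R := ((p + lambda - 1) / p)%R.
rewrite (integral_mean_dist X1 mgrad (fun x => powR_ge0 _ _)).
rewrite (integral_mean_dist X2 mnu (fun x => powR_ge0 _ _)).
rewrite (skeletal_mean_midpoint_term oO Cu).
have -> : \int[L]_(x in Omega) \int[S]_(nu in usphere)
        (epow (rho Omega nu x) (- lambda)%R *
         (Cp p ('D_nu u x) (weighted_derive Omega nu b u x))%:E) =
    \int[L]_(x in Omega) \int[S]_(nu in usphere) Cp_term Omega u p lambda nu x.
  apply: eq_integral => x /set_mem Ox; apply: eq_integral => nu _.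
  by rewrite -Cp_term_weighted_derive.
have i0 F : (forall nu x, 0 <= F nu x) -> 0 <= \int[L]_(x in Omega) \int[S]_(nu in usphere) F nu x.
  by move=> F0; apply: integral_ge0 => x _; apply: integral_ge0.
have mA := measurable_gradient_term oO Cu p lambda.
have A0 := @gradient_term_ge0 R n.+1 Omega u p lambda.
pose F nu x := (enorm (grad u x) `^ p)%:E * epow (rho Omega nu x) (- lambda).
have mF : measurable_fun setT (fun z : 'rV[R]_n.+1 * 'rV[R]_n.+1 => F z.1 z.2).
  apply: emeasurable_funM; last exact: measurable_epow_rho.
  by apply/measurable_EFinP; exact: measurableT_comp mgrad measurable_snd.
have F0 nu x : 0 <= F nu x by rewrite mule_ge0 ?epow_ge0// lee_fin powR_ge0.
apply: (@le_trans _ _ (\int[L]_(x in Omega) \int[S]_(nu in usphere) gradient_term Omega u p lambda nu x)); last first.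
  have I0 x : Omega x -> 0 <= \int[S]_(nu in usphere) gradient_term Omega u p lambda nu x.
    by move=> _; exact: integral_ge0.
  have mS := @measurable_usphere R n.+1.
  apply: (@ge0_le_integral _ _ _ L Omega mO _ _ I0 (measurable_sphere_integral oO mA A0) (measurable_sphere_integral oO mF F0)).
  move=> x _; have mAx := measurable_funTS (D := usphere) (measurableT_comp mA (pair2_measurable x)).
  have mFx := measurable_funTS (D := usphere) (measurableT_comp mF (pair2_measurable x)).
  apply: (@ge0_le_integral _ _ _ S usphere mS _ _ (fun nu _ => A0 nu x) mAx mFx) => nu Snu.
  rewrite /= /gradient_term muleC; apply: lee_wpmul2r; first exact: epow_ge0.
  rewrite lee_fin ge0_ler_powR ?nnegrE ?enorm_ge0// ?(ltW p0)//.
  by apply: le_trans (dotp_cauchy_schwarz _ _) _; rewrite Snu mul1r.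
have := sphere_identity oO Cu su lambda p1; apply: identity_ge.
- exact: i0.
- rewrite mule_ge0 ?lee_fin ?powR_ge0//; apply: i0 => nu x.
  by rewrite mule_ge0 ?epow_ge0// lee_fin powR_ge0.
- by apply: i0 => nu x; exact: Cp_term_ge0.
- by apply: integral_ge0 => nu _; apply: integral_ge0 => x _; exact: midpoint_term_ge0.
Qed.

End hardy.

Local Open Scope ereal_scope.

Theorem corollary3p17 (R : realType) (N : nat) (hN : (2 <= N)%N)
    (Omega : set 'rV[R]_N) (hdom : domain Omega) (hproper : Omega <> setT)
    (p : R) (hp : (1 < p)%R)
    (u : 'rV[R]_N -> R) (hu : C0infty Omega u) :
  (Xi N p)^-1 * \int[lebesgue_rV N]_(x in Omega) (enorm (grad u x) `^ p)%:E =
    (((p - 1) / p) `^ p)%:E *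
      ((Xi N p)^-1 * \int[lebesgue_rV N]_(x in Omega)
         ((`|u x| `^ p)%:E * mean_dist_powN Omega p x))
    + (2 * ((p - 1) / p) `^ (p - 1))%:E *
      skeletal_mean Omega
        (fun nu m => (`|u m| `^ p)%:E * epow (rho Omega nu m) (1 - p)%R)
    + \int[lebesgue_rV N]_(x in Omega) \int[sphere_measure R N]_(nu in usphere)
        (Cp p ('D_nu u x) (weighted_derive Omega nu ((p - 1) / p) u x))%:E
  /\
  forall lambda : R,
    0 < Xi N lambda < +oo -> 0 < Xi N (lambda + p)%R < +oo ->
    let b := ((p + lambda - 1) / p)%R in
    (Xi N lambda)^-1 * \int[lebesgue_rV N]_(x in Omega)
        ((enorm (grad u x) `^ p)%:E * mean_dist_powN Omega lambda x) >=
      (`|b| `^ p)%:E *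
        ((Xi N (lambda + p)%R)^-1 * \int[lebesgue_rV N]_(x in Omega)
           ((`|u x| `^ p)%:E * mean_dist_powN Omega (lambda + p)%R x))
      + (2 * (b * `|b| `^ (p - 2)))%:E *
        skeletal_mean Omega
          (fun nu m => (`|u m| `^ p)%:E * epow (rho Omega nu m) (1 - p - lambda)%R)
      + \int[lebesgue_rV N]_(x in Omega) \int[sphere_measure R N]_(nu in usphere)
          (epow (rho Omega nu x) (- lambda)%R *
           (Cp p ('D_nu u x) (weighted_derive Omega nu b u x))%:E).
Proof.
have [oO _ _] := hdom; have [/(_ 1%N) Cu su] := hu.
case: N hN Omega hdom hproper u hu oO Cu su => [//|n] n1 Omega _ _ u _ oO Cu su.
split; first exact: hardy_identity.
exact: weighted_hardy_inequality.
Qed.
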